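(* Let $Q=Q^1\sqcup Q^2$ be a deconcatenation at a sink or a source $v$. Assume that there are regular exact Borel subalgebras $B^1\subset A^1$ and $B^2\subset A^2$ containing the sets of idempotents $\{e_i\mid i\in Q_0^1\}$ and $\{e_j\mid j\in Q_0^2\}$, respectively, and that $A$ admits a regular exact Borel subalgebra. Then $B^1\diamond B^2\subset A$ is a regular exact Borel subalgebra of $A$.
   Context: $K$ is an algebraically closed field, $Q$ a finite connected quiver, $I\subset KQ$ an admissible ideal, $A=KQ/I$; modules are finite-dimensional left modules. $L(i),P(i)$ are the simple and its projective cover at $i\in Q_0$ and $e_i$ the trivial path. For a partial order $\trianglelefteq$ on $Q_0$, the standard module $\Delta(i)$ is the largest quotient of $P(i)$ with all composition factors $L(j)$ satisfying $j\trianglelefteq i$. $(A,\trianglelefteq)$ is quasi-hereditary if for each $i$ the kernel of $P(i)\twoheadrightarrow\Delta(i)$ has a filtration with subquotients $\Delta(j)$, $j\triangleright i$, and the kernel of $\Delta(i)\twoheadrightarrow L(i)$ has a filtration with subquotients $L(j)$, $j\triangleleft i$. A deconcatenation $Q=Q^1\sqcup Q^2$ at a sink or source $v$: $Q^1,Q^2$ are connected full subquivers of $Q$ with $Q_0=Q^1_0\cup Q^2_0$, $Q^1_0\cap Q^2_0=\{v\}$, and no arrows in $Q$ between vertices of $Q^1_0\setminus\{v\}$ and of $Q^2_0\setminus\{v\}$. Put $A^\ell=A/\langle e_u\mid u\in Q_0\setminus Q_0^\ell\rangle$ for $\ell=1,2$. A partial order $\trianglelefteq$ on $Q_0$ is fixed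 with $(A,\trianglelefteq)$ quasi-hereditary; $\trianglelefteq^\ell$ is its restriction to $Q_0^\ell$, for which $A^\ell$ is quasi-hereditary. Regular exact Borel subalgebras of $A$, $A^\ell$ are with respect to $\trianglelefteq$, $\trianglelefteq^\ell$. Gluing: identify $A^\ell$ with the subspace of $A$ spanned by the (classes of) paths in $Q^\ell$; this subspace is closed under multiplication and $A^1\cap A^2=Ke_v$. If $B^1\subset A^1$ has a basis $\{b_1,\dots,b_p,e_v\}$ and $B^2\subset A^2$ has a basis $\{c_1,\dots,c_q,e_v\}$, then $B^1\diamond B^2\subset A$ is the subalgebra with basis $\{b_1,\dots,b_p,c_1,\dots,c_q,e_v\}$, i.e. the span of $B^1$ and $B^2$ in $A$. Regular exact Borel subalgebra: let $(\Lambda,\trianglelefteq)$ be quasi-hereditary with $n$ simple modules up to isomorphism. A subalgebra $B\subset\Lambda$ is an exact Borel subalgebra if (i) $B$ also has $n$ simple modules $L_B(i)$ up to isomorphism, indexed by the same set, and $(B,\trianglelefteq)$ is quasi-hereditary with simple standard modules; (ii) $\Lambda\otimes_B-$ is exact; (iii) $\Lambda\otimes_B L_B(i)\cong\Delta_\Lambda(i)$ for all $i$. It is regular if moreover the maps $\operatorname{Ext}_B^k(L_B(i),L_B(j))\to\operatorname{Ext}_\Lambda^k(\Lambda\otimes_BL_B(i),\Lambda\otimes_BL_B(j))$ induced by $\Lambda\otimes_B-$ are isomorphisms for all $k\ge 1$ and all $i,j$. *)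

(* Defs.v *)
From HB Require Import structures.
From mathcomp Require Import all_boot all_algebra all_field.
From mathcomp Require Import boolp.
From mathcomp Require Import freeg.

Set Implicit Arguments.
Unset Strict Implicit.
Unset Printing Implicit Defensive.

Import GRing.Theory.
Local Open Scope ring_scope.
Local Open Scope quotient_scope.

Record quiver := Quiver {
  vertex : finType;
  arrow : finType;
  src : arrow -> vertex;
  tgt : arrow -> vertex }.

(* [pend i s] is the endpoint of the walk starting at [i] and running through
   the arrows of [s] in order of traversal; [walk i s] says that this walk
   makes sense. *)
Definition pend (Q : quiver) (i : vertex Q) (s : seq (arrow Q)) : vertex Q :=
  last i (map (@tgt Q) s).

Fixpoint walk (Q : quiver) (i : vertex Q) (s : seq (arrow Q)) : bool :=
  if s is a :: s' then (src a == i) && walk (tgt a) s' else true.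

Definition qpath (Q : quiver) :=
  {p : vertex Q * seq (arrow Q) | walk p.1 p.2}.

Section Paths.
Variable Q : quiver.
Implicit Types (i : vertex Q) (s : seq (arrow Q)) (p q : qpath Q).

Definition psrc p : vertex Q := (val p).1.
Definition parr p : seq (arrow Q) := (val p).2.
Definition ptgt p : vertex Q := pend (psrc p) (parr p).
Definition plen p : nat := size (parr p).

Definition mkpath i s (w : walk i s) : qpath Q :=
  exist (fun p : vertex Q * seq (arrow Q) => is_true (walk p.1 p.2)) (i, s) w.

Definition triv i : qpath Q := @mkpath i [::] isT.

Lemma pend_cat i s1 s2 : pend i (s1 ++ s2) = pend (pend i s1) s2.
Proof. by rewrite /pend map_cat last_cat. Qed.

Lemma walk_cat i s1 s2 : walk i (s1 ++ s2) = walk i s1 && walk (pend i s1) s2.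
Proof.
elim: s1 i => [|a s1 IH] i //=.
by rewrite IH -andbA.
Qed.

Fact pcomp_subproof p q : ptgt q = psrc p -> walk (psrc q) (parr q ++ parr p).
Proof.
by move=> e; rewrite walk_cat (valP q) -/(ptgt q) e (valP p).
Qed.

(* The product is written as for composition of maps, so that left modules over
   the path algebra are covariant representations: [pcomp p q] is [q] followed
   by [p], and is [None] if they do not compose. *)
Definition pcomp p q : option (qpath Q) :=
  if ptgt q =P psrc p is ReflectT e then
    Some (mkpath (pcomp_subproof e))
  else None.

Lemma pcompP p q r : pcomp p q = Some r <->
  [/\ ptgt q = psrc p, psrc r = psrc q & parr r = parr q ++ parr p].
Proof.
rewrite /pcomp; case: eqP => [e|ne]; last by split=> // -[] /ne.
split=> [[<-] //|[_ e1 e2]].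
apply: congr1; apply: val_inj => /=.
by rewrite -e1 -e2 /psrc /parr -surjective_pairing.
Qed.

Lemma ptgt_comp p q r : pcomp p q = Some r -> ptgt r = ptgt p.
Proof.
by case/pcompP=> e e1 e2; rewrite /ptgt e1 e2 pend_cat -/(ptgt q) e.
Qed.

Lemma pcompA p q r :
  obind (pcomp p) (pcomp q r) = obind (fun x => pcomp x r) (pcomp p q).
Proof.
case qr: (pcomp q r) => [x|]; case pq: (pcomp p q) => [y|] //=.
- case/pcompP: (qr) => a1 a2 a3; case/pcompP: (pq) => b1 b2 b3.
  have [z Hz] : exists z, pcomp p x = Some z.
    rewrite /pcomp; case: eqP => [e|[]]; first by eexists.
    by rewrite (ptgt_comp qr).
  rewrite Hz; apply/esym/pcompP; case/pcompP: Hz => c1 c2 c3.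
  by split; rewrite ?a1 ?b2 // ?c2 // c3 b3 a3 catA.
- case px: (pcomp p x) => [z|] //; case/pcompP: px => c1 _ _.
  have := ptgt_comp qr; rewrite c1 => e.
  by move: pq; rewrite /pcomp; case: eqP => // -[]; rewrite e.
- case yr: (pcomp y r) => [z|] //; case/pcompP: yr => c1 _ _.
  case/pcompP: pq => _ e _.
  by move: qr; rewrite /pcomp; case: eqP => // -[]; rewrite c1 e.
Qed.

Lemma pcomp_trivl i q : pcomp (triv i) q = if ptgt q == i then Some q else None.
Proof.
case: eqP => e; first by apply/pcompP; rewrite cats0.
by rewrite /pcomp; case: eqP.
Qed.

Lemma pcomp_trivr p i : pcomp p (triv i) = if psrc p == i then Some p else None.
Proof.
case: eqP => [e|e]; first by apply/pcompP.
by rewrite /pcomp; case: eqP => // h; case: e.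
Qed.
End Paths.

Section FglLinear.
Variables (R : comNzRingType) (T : choiceType).

Fact fglift_is_linear (V : lmodType R) (h : T -> V) :
  linear (fglift h : {freeg T / R} -> V).
Proof.
have hB : additive (fglift h : {freeg T / R} -> V) by exact: lift_is_additive.
pose H := GRing.isZmodMorphism.Build _ _ (fglift h : {freeg T / R} -> V) hB.
pose f : {additive {freeg T / R} -> V} := HB.pack (fglift h) H.
have hD x y : fglift h (x + y) = fglift h x + fglift h y by exact: (raddfD f).
have hS I (s : seq I) F : fglift h (\sum_(i <- s) F i) =
    \sum_(i <- s) fglift h (F i) by exact: (raddf_sum f).
move=> a x y; rewrite hD; congr (_ + _).
rewrite -[x in LHS]freeg_sumE scaler_sumr !hS.
rewrite -[x in RHS]freeg_sumE hS scaler_sumr.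
apply: eq_bigr => t _; rewrite !liftU.
suff -> : a *: << coeff t x *g t >> = << a * coeff t x *g t >> by
  rewrite liftU scalerA.
by apply/eqP/freeg_eqP => u; rewrite coeffZ !coeffU mulrA.
Qed.

HB.instance Definition _ (V : lmodType R) (h : T -> V) :=
  GRing.isLinear.Build R {freeg T / R} V _ (fglift h) (fglift_is_linear h).

Lemma freeg_linear_ext (V : lmodType R) (f g : {linear {freeg T / R} -> V}) :
  (forall t, f << t >> = g << t >>) -> f =1 g.
Proof.
move=> e x; rewrite -[x]freeg_sumE !linear_sum; apply: eq_bigr => t _.
have -> : << coeff t x *g t >> = coeff t x *: << t >> :> {freeg T / R}.
  by apply/eqP/freeg_eqP => u; rewrite coeffZ !coeffU mul1r.
by rewrite !linearZ e.
Qed.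
End FglLinear.

(* The path algebra: free K-module on the paths, product of two paths being
   their composite, or zero if they do not compose. *)
Definition pathalg (K : fieldType) (Q : quiver) := {freeg (qpath Q) / K}.

Section PathAlgebra.
Variables (K : fieldType) (Q : quiver).
Notation KQ := (pathalg K Q).
Implicit Types (p q r : qpath Q) (x y z : KQ).

HB.instance Definition _ := GRing.Lmodule.on KQ.

Definition pathof p : KQ := << p >>.

Definition pathof_opt (o : option (qpath Q)) : KQ :=
  if o is Some r then pathof r else 0.

Definition kqmul x y : KQ :=
  fglift (fun p => fglift (fun q => pathof_opt (pcomp p q)) y) x.

Definition kq1 : KQ := \sum_(i : vertex Q) pathof (triv i).

Definition kqmulr y x : KQ := kqmul x y.

Lemma kqmul_linl y : linear (kqmulr y).
Proof. by move=> a x x'; rewrite /kqmulr /kqmul linearP. Qed.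

Lemma kqmul_linr x : linear (kqmul x).
Proof.
move=> a y y'; rewrite /kqmul.
pose F z : KQ -> KQ := fglift (fun p => fglift (fun q => pathof_opt (pcomp p q)) z).
pose G : KQ -> KQ := fun x => a *: F y x + F y' x.
have Glin : linear G.
  by move=> b u v; rewrite /G /F !linearP /= !scalerA [b * a]mulrC addrACA.
pose Gl : {linear KQ -> KQ} := HB.pack G (GRing.isLinear.Build _ _ _ _ G Glin).
rewrite -[RHS]/(Gl x); apply: (@freeg_linear_ext K (qpath Q)).
by move=> p; rewrite /= /G /F !liftU !scale1r linearP.
Qed.

HB.instance Definition _ y :=
  GRing.isLinear.Build K KQ KQ _ (kqmulr y) (kqmul_linl y).
HB.instance Definition _ x :=
  GRing.isLinear.Build K KQ KQ _ (kqmul x) (kqmul_linr x).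

Lemma kqmul_path p q : kqmul (pathof p) (pathof q) = pathof_opt (pcomp p q).
Proof. by rewrite /kqmul !liftU !scale1r. Qed.

Lemma kqmulA : associative kqmul.
Proof.
move=> x y z.
have E (f g : {linear KQ -> KQ}) : (forall p, f (pathof p) = g (pathof p)) ->
  f =1 g by move=> e; apply: (@freeg_linear_ext K (qpath Q)).
pose l1 : {linear KQ -> KQ} := kqmulr (kqmul y z).
pose r1 : {linear KQ -> KQ} := (kqmulr z \o kqmulr y).
apply: (E l1 r1) => p; rewrite /l1 /r1 /=.
pose l2 : {linear KQ -> KQ} := (kqmul (pathof p) \o kqmulr z).
pose r2 : {linear KQ -> KQ} := (kqmulr z \o kqmul (pathof p)).
apply: (E l2 r2) => q; rewrite /l2 /r2 /=.
pose l3 : {linear KQ -> KQ} := (kqmul (pathof p) \o kqmul (pathof q)).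
pose r3 : {linear KQ -> KQ} := kqmul (kqmul (pathof p) (pathof q)).
apply: (E l3 r3) => r; rewrite /l3 /r3 /= !kqmul_path.
have Ol o : kqmul (pathof p) (pathof_opt o) = pathof_opt (obind (pcomp p) o).
  by case: o => [t|] /=; rewrite ?kqmul_path ?linear0.
have Or o : kqmul (pathof_opt o) (pathof r) =
    pathof_opt (obind (fun t => pcomp t r) o).
  case: o => [t|] /=; first by rewrite kqmul_path.
  by rewrite -[LHS]/((kqmulr (pathof r)) 0) linear0.
by rewrite Ol Or pcompA.
Qed.

Lemma kqmul1l : left_id kq1 kqmul.
Proof.
move=> x; pose l : {linear KQ -> KQ} := kqmul kq1.
pose r : {linear KQ -> KQ} := idfun.
rewrite -[RHS]/(r x) -[LHS]/(l x); apply: (@freeg_linear_ext K (qpath Q)) => p.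
rewrite /l /r /= -/(pathof p) -[LHS]/((kqmulr (pathof p)) kq1) linear_sum /= /kqmulr.
rewrite (bigD1 (ptgt p)) //= big1 => [|i ni].
  by rewrite addr0 kqmul_path pcomp_trivl eqxx.
by rewrite kqmul_path pcomp_trivl eq_sym (negbTE ni).
Qed.

Lemma kqmul1r : right_id kq1 kqmul.
Proof.
move=> x; pose l : {linear KQ -> KQ} := kqmulr kq1.
pose r : {linear KQ -> KQ} := idfun.
rewrite -[RHS]/(r x) -[LHS]/(l x); apply: (@freeg_linear_ext K (qpath Q)) => p.
rewrite /l /r /= -/(pathof p) /kqmulr linear_sum /=.
rewrite (bigD1 (psrc p)) //= big1 => [|i ni].
  by rewrite addr0 kqmul_path pcomp_trivr eqxx.
by rewrite kqmul_path pcomp_trivr eq_sym (negbTE ni).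
Qed.

Lemma kqmulDl : left_distributive kqmul +%R.
Proof. by move=> x y z; rewrite -[LHS]/((kqmulr z) (x + y)) linearD. Qed.

Lemma kqmulDr : right_distributive kqmul +%R.
Proof. by move=> x y z; rewrite linearD. Qed.

HB.instance Definition _ := GRing.Zmodule_isPzRing.Build KQ
  kqmulA kqmul1l kqmul1r kqmulDl kqmulDr.

Lemma kqscaleAl (a : K) x y : a *: (x * y) = (a *: x) * y.
Proof. by rewrite -[RHS]/((kqmulr y) (a *: x)) linearZ. Qed.

Lemma kqscaleAr (a : K) x y : a *: (x * y) = x * (a *: y).
Proof. by rewrite -[RHS]/(kqmul x (a *: y)) linearZ. Qed.
End PathAlgebra.

(* [tensor f M] is the tensor product of A and M over B, where B acts on A on
   the right through f : B -> A: the free abelian group on A * M modulo the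
   biadditivity and balancing relations. *)
Section Tensor.
Variables (A B : nzRingType) (f : B -> A).

Section Object.
Variable M : lmodType B.
Notation F := {freeg (A * M)%type / int}.

Inductive tensor_rel : F -> Prop :=
| TRel0 : tensor_rel 0
| TRelB x y : tensor_rel x -> tensor_rel y -> tensor_rel (x - y)
| TRelDl a a' m : tensor_rel (<< (a + a', m) >> - << (a, m) >> - << (a', m) >>)
| TRelDr a m m' : tensor_rel (<< (a, m + m') >> - << (a, m) >> - << (a, m') >>)
| TRelZ a b m : tensor_rel (<< (a * f b, m) >> - << (a, b *: m) >>).

Definition tensor_pred : {pred F} := fun x => `[< tensor_rel x >].

Lemma tensor_predE x : x \in tensor_pred = `[< tensor_rel x >].
Proof. by []. Qed.

Fact tensor_zmod_closed : zmod_closed tensor_pred.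
Proof.
split=> [|x y]; rewrite !tensor_predE; first exact/asboolP/TRel0.
by move=> /asboolP hx /asboolP hy; apply/asboolP/TRelB.
Qed.

HB.instance Definition _ :=
  GRing.isZmodClosed.Build F tensor_pred tensor_zmod_closed.

Definition tensor := {ideal_quot tensor_pred}.

HB.instance Definition _ := GRing.Zmodule.on tensor.

Definition tpi (x : F) : tensor := \pi_({ideal_quot tensor_pred}) x.

Fact tpi_is_additive : zmod_morphism tpi.
Proof. by move=> x y; rewrite /tpi raddfB. Qed.

HB.instance Definition _ :=
  GRing.isZmodMorphism.Build F tensor tpi tpi_is_additive.

Definition ptensor (a : A) (m : M) : tensor := tpi << (a, m) >>.

Lemma tpi_eqP x y : tpi x = tpi y <-> tensor_rel (x - y).
Proof.
have e := Quotient.idealrBE tensor_pred x y.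
rewrite /tpi; split=> [h|/asboolP h].
  by apply/asboolP; rewrite -tensor_predE e h.
by apply/eqP; rewrite -e tensor_predE.
Qed.

Definition trepr (t : tensor) : F := repr (t : {ideal_quot tensor_pred}).

Lemma treprK t : tpi (trepr t) = t.
Proof. exact: reprK. Qed.
End Object.

Section Lift.
Variables (M N : lmodType B) (h : A * M -> {freeg (A * N)%type / int}).

Definition tlift (t : tensor M) : tensor N := tpi (fglift h (trepr t)).

Definition tlift_compat :=
  [/\ forall a a' m, tensor_rel (h (a + a', m) - h (a, m) - h (a', m)),
      forall a m m', tensor_rel (h (a, m + m') - h (a, m) - h (a, m'))
    & forall a b m, tensor_rel (h (a * f b, m) - h (a, b *: m))].

Hypothesis hP : tlift_compat.

Lemma tlift_rel x : tensor_rel x -> tensor_rel (fglift h x).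
Proof.
have [h1 h2 h3] := hP.
elim=> [|u v _ IHu _ IHv|a a' m|a m m'|a b m].
- by rewrite linear0; apply: TRel0.
- by rewrite linearB; apply: TRelB.
- by rewrite !linearB /= !liftU !scale1r.
- by rewrite !linearB /= !liftU !scale1r.
- by rewrite !linearB /= !liftU !scale1r.
Qed.

Lemma tliftE x : tlift (tpi x) = tpi (fglift h x).
Proof.
apply/tpi_eqP; rewrite -linearB; apply: tlift_rel.
by apply/tpi_eqP; rewrite treprK.
Qed.

Lemma tlift_is_additive : zmod_morphism tlift.
Proof.
move=> t u; rewrite -[t]treprK -[u]treprK -raddfB !tliftE -raddfB.
by rewrite linearB.
Qed.
End Lift.

Lemma tensor_ind_additive (M : lmodType B) (V : zmodType)
    (u v : {additive tensor M -> V}) :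
  (forall a m, u (ptensor a m) = v (ptensor a m)) -> u =1 v.
Proof.
move=> e t; rewrite -[t]treprK -[trepr t]freeg_sumE !raddf_sum.
apply: eq_bigr => -[a m] _ /=.
have -> k (p : A * M) : << k *g p >> = << p >> *~ k :> {freeg (A * M)%type / int}.
  by rewrite freeg_mulz -mulrzl; congr << _ *g _ >>; rewrite mulr1 intz.
by rewrite !raddfMz -/(ptensor a m) e.
Qed.

Section Action.
Variable M : lmodType B.

Fact tact_compat (a : A) :
  tlift_compat (fun p : A * M => << (a * p.1, p.2) >>).
Proof.
split=> [b b' m|b m m'|b c m] /=.
- by rewrite mulrDr; apply: TRelDl.
- exact: TRelDr.
- by rewrite mulrA; apply: TRelZ.
Qed.

Definition tact (a : A) : tensor M -> tensor M :=
  tlift (fun p : A * M => << (a * p.1, p.2) >>).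

Fact tact_is_additive a : zmod_morphism (tact a).
Proof. exact/tlift_is_additive/tact_compat. Qed.

HB.instance Definition _ a :=
  GRing.isZmodMorphism.Build (tensor M) (tensor M) (tact a) (tact_is_additive a).

Lemma tact_ptensor a b m : tact a (ptensor b m) = ptensor (a * b) m.
Proof.
by rewrite /tact /ptensor (tliftE (tact_compat a)) liftU scale1r.
Qed.

Lemma tactA a b t : tact a (tact b t) = tact (a * b) t.
Proof.
apply: (tensor_ind_additive (u := tact a \o tact b) (v := tact (a * b))).
by move=> c m /=; rewrite !tact_ptensor mulrA.
Qed.

Lemma tact1 : left_id 1 tact.
Proof.
move=> t; apply: (tensor_ind_additive (u := tact 1) (v := idfun)) => b m /=.
by rewrite tact_ptensor mul1r.
Qed.

Lemma tactDr : right_distributive tact +%R.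
Proof. by move=> a t u; rewrite raddfD. Qed.

Lemma tactDl t : {morph tact^~ t : a b / a + b}.
Proof.
move=> a b; rewrite -[t]treprK; move: (trepr t) => x.
apply: (tensor_ind_additive (u := tact (a + b)) (v := tact a \+ tact b)).
move=> c m /=; rewrite !tact_ptensor mulrDl /ptensor -raddfD.
apply/tpi_eqP; rewrite opprD addrA; exact: TRelDl.
Qed.

HB.instance Definition _ :=
  GRing.Zmodule_isLmodule.Build A (tensor M) tactA tact1 tactDr tactDl.

Lemma tensor_scaleE (a b : A) (m : M) : a *: ptensor b m = ptensor (a * b) m.
Proof. exact: tact_ptensor. Qed.
End Action.

Section Functor.
Variables (M N : lmodType B) (g : {linear M -> N}).

Fact tmap_compat : tlift_compat (fun p : A * M => << (p.1, g p.2) >>).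
Proof.
split=> [b b' m|b m m'|b c m] /=.
- exact: TRelDl.
- by rewrite linearD; apply: TRelDr.
- by rewrite linearZ; apply: TRelZ.
Qed.

Definition tmap : tensor M -> tensor N :=
  tlift (fun p : A * M => << (p.1, g p.2) >>).

Fact tmap_is_additive : zmod_morphism tmap.
Proof. exact/tlift_is_additive/tmap_compat. Qed.

HB.instance Definition _ :=
  GRing.isZmodMorphism.Build (tensor M) (tensor N) tmap tmap_is_additive.

Lemma tmap_ptensor a m : tmap (ptensor a m) = ptensor a (g m).
Proof. by rewrite /tmap /ptensor (tliftE tmap_compat) liftU scale1r. Qed.

Fact tmap_is_scalable : scalable tmap.
Proof.
move=> a t.
apply: (tensor_ind_additive (u := tmap \o tact a) (v := tact a \o tmap)).
by move=> b m /=; rewrite tact_ptensor !tmap_ptensor tact_ptensor.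
Qed.

HB.instance Definition _ :=
  GRing.isScalable.Build A (tensor M) (tensor N) _ tmap tmap_is_scalable.
End Functor.
End Tensor.

Section Modules.
Variables (K : fieldType) (A : falgType K).
Implicit Types M N P D S X Y Z : lmodType A.

(* K acts on an A-module through k%:A. *)
Definition findim M : Prop :=
  exists (n : nat) (b : 'I_n -> M), forall x : M,
    exists c : 'I_n -> K, x = \sum_(i < n) (c i)%:A *: b i.

Definition isom M N : Prop := exists g : {linear M -> N}, bijective g.

Definition surj_lin M N (g : {linear M -> N}) : Prop :=
  forall y, exists x, g x = y.

Definition exact_at M N P (g : {linear M -> N}) (h : {linear N -> P}) : Prop :=
  forall y, h y = 0 <-> exists x, g x = y.

Definition short_exact M N P (g : {linear M -> N}) (h : {linear N -> P}) : Prop :=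
  [/\ injective g, exact_at g h & surj_lin h].

Definition simple_module M : Prop :=
  (exists x : M, x != 0) /\
  forall U : {pred M}, submod_closed U ->
    (forall x, x \in U -> x = 0) \/ (forall x, x \in U).

(* [filtered C M]: M has a finite filtration by submodules, starting at 0, whose
   subquotients belong to the class C. *)
Inductive filtered (C : lmodType A -> Prop) : lmodType A -> Prop :=
| Filtered0 M : (forall x : M, x = 0) -> filtered C M
| FilteredS M N S (g : {linear M -> N}) (h : {linear N -> S}) :
    filtered C M -> short_exact g h -> C S -> filtered C N.

Definition ker_filtered (C : lmodType A -> Prop) M N (g : {linear M -> N}) : Prop :=
  exists (Z : lmodType A) (k : {linear Z -> M}),
    [/\ injective k, exact_at k g & filtered C Z].

Definition projective P : Prop :=
  findim P /\
  forall X Y (g : {linear X -> Y}) (h : {linear P -> Y}),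
    findim X -> findim Y -> surj_lin g ->
    exists h' : {linear P -> X}, forall x, g (h' x) = h x.

Definition projective_cover P M (p : {linear P -> M}) : Prop :=
  [/\ projective P, surj_lin p
    & forall (X : lmodType A) (u : {linear X -> P}),
        surj_lin (p \o u) -> surj_lin u].

Variables (I : finType) (L : I -> lmodType A) (ord : rel I).

Definition partial_order : Prop :=
  [/\ reflexive ord, antisymmetric ord & transitive ord].

Definition sord (i j : I) : bool := (i != j) && ord i j.

Definition simple_modules : Prop :=
  [/\ forall i, simple_module (L i),
      forall i j, isom (L i) (L j) -> i = j
    & forall M, simple_module M -> exists i, isom M (L i)].

(* All composition factors of M are of the form L j with j below i: by
   Jordan-Hoelder this can be read off any one composition series. *)
Definition factors_below (i : I) M : Prop :=
  filtered (fun S => exists2 j, ord j i & isom S (L j)) M.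

(* [q] exhibits D as the largest quotient of P with composition factors L j,
   j below i. *)
Definition standard_quotient (i : I) P D (q : {linear P -> D}) : Prop :=
  [/\ surj_lin q, factors_below i D
    & forall (X : lmodType A) (g : {linear P -> X}),
        surj_lin g -> factors_below i X ->
        exists h : {linear D -> X}, forall x, h (q x) = g x].

Definition standard (i : I) D : Prop :=
  exists P (p : {linear P -> L i}) (q : {linear P -> D}),
    projective_cover p /\ standard_quotient i q.

Definition quasi_hereditary : Prop :=
  forall i : I, exists P D
    (p : {linear P -> L i}) (q : {linear P -> D}) (r : {linear D -> L i}),
    [/\ projective_cover p, standard_quotient i q, forall x, r (q x) = p x,
        ker_filtered (fun S => exists2 j, sord i j & standard j S) q
      & ker_filtered (fun S => exists2 j, sord j i & isom S (L j)) r].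
End Modules.

Section Resolutions.
Variables (K : fieldType) (A : falgType K).

(* A bare sequence of maps; exactness is imposed by [proj_resolution]. *)
Record chain_data := ChainData {
  cobj :> nat -> lmodType A;
  cdiff : forall k, {linear cobj k.+1 -> cobj k} }.

Definition proj_resolution (M : lmodType A) (P : chain_data)
    (eps : {linear P 0%N -> M}) : Prop :=
  [/\ forall k, projective (P k), surj_lin eps,
      exact_at (cdiff P 0) eps
    & forall k, exact_at (cdiff P k.+1) (cdiff P k)].

(* Ext^(k+1)(M, N) is the space of cocycles P k.+1 -> N modulo coboundaries, for
   a projective resolution P of M. *)
Definition cocycle (P : chain_data) (N : lmodType A) k (g : {linear P k -> N}) : Prop :=
  forall x, g (cdiff P k x) = 0.

Definition coboundary (P : chain_data) (N : lmodType A) k (g : P k.+1 -> N) : Prop :=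
  exists h : {linear P k -> N}, forall x, g x = h (cdiff P k x).
End Resolutions.

Section ExactBorel.
Variables (K : fieldType) (A : falgType K).

Section Induction.
Variable B : {aspace A}.

Definition induced (M : lmodType (subvs_of B)) : lmodType A :=
  tensor (@vsval _ _ B) M.

Definition induced_map (M N : lmodType (subvs_of B)) (g : {linear M -> N}) :
    {linear induced M -> induced N} := @tmap _ _ (@vsval _ _ B) M N g.

Definition induction_exact : Prop :=
  forall (M N P : lmodType (subvs_of B)) (g : {linear M -> N}) (h : {linear N -> P}),
    findim M -> findim N -> findim P ->
    short_exact g h -> short_exact (induced_map g) (induced_map h).

(* The map Ext_B^(k+1)(M, N) -> Ext_A^(k+1)(FM, FN) induced by the exact functor
   F = induced is an isomorphism: for projective resolutions P of M and R of FM
   and a chain map c : R -> FP over the identity of FM, it sends the class of a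
   cocycle g : P k.+1 -> N to the class of F g \o c k.+1. *)
Definition ext_iso (k : nat) (M N : lmodType (subvs_of B)) : Prop :=
  forall (P : chain_data (subvs_of B)) (eps : {linear P 0%N -> M})
         (R : chain_data A) (eta : {linear R 0%N -> induced M})
         (c : forall n, {linear R n -> induced (P n)}),
    proj_resolution eps -> proj_resolution eta ->
    (forall x, induced_map eps (c 0%N x) = eta x) ->
    (forall n x, c n (cdiff R n x) = induced_map (cdiff P n) (c n.+1 x)) ->
    (forall g : {linear P k.+1 -> N}, cocycle g ->
       coboundary (induced_map g \o c k.+1) -> coboundary g) /\
    (forall h : {linear R k.+1 -> induced N}, cocycle h ->
       exists2 g : {linear P k.+1 -> N}, cocycle g
         & coboundary (fun x => h x - induced_map g (c k.+1 x))).
End Induction.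

Variables (I : finType) (L : I -> lmodType A) (ord : rel I).

Definition regular_exact_Borel (U : {vspace A}) : Prop :=
  exists2 B : {aspace A}, (B : {vspace A}) = U & 1 \in U /\
  exists LB : I -> lmodType (subvs_of B),
    [/\ simple_modules LB,
        quasi_hereditary LB ord /\ (forall i, standard LB ord i (LB i)),
        induction_exact B,
        forall i, exists2 D, standard L ord i D & isom (induced (LB i)) D
      & forall k i j, ext_iso k (LB i) (LB j)].
End ExactBorel.

Section BoundQuiver.
Variables (K : fieldType) (Q : quiver).
Notation KQ := (pathalg K Q).

Definition two_sided_ideal (I : KQ -> Prop) : Prop :=
  [/\ I 0, forall x y, I x -> I y -> I (x + y)
    & forall x y, I x -> I (y * x) /\ I (x * y)].

(* The m-th power of the arrow ideal: the span of the paths of length >= m. *)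
Definition arrow_ideal (m : nat) (x : KQ) : Prop :=
  forall p, coeff p x != 0 -> (m <= plen p)%N.

Definition admissible (I : KQ -> Prop) : Prop :=
  two_sided_ideal I /\
  exists2 m, (2 <= m)%N & (forall x, arrow_ideal m x -> I x) /\
                          (forall x, I x -> arrow_ideal 2 x).

(* [phi] exhibits A as the quotient algebra KQ/I. *)
Definition bound_quiver_algebra (I : KQ -> Prop) (A : falgType K)
    (phi : {linear KQ -> A}) : Prop :=
  [/\ monoid_morphism phi, forall y, exists x, phi x = y
    & forall x, phi x = 0 <-> I x].

Definition videm (A : falgType K) (phi : {linear KQ -> A}) (i : vertex Q) : A :=
  phi (pathof K (triv i)).

(* L i is the simple module on which e i does not vanish. *)
Definition vertex_simples (A : falgType K) (J : finType) (e : J -> A)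
    (L : J -> lmodType A) : Prop :=
  forall i, simple_module (L i) /\ exists x : L i, e i *: x != 0.

(* Full subquivers are given by their sets of vertices. *)
Definition adjacent (i j : vertex Q) : bool :=
  [exists a : arrow Q, ((src a == i) && (tgt a == j)) ||
                       ((src a == j) && (tgt a == i))].

Definition connected_on (V : {set vertex Q}) : Prop :=
  V != set0 /\
  {in V &, forall i j,
     connect (fun k l => [&& k \in V, l \in V & adjacent k l]) i j}.

Definition sink (v : vertex Q) : Prop := forall a : arrow Q, src a != v.
Definition source (v : vertex Q) : Prop := forall a : arrow Q, tgt a != v.

Definition deconcatenation (V1 V2 : {set vertex Q}) (v : vertex Q) : Prop :=
  [/\ sink v \/ source v, connected_on V1 /\ connected_on V2,
      V1 :|: V2 = [set: vertex Q], V1 :&: V2 = [set v]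
    & forall a : arrow Q,
        ~~ ((src a \in V1 :\ v) && (tgt a \in V2 :\ v)) /\
        ~~ ((src a \in V2 :\ v) && (tgt a \in V1 :\ v))].

(* [pi] exhibits A' as the quotient of A by the two-sided ideal generated by the
   idempotents at the vertices outside V. *)
Definition vertex_quotient (A : falgType K) (phi : {linear KQ -> A})
    (V : {set vertex Q}) (A' : falgType K) (pi : {lrmorphism A -> A'}) : Prop :=
  (forall y, exists x, pi x = y) /\
  (forall x, pi x = 0 <->
     x \in ({:A} * <<[seq videm phi u | u in ~: V]>> * {:A})%VS).

Definition path_in (V : {set vertex Q}) (p : qpath Q) : bool :=
  (psrc p \in V) && all (fun a => (src a \in V) && (tgt a \in V)) (parr p).

(* The subspace of A spanned by the classes of the paths inside V. *)
Definition path_span (A : falgType K) (phi : {linear KQ -> A})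
    (V : {set vertex Q}) (x : A) : Prop :=
  exists2 f : KQ, (forall p, coeff p f != 0 -> path_in V p) & phi f = x.

(* A subspace of the vertex quotient A', seen inside A through the
   identification of A' with [path_span phi V]. *)
Definition in_path_span (A : falgType K) (phi : {linear KQ -> A})
    (V : {set vertex Q}) (A' : falgType K) (pi : {lrmorphism A -> A'})
    (B : {vspace A'}) (x : A) : Prop :=
  path_span phi V x /\ pi x \in B.

Definition glue (A : falgType K) (phi : {linear KQ -> A})
    (V1 V2 : {set vertex Q}) (A1 A2 : falgType K)
    (pi1 : {lrmorphism A -> A1}) (pi2 : {lrmorphism A -> A2})
    (B1 : {vspace A1}) (B2 : {vspace A2}) (x : A) : Prop :=
  exists x1 x2, [/\ in_path_span phi V1 pi1 B1 x1,
                    in_path_span phi V2 pi2 B2 x2 & x = x1 + x2].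
End BoundQuiver.

Definition sub_rel (T : finType) (V : {set T}) (ord : rel T) :
    rel {i : T | i \in V} :=
  fun i j => ord (val i) (val j).
Arguments sub_rel {T} V ord _ _.

(* Main.v *)
(* Let B contain the idempotents e_i, and let N be its radical.  The standard
   module at j is A e_j / A N e_j; let C_j be its quotient by its B-submodule
   L_B(j).  Comparing long exact sequences, B is regular if and only if C_j is
   injective over B and all maps of B-modules L_B(i) -> C_j lift to
   A e_j / A N e_j.  These are equations in A (Baer's criterion for the first),
   as are the other conditions on an exact Borel subalgebra, exactness of
   induction being the existence of a dual basis of A over B.  They can thus be
   checked corner by corner for B^1 + B^2.

   At a source this needs nothing more.  At a sink v, injectivity of C_j over
   B^1 + B^2 can fail for j in Q^1 because of maps from the radical of B^2 e_i
   to e_v A e_j through the simple module at v; the same maps then obstruct the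
   injectivity of C_j over any other Borel subalgebra, so this is excluded by
   the existence of a regular exact Borel subalgebra of A.  That subalgebra
   need not contain the e_i, but it contains a family f_i of lifted idempotents,
   and on e_j and on f_j the space A N is cut out by the same ideal, generated
   by the e_k with k not below j. *)

From HB Require Import structures.
From mathcomp Require Import all_boot all_algebra all_field.
From mathcomp Require Import boolp.
From mathcomp Require Import freeg ring.
Require Import Defs.

Set Implicit Arguments.
Unset Strict Implicit.
Unset Printing Implicit Defensive.

Import GRing.Theory.
Local Open Scope ring_scope.
Local Open Scope quotient_scope.

(** By adjunction, Ext over A between induced modules is Ext over B from L_B(i) to D_j, the induced
    module of L_B(j), and the map on Ext comes from the inclusion of L_B(j) in D_j. In the long
    exact sequence with C_j = D_j / L_B(j), injectivity in degree 1 is the lifting of maps from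
    simples to C_j, while surjectivity in degree 1 and injectivity in degree 2 give Ext^1(L_B(i),
    C_j) = 0. So degrees 1 and 2 suffice to obtain the equations, and the equations give all degrees
    back. The equations split along the deconcatenation because a |-> E a E is multiplicative, E
    being the sum of the idempotents on one side: a path with both ends on one side stays there.
    Each corner is thus a subspace of A and a quotient algebra at once. At a sink, the obstruction
    must be stated independently of B^1 + B^2 before another Borel subalgebra can be tested on it. A
    map from the radical of B^2 e_i to the simple B^2-module at v is therefore induced to an
    A-linear map on A N e_i, a space that does not depend on the Borel subalgebra, up to the passage
    from e_i to f_i. *)

Lemma linear_factor (R : nzRingType) (U V W : lmodType R)
    (p : {linear U -> V}) (g : {linear U -> W}) :
  (forall y, exists x, p x = y) -> (forall x, p x = 0 -> g x = 0) ->
  exists h : {linear V -> W}, forall x, h (p x) = g x.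
Proof.
move=> /choice [s ps] k.
have E x y : p x = p y -> g x = g y.
  by move=> e; apply/eqP; rewrite -subr_eq0 -linearB k // linearB e subrr.
have hl : linear (g \o s).
  by move=> a x y; rewrite /= -linearP; apply: E; rewrite linearP !ps.
pose h : {linear V -> W} := HB.pack (g \o s) (GRing.isLinear.Build _ _ _ _ _ hl).
by exists h => x; apply: E; rewrite ps.
Qed.

Lemma linear_lift_inj (R : nzRingType) (U V W : lmodType R)
    (i : {linear V -> W}) (g : {linear U -> W}) :
  injective i -> (forall x, exists y, i y = g x) ->
  exists h : {linear U -> V}, forall x, i (h x) = g x.
Proof.
move=> ii /choice [s ps].
have hl : linear s by move=> a x y; apply: ii; rewrite linearP !ps linearP.
pose h : {linear U -> V} := HB.pack s (GRing.isLinear.Build _ _ _ _ _ hl).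
by exists h.
Qed.

Section RestrictScalars.
Variables (R S : nzRingType).
(** A copy of the type of [M], so that the [R]-structure does not compete with the structure that
    [M] already has. *)
Definition resmod (f : {rmorphism R -> S}) (M : lmodType S) : Type := M.
Variables (f : {rmorphism R -> S}) (M : lmodType S).
Notation fM := (resmod f M).

HB.instance Definition _ := GRing.Zmodule.copy fM M.
Definition res_scale (r : R) (x : fM) : fM := f r *: (x : M).
Fact res_scaleA a b x : res_scale a (res_scale b x) = res_scale (a * b) x.
Proof. by rewrite /res_scale scalerA rmorphM. Qed.
Fact res_scale1 : left_id 1 res_scale.
Proof. by move=> x; rewrite /res_scale rmorph1 scale1r. Qed.
Fact res_scaleDr : right_distributive res_scale +%R.
Proof. by move=> a x y; rewrite /res_scale scalerDr. Qed.
Fact res_scaleDl x : {morph res_scale^~ x : a b / a + b}.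
Proof. by move=> a b; rewrite /res_scale rmorphD scalerDl. Qed.
HB.instance Definition _ := GRing.Zmodule_isLmodule.Build R fM
  res_scaleA res_scale1 res_scaleDr res_scaleDl.

Lemma resmod_scaleE (r : R) (x : fM) : r *: x = f r *: (x : M) :> M.
Proof. by []. Qed.
End RestrictScalars.

Section SubQuot.
Variables (R : nzRingType) (M : lmodType R) (U : submodClosed M).

Definition submod := {x : M | x \in U}.
HB.instance Definition _ := SubType.on submod.
HB.instance Definition _ := Choice.on submod.
HB.instance Definition _ := [SubChoice_isSubLmodule of submod by <:].

Definition submod_val : {linear submod -> M} := val.

Definition mksub (x : M) (h : x \in U) : submod := exist _ x h.

Lemma submod_valP (x : submod) : submod_val x \in U.
Proof. exact: valP. Qed.
Lemma submod_val_inj : injective submod_val.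
Proof. exact: val_inj. Qed.

Definition sub_pred : {pred M} := fun x => x \in U.
Fact sub_pred_closed : zmod_closed sub_pred.
Proof.
split=> [|x y]; first exact: (rpred0 U).
rewrite -!topredE /= /sub_pred => hx hy.
by rewrite -scaleN1r rpredD // rpredZ.
Qed.
HB.instance Definition _ := GRing.isZmodClosed.Build M sub_pred sub_pred_closed.

Definition quotmod := {ideal_quot sub_pred}.
HB.instance Definition _ := GRing.Zmodule.on quotmod.
Definition qproj (x : M) : quotmod := \pi_quotmod x.
Lemma qproj_eq x y : (qproj x = qproj y) <-> (x - y \in U).
Proof.
have e := Quotient.idealrBE sub_pred x y.
by rewrite /qproj; split=> [/eqP|h]; [rewrite -e|apply/eqP; rewrite -e].
Qed.
Fact qproj_is_additive : zmod_morphism qproj.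
Proof. by move=> x y; rewrite /qproj raddfB. Qed.
HB.instance Definition _ :=
  GRing.isZmodMorphism.Build M quotmod qproj qproj_is_additive.
Definition qrepr (x : quotmod) : M := repr (x : {ideal_quot sub_pred}).
Lemma qreprK x : qproj (qrepr x) = x.
Proof. exact: reprK. Qed.
Definition qscale (a : R) (x : quotmod) := qproj (a *: qrepr x).
Lemma qscaleE a x : qscale a (qproj x) = qproj (a *: x).
Proof.
rewrite /qscale; apply/qproj_eq; rewrite -scalerBr rpredZ //.
by apply/qproj_eq; rewrite qreprK.
Qed.
Fact qscaleA a b x : qscale a (qscale b x) = qscale (a * b) x.
Proof. by rewrite -[x]qreprK !qscaleE scalerA. Qed.
Fact qscale1 : left_id 1 qscale.
Proof. by move=> x; rewrite -[x]qreprK qscaleE scale1r. Qed.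
Fact qscaleDr : right_distributive qscale +%R.
Proof.
move=> a x y; rewrite -[x]qreprK -[y]qreprK -raddfD !qscaleE scalerDr.
by rewrite raddfD.
Qed.
Fact qscaleDl x : {morph qscale^~ x : a b / a + b}.
Proof. by move=> a b; rewrite -[x]qreprK !qscaleE scalerDl raddfD. Qed.
HB.instance Definition _ := GRing.Zmodule_isLmodule.Build R quotmod
  qscaleA qscale1 qscaleDr qscaleDl.
Fact qproj_is_scalable : scalable qproj.
Proof. by move=> a x; rewrite -[RHS]/(qscale a (qproj x)) qscaleE. Qed.
HB.instance Definition _ :=
  GRing.isScalable.Build R M quotmod _ qproj qproj_is_scalable.
Lemma qproj0 x : qproj x = 0 <-> x \in U.
Proof. by rewrite -(raddf0 qproj) qproj_eq subr0. Qed.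
Lemma qproj_surj y : exists x, qproj x = y.
Proof. by exists (qrepr y); rewrite qreprK. Qed.
End SubQuot.

Lemma mk_submodClosed (R : nzRingType) (M : lmodType R) (P : M -> Prop) :
  P 0 -> (forall a x y, P x -> P y -> P (a *: x + y)) ->
  exists U : submodClosed M, forall x, x \in U <-> P x.
Proof.
move=> P0 PD; pose p : {pred M} := fun x => `[< P x >].
have pE x : x \in p <-> P x by split=> [/asboolP|h]; [|apply/asboolP].
have hp : submod_closed p by split=> [|a x y /pE hx /pE hy]; apply/pE; auto.
pose U : submodClosed M := HB.pack p (GRing.isSubmodClosed.Build R M p hp).
by exists U.
Qed.

Lemma kernel_module (R : nzRingType) (M N : lmodType R) (g : {linear M -> N}) :
  exists (Z : lmodType R) (k : {linear Z -> M}),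
    injective k /\ forall y, g y = 0 <-> exists x, k x = y.
Proof.
have [|a x y hx hy|U hU] := @mk_submodClosed R M (fun x => g x = 0).
- exact: linear0.
- by rewrite linearP hx hy scaler0 addr0.
exists (submod U), (submod_val U); split; first exact: submod_val_inj.
move=> y; split=> [/hU h|[x <-]]; first by exists (mksub h).
by apply/hU; apply: submod_valP.
Qed.

(** * Resolutions and maps on Ext *)

Section FiniteDimension.
Variables (K : fieldType) (A : falgType K).
Implicit Types M N P X Y Z : lmodType A.

(** The modules carry no [K]-structure of their own, so scalars enter as [c%:A]; recursion on the
    list makes the elimination of one generator an induction step. *)
Fixpoint kspan M (s : seq M) (x : M) : Prop :=
  if s is b :: s' then exists c : K, kspan s' (x - c%:A *: b) else x = 0.

Lemma kspan0 M (s : seq M) : kspan s 0.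
Proof.
elim: s => //= b s IH; exists 0.
by rewrite scale0r scale0r subr0.
Qed.

Lemma kspanD M (s : seq M) x y : kspan s x -> kspan s y -> kspan s (x + y).
Proof.
elim: s x y => /= [x y -> ->|b s IH x y [c hc] [d hd]]; first by rewrite addr0.
exists (c + d); rewrite scalerDl scalerDl opprD addrACA; exact: IH.
Qed.

Lemma kspanZ M (s : seq M) (a : K) x : kspan s x -> kspan s (a%:A *: x).
Proof.
elim: s x => /= [x ->|b s IH x [c hc]]; first by rewrite scaler0.
exists (a * c); have := IH _ hc.
by rewrite scalerBr scalerA -scalerAl mul1r scalerA.
Qed.

Lemma kspan_mem M (s : seq M) x : x \in s -> kspan s x.
Proof.
elim: s => //= b s IH; rewrite inE => /predU1P [->|/IH h].
  by exists 1; rewrite !scale1r subrr; apply: kspan0.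
by exists 0; rewrite !scale0r subr0.
Qed.

Lemma kspan_min M (s : seq M) (P : M -> Prop) :
  P 0 -> (forall x y, P x -> P y -> P (x + y)) ->
  (forall a : K, forall x, P x -> P (a%:A *: x)) ->
  (forall x, x \in s -> P x) -> forall x, kspan s x -> P x.
Proof.
move=> P0 PD PZ; elim: s => /= [_ x -> //|b s IH h x [c hc]].
rewrite -[x](subrK (c%:A *: b)); apply: PD.
  by apply: IH hc => y hy; apply: h; rewrite inE hy orbT.
by apply: PZ; apply: h; rewrite mem_head.
Qed.

Lemma kspan_catl M (s t : seq M) x : kspan s x -> kspan (s ++ t) x.
Proof.
apply: kspan_min => [|? ?|? ?|y hy]; [exact: kspan0|exact: kspanD|exact: kspanZ|].
by apply: kspan_mem; rewrite mem_cat hy.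
Qed.

Lemma kspan_catr M (s t : seq M) x : kspan t x -> kspan (s ++ t) x.
Proof.
apply: kspan_min => [|? ?|? ?|y hy]; [exact: kspan0|exact: kspanD|exact: kspanZ|].
by apply: kspan_mem; rewrite mem_cat hy orbT.
Qed.

Lemma kspan_sum M (s : seq M) I (r : seq I) (F : I -> M) :
  (forall i, kspan s (F i)) -> kspan s (\sum_(i <- r) F i).
Proof.
move=> h; elim: r => [|i r IH]; first by rewrite big_nil; apply: kspan0.
by rewrite big_cons; apply: kspanD.
Qed.

Lemma findimP M : findim M <-> exists s : seq M, forall x, kspan s x.
Proof.
split=> [[n [b hb]]|[s hs]].
  exists (codom b) => x; have [c ->] := hb x.
  apply: kspan_sum => i; apply: kspanZ; apply: kspan_mem; exact: codom_f.
exists (size s), (fun i => s`_i) => x; have := hs x.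
elim: s {hs} x => [|b s IH] x /=.
  by move=> ->; exists (fun=> 0); rewrite big_ord0.
case=> c /IH [d hd].
exists (fun i => if unlift ord0 i is Some j then d j else c).
rewrite big_ord_recl unlift_none /= -[LHS](subrK (c%:A *: b)) addrC hd.
by congr (_ + _); apply: eq_bigr => j _; rewrite liftK.
Qed.

Lemma kspan_map M N (g : {linear M -> N}) s x :
  kspan s x -> kspan (map g s) (g x).
Proof.
apply: (@kspan_min _ _ (fun x => kspan (map g s) (g x))) => [|y z|a y|y hy].
- by rewrite linear0; apply: kspan0.
- by rewrite linearD; apply: kspanD.
- by rewrite linearZ; apply: kspanZ.
- by apply: kspan_mem; apply: map_f.
Qed.

Lemma findim_surj M N (g : {linear M -> N}) :
  surj_lin g -> findim M -> findim N.
Proof.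
move=> gs /findimP [s hs]; apply/findimP; exists (map g s) => y.
by have [x <-] := gs y; apply: kspan_map.
Qed.

(** Gaussian elimination: a vector of [P] with nonzero coefficient at the head [b] serves as pivot,
    and subtracting its multiples moves the other vectors of [P] into the span of the tail. *)
Lemma kspan_sub M (P : M -> Prop) (s : seq M) :
  P 0 -> (forall (a : K) x y, P x -> P y -> P (a%:A *: x + y)) ->
  (forall x, P x -> kspan s x) ->
  exists t : seq M, (forall x, x \in t -> P x) /\ forall x, P x -> kspan t x.
Proof.
elim: s P => [|b s IH] P P0 PD hs; first by exists [::].
pose P' x := P x /\ kspan s x.
have [||x [] //|t [t1 t2]] := IH P'.
- by split=> //; apply: kspan0.
- move=> a x y [hx1 hx2] [hy1 hy2]; split; first exact: PD.
  by apply: kspanD => //; apply: kspanZ.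
have [[u [c [Pu c0 hu]]]|no] :=
    pselect (exists u c, [/\ P u, c != 0 & kspan s (u - c%:A *: b)]); last first.
  exists t; split=> [x /t1 [] //|x Px]; apply: t2; split=> //.
  have [c hc] := hs x Px; have [c0|c0] := eqVneq c 0.
    by move: hc; rewrite c0 !scale0r subr0.
  by case: no; exists x, c.
exists (u :: t); split=> [x|x Px].
  by rewrite inE => /predU1P [-> //|/t1 []].
have [d hd] := hs x Px; exists (d / c); apply: t2; split.
  by rewrite addrC -scaleNr -scaleNr; apply: PD.
have -> : x - (d / c)%:A *: u =
    (x - d%:A *: b) + (- (d / c))%:A *: (u - c%:A *: b).
  rewrite scalerBr scalerA -scalerAl mul1r scalerA mulNr divfK // !scaleNr.
  by rewrite opprK [- _ + _]addrC addrA subrK.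
by apply: kspanD => //; apply: kspanZ.
Qed.

Lemma findim_inj Z M (g : {linear Z -> M}) :
  injective g -> findim M -> findim Z.
Proof.
move=> gi /findimP [s hs].
have [||x _|t [t1 t2]] := @kspan_sub M (fun x => exists z, g z = x) s.
- by exists 0; rewrite linear0.
- by move=> a x y [u <-] [w <-]; exists (a%:A *: u + w); rewrite linearP.
- exact: hs.
have [t' et] : exists t', t = map g t'.
  elim: t t1 {t2} => [|x t IH] h; first by exists [::].
  have [z hz] := h x (mem_head _ _).
  have [|t' ->] := IH; first by move=> y hy; apply: h; rewrite inE hy orbT.
  by exists (z :: t'); rewrite /= hz.
apply/findimP; exists t' => z.
have := t2 (g z) (ex_intro _ z erefl); rewrite {}et.
elim: t' z {t1 t2} => [|x t' IH] z /=; first by rewrite -(linear0 g) => /gi.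
by case=> c; rewrite -linearZ -linearB => /IH; exists c.
Qed.

Lemma findim_pair M N : findim M -> findim N -> findim (M * N)%type.
Proof.
move=> /findimP [s hs] /findimP [t ht]; apply/findimP.
exists ([seq (x, 0) | x <- s] ++ [seq (0, y) | y <- t]) => -[x y].
have -> : (x, y) = (x, 0) + (0, y) by congr pair; rewrite /= ?addr0 ?add0r.
apply: kspanD.
- apply: kspan_catl.
  apply: (@kspan_min _ s (fun x => kspan _ (x, 0 : N))) (hs x); first exact: kspan0.
  + move=> a b ha hb; have -> : (a + b, 0 : N) = (a, 0) + (b, 0).
      by congr pair; rewrite /= addr0.
    exact: kspanD.
  + move=> a b hb; have -> : (a%:A *: b, 0 : N) = a%:A *: (b, 0).
      by congr pair; rewrite /= scaler0.
    exact: kspanZ.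
  + by move=> a ha; apply: kspan_mem; apply: (map_f (fun x => (x, 0))).
- apply: kspan_catr.
  apply: (@kspan_min _ t (fun x => kspan _ (0 : M, x))) (ht y); first exact: kspan0.
  + move=> a b ha hb; have -> : (0 : M, a + b) = (0, a) + (0, b).
      by congr pair; rewrite /= addr0.
    exact: kspanD.
  + move=> a b hb; have -> : (0 : M, a%:A *: b) = a%:A *: (0, b).
      by congr pair; rewrite /= scaler0.
    exact: kspanZ.
  + by move=> a ha; apply: kspan_mem; apply: (map_f (fun x => (0, x))).
Qed.

Lemma findim_regular : findim (A^o : lmodType A).
Proof.
apply/findimP; exists (vbasis {:A}) => x.
rewrite (coord_vbasis (memvf x)); apply: kspan_sum => i.
rewrite -mulr_algl; apply: (@kspanZ A^o).
by apply: kspan_mem; rewrite mem_nth // size_tuple.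
Qed.

Lemma mk_linear (R : nzRingType) (M N : lmodType R) (f : M -> N) :
  linear f -> exists h : {linear M -> N}, h =1 f.
Proof.
move=> fl.
by exists (HB.pack f (GRing.isLinear.Build _ _ _ _ f fl) : {linear M -> N}).
Qed.

Lemma scale_linear M (x : M) : exists h : {linear A^o -> M}, forall a, h a = a *: x.
Proof.
by apply: mk_linear => a b c; rewrite scalerDl -[a *: b]/(a * b) scalerA.
Qed.

Lemma projective_regular : projective (A^o : lmodType A).
Proof.
split=> [|X Y g h fX fY gs]; first exact: findim_regular.
have [x gx] := gs (h 1); have [h' hE] := scale_linear x.
by exists h' => a; rewrite hE linearZ gx -linearZ; congr (h _); apply: mulr1.
Qed.

Lemma projective_pair P P' :
  projective P -> projective P' -> projective (P * P')%type.
Proof.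
move=> [fP lP] [fP' lP']; split=> [|X Y g h fX fY gs]; first exact: findim_pair.
have [h1 h1E] : exists h1 : {linear P -> Y}, h1 =1 (fun x => h (x, 0)).
  apply: mk_linear => a x y; rewrite -linearP; congr (h _).
  by congr pair; rewrite /= scaler0 addr0.
have [h2 h2E] : exists h2 : {linear P' -> Y}, h2 =1 (fun x => h (0, x)).
  apply: mk_linear => a x y; rewrite -linearP; congr (h _).
  by congr pair; rewrite /= scaler0 addr0.
have [k1 k1E] := lP X Y g h1 fX fY gs; have [k2 k2E] := lP' X Y g h2 fX fY gs.
have [k kE] : exists k : {linear (P * P')%type -> X}, k =1 (fun x => k1 x.1 + k2 x.2).
  by apply: mk_linear => a [x x'] [y y'] /=; rewrite !linearP addrACA scalerDr.
exists k => -[x x']; rewrite kE linearD k1E k2E h1E h2E -linearD.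
by congr (h _); congr pair; rewrite /= ?addr0 ?add0r.
Qed.

Lemma projective_cover_exists M : findim M ->
  exists P (g : {linear P -> M}), projective P /\ surj_lin g.
Proof.
move=> /findimP [s hs].
suff [P [g [pP hg]]] : exists P (g : {linear P -> M}),
    projective P /\ forall x, x \in s -> exists y, g y = x.
  exists P, g; split=> // x.
  apply: (@kspan_min _ s (fun x => exists y, g y = x)) (hs x) => //.
  - by exists 0; rewrite linear0.
  - by move=> ? ? [u <-] [w <-]; exists (u + w); rewrite linearD.
  - by move=> a ? [u <-]; exists (a%:A *: u); rewrite linearZ.
elim: s {hs} => [|b s [P [g [pP hg]]]].
  have [h _] := scale_linear (0 : M).
  by exists A^o, h; split=> //; apply: projective_regular.
have [h hE] := scale_linear b.
have [k kE] : exists k : {linear (A^o * P)%type -> M}, k =1 (fun x => h x.1 + g x.2).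
  by apply: mk_linear => a [x x'] [y y'] /=; rewrite !linearP addrACA scalerDr.
exists (A^o * P)%type, k; split.
  by apply: projective_pair pP; apply: projective_regular.
move=> x; rewrite inE => /predU1P [->|/hg [y <-]].
  by exists (1, 0); rewrite kE hE scale1r linear0 addr0.
by exists (0, y); rewrite kE linear0 add0r.
Qed.

(** Projectivity gives lifts along surjections only, so [f] and [g] are first factored through the
    kernel of [h], onto which [g] is surjective by exactness. *)
Lemma projective_lift P X Y Z (g : {linear X -> Y}) (h : {linear Y -> Z})
    (f : {linear P -> Y}) :
  projective P -> findim X -> findim Y -> exact_at g h ->
  (forall x, h (f x) = 0) ->
  exists f' : {linear P -> X}, forall x, g (f' x) = f x.
Proof.
move=> [_ lP] fX fY ex hf.
have [Z0 [k [ki kE]]] := kernel_module h.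
have [|g0 g0E] := @linear_lift_inj _ X Z0 Y k g ki.
  by move=> x; apply/kE/ex; exists x.
have [|f0 f0E] := @linear_lift_inj _ P Z0 Y k f ki.
  by move=> x; apply/kE.
have [||f' hf'] := lP X Z0 g0 f0 fX.
- exact: findim_inj ki fY.
- move=> z; have /ex [x xE] : h (k z) = 0 by apply/kE; exists z.
  by exists x; apply: ki; rewrite g0E.
by exists f' => x; rewrite -g0E hf' f0E.
Qed.
End FiniteDimension.

(** * Comparison of projective resolutions *)

Section Comparison.
Variables (K : fieldType) (A : falgType K) (M : lmodType A).
Variables (P R : chain_data A) (eps : {linear P 0%N -> M}) (eta : {linear R 0%N -> M}).
Hypotheses (hP : proj_resolution eps) (hR : proj_resolution eta).

Let projP k : projective (P k). Proof. by case: hP. Qed.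
Let fdR k : findim (R k). Proof. by case: hR => /(_ k) []. Qed.
Let exR k : exact_at (cdiff R k.+1) (cdiff R k). Proof. by case: hR. Qed.
Let ex0R : exact_at (cdiff R 0) eta. Proof. by case: hR. Qed.
Let ddP k x : cdiff P k (cdiff P k.+1 x) = 0.
Proof. by case: hP => _ _ _ /(_ k) e; apply/e; exists x. Qed.
Let edP x : eps (cdiff P 0 x) = 0.
Proof. by case: hP => _ _ e _; apply/e; exists x. Qed.

(** Two consecutive components with their commuting square: the recursion needs the square in order
    to construct the next component. *)
Let cmp_type k := {p : {linear P k -> R k} * {linear P k.+1 -> R k.+1} |
  forall x, p.1 (cdiff P k x) = cdiff R k (p.2 x)}.

Let cmp_start : exists p : cmp_type 0, forall x, eta ((sval p).1 x) = eps x.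
Proof.
have [c0 c0E] : exists c0 : {linear P 0%N -> R 0%N}, forall x, eta (c0 x) = eps x.
  case: (projP 0) => _ lP; apply: lP => //; last by case: hR.
  by apply: findim_surj (fdR 0); case: hR => _ ? _ _.
have [|c1 c1E] := projective_lift (f := c0 \o cdiff P 0) (projP 1) (fdR 1)
  (fdR 0) ex0R.
  by move=> x /=; rewrite c0E edP.
have h x : (c0, c1).1 (cdiff P 0 x) = cdiff R 0 ((c0, c1).2 x) by rewrite /= c1E.
by exists (exist _ (c0, c1) h).
Qed.

Let cmp_step k (p : cmp_type k) :
  {q : cmp_type k.+1 | (sval q).1 = (sval p).2}.
Proof.
apply: cid; case: p => -[c0 c1] /= h.
have [|c2 c2E] := projective_lift (f := c1 \o cdiff P k.+1) (projP k.+2)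
  (fdR k.+2) (fdR k.+1) (@exR k).
  by move=> x /=; rewrite -h ddP linear0.
have h' x : (c1, c2).1 (cdiff P k.+1 x) = cdiff R k.+1 ((c1, c2).2 x).
  by rewrite /= c2E.
by exists (exist _ (c1, c2) h').
Qed.

Let Fixpoint cmp_build k : cmp_type k :=
  if k is k'.+1 then sval (cmp_step (cmp_build k')) else sval (cid cmp_start).

Lemma comparison_map : exists c : forall k, {linear P k -> R k},
  (forall x, eta (c 0%N x) = eps x) /\
  forall k x, c k (cdiff P k x) = cdiff R k (c k.+1 x).
Proof.
exists (fun k => (sval (cmp_build k)).1); split=> [|k x].
  exact: svalP (cid cmp_start).
by rewrite (svalP (cmp_build k)) /= (svalP (cmp_step _)).
Qed.

Variable u : forall k, {linear P k -> R k}.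
Hypothesis u0 : forall x, eta (u 0 x) = 0.
Hypothesis uS : forall k x, u k (cdiff P k x) = cdiff R k (u k.+1 x).

(** The homotopy identity in one degree involves the preceding component. Keeping only its
    consequence on the image of the differential gives a type that depends on one degree and
    suffices for the next step. *)
Let htp_type k := {H : {linear P k -> R k.+1} |
  forall x, cdiff R k (H (cdiff P k x)) = u k (cdiff P k x)}.

Let htp_start : exists p : htp_type 0, forall x, cdiff R 0 (sval p x) = u 0 x.
Proof.
have [H HE] := projective_lift (projP 0) (fdR 1) (fdR 0) ex0R u0.
have h x : cdiff R 0 (H (cdiff P 0 x)) = u 0 (cdiff P 0 x) by rewrite HE.
by exists (exist _ H h).
Qed.

Let htp_step k (p : htp_type k) : {q : htp_type k.+1 | forall x,
  cdiff R k.+1 (sval q x) = u k.+1 x - sval p (cdiff P k x)}.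
Proof.
apply: cid; case: p => H h /=.
have [g gE] : exists g : {linear P k.+1 -> R k.+1},
    g =1 (fun x => u k.+1 x - H (cdiff P k x)).
  by apply: mk_linear => a x y; rewrite !linearP /= addrACA -scalerDr.
have [|H' H'E] := projective_lift (f := g) (projP k.+1) (fdR k.+2)
  (fdR k.+1) (@exR k).
  by move=> x; rewrite gE linearB h uS subrr.
have h' x : cdiff R k.+1 (H' (cdiff P k.+1 x)) = u k.+1 (cdiff P k.+1 x).
  by rewrite H'E gE ddP linear0 subr0.
by exists (exist _ H' h') => x; rewrite /= H'E gE.
Qed.

Let Fixpoint htp_build k : htp_type k :=
  if k is k'.+1 then sval (htp_step (htp_build k')) else sval (cid htp_start).

(** Only positive degrees are recorded, since Ext^(k+1) is computed from the terms of degree k+1. *)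
Lemma null_homotopy : exists H : forall k, {linear P k -> R k.+1},
  forall k x, u k.+1 x = cdiff R k.+1 (H k.+1 x) + H k (cdiff P k x).
Proof.
exists (fun k => sval (htp_build k)) => k x.
by rewrite (svalP (htp_step (htp_build k))) subrK.
Qed.
End Comparison.

Section ExtIndependence.
Variables (K : fieldType) (A : falgType K) (M N : lmodType A).
Variables (R P : chain_data A) (eta : {linear R 0%N -> M}) (eps : {linear P 0%N -> M}).
Hypotheses (hR : proj_resolution eta) (hP : proj_resolution eps).
Variable c : forall k, {linear R k -> P k}.
Hypothesis c0 : forall x, eps (c 0%N x) = eta x.
Hypothesis cS : forall k x, c k (cdiff R k x) = cdiff P k (c k.+1 x).

Let selfcmp (S : chain_data A) (th : {linear S 0%N -> M}) (hS : proj_resolution th)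
    (f : forall k, {linear S k -> S k}) :
  (forall x, th (f 0%N x) = th x) ->
  (forall k x, f k (cdiff S k x) = cdiff S k (f k.+1 x)) ->
  exists H : forall k, {linear S k -> S k.+1},
  forall k x, f k.+1 x = x + cdiff S k.+1 (H k.+1 x) + H k (cdiff S k x).
Proof.
move=> f0 fS.
have w k : {u : {linear S k -> S k} | u =1 (fun x => f k x - x)}.
  by apply/cid; apply: mk_linear => a x y; rewrite !linearP /= addrACA -scalerDr.
have [||H HE] := @null_homotopy _ _ _ _ _ _ _ hS hS (fun k => sval (w k)).
- by move=> x; rewrite (svalP (w 0%N)) linearB f0 subrr.
- by move=> k x; rewrite (svalP (w k)) (svalP (w k.+1)) linearB fS.
by exists H => k x; rewrite -addrA -HE (svalP (w k.+1)) addrC subrK.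
Qed.

(** A comparison map [c'] in the other direction is a homotopy inverse of [c]: one composite gives
    injectivity, the other surjectivity. This replaces an arbitrary resolution of an induced module
    by an induced resolution. *)
Lemma ext_comparison k :
  (forall g : {linear P k.+1 -> N}, cocycle g ->
     coboundary (P := R) (g \o c k.+1) -> coboundary g) /\
  (forall h : {linear R k.+1 -> N}, cocycle h ->
     exists2 g : {linear P k.+1 -> N}, cocycle g
       & coboundary (P := R) (fun x => h x - g (c k.+1 x))).
Proof.
have [c' [c'0 c'S]] := comparison_map hP hR.
split=> [g hg [s hs]|h hh].
- have [||H HE] := @selfcmp P eps hP (fun k => c k \o c' k).
  + by move=> x /=; rewrite c0 c'0.
  + by move=> n x /=; rewrite c'S cS.
  have [t tE] : exists t : {linear P k -> N}, t =1 (fun x => s (c' k x) - g (H k x)).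
    by apply: mk_linear => a x y; rewrite !linearP /= addrACA -scalerDr.
  exists t => x; rewrite tE c'S -hs /= [c _ _]HE 2!(linearD g) hg addr0.
  by rewrite addrK.
- have [||H HE] := @selfcmp R eta hR (fun k => c' k \o c k).
  + by move=> x /=; rewrite c'0 c0.
  + by move=> n x /=; rewrite cS c'S.
  exists (h \o c' k.+1) => [x /=|]; first by rewrite c'S hh.
  have [t tE] : exists t : {linear R k -> N}, t =1 (fun x => - h (H k x)).
    by apply: mk_linear => a x y; rewrite !linearP.
  by exists t => x; rewrite tE /= [c' _ _]HE 2!(linearD h) hh addr0 opprD addrA subrr add0r.
Qed.
End ExtIndependence.

Section Resolution.
Variables (K : fieldType) (A : falgType K).

Record syzygy := Syzygy {
  syz_proj : lmodType A;
  syz_mod : lmodType A;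
  syz_incl : {linear syz_mod -> syz_proj};
  syz_projP : projective syz_proj;
  syz_inclP : injective syz_incl }.

Lemma cover_ex (s : syzygy) : {P : lmodType A &
  {g : {linear P -> syz_mod s} | projective P /\ surj_lin g}}.
Proof.
have fs : findim (syz_mod s) by apply: (findim_inj (@syz_inclP s)); case: (syz_projP s).
have /cid [P /cid [g h]] := projective_cover_exists fs.
by exists P, g.
Qed.

Lemma ker_ex (P N : lmodType A) (g : {linear P -> N}) : {Z : lmodType A &
  {k : {linear Z -> P} | injective k /\ exact_at k g}}.
Proof.
by have /cid [Z /cid [k h]] := kernel_module g; exists Z, k.
Qed.

Variables (M P0 : lmodType A) (eps : {linear P0 -> M}).
Hypotheses (pP0 : projective P0) (eps_surj : surj_lin eps).

Definition syz_start : syzygy :=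
  Syzygy pP0 (proj1 (svalP (projT2 (ker_ex eps)))).
Definition syz_next (s : syzygy) : syzygy :=
  Syzygy (proj1 (svalP (projT2 (cover_ex s))))
    (proj1 (svalP (projT2 (ker_ex (sval (projT2 (cover_ex s))))))).

Fixpoint syz k : syzygy := if k is k'.+1 then syz_next (syz k') else syz_start.

(** The given cover [P0] is the term of degree 0, so that the simple module at i can be resolved
    starting with B e_i itself. *)
Definition resolution : chain_data A :=
  @ChainData K A (fun k => syz_proj (syz k))
    (fun k => @syz_incl (syz k) \o sval (projT2 (cover_ex (syz k)))).

Lemma resolutionP : @proj_resolution K A M resolution eps.
Proof.
split=> [k||y|k y] /=.
- exact: syz_projP.
- exact: eps_surj.
- have [_ e] := svalP (projT2 (ker_ex eps)).
  have [_ gs] := svalP (projT2 (cover_ex syz_start)).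
  split=> [/e [z <-]|[x <-]]; last by apply/e; eexists.
  by have [x <-] := gs z; exists x.
- set g := sval (projT2 (cover_ex (syz k))).
  have [_ e] : injective (@syz_incl (syz k.+1)) /\ exact_at (@syz_incl (syz k.+1)) g
    := svalP (projT2 (ker_ex g)).
  have [_ gs] := svalP (projT2 (cover_ex (syz k.+1))).
  split=> [h|[x <-]].
    have /e [z <-] : g y = 0 by apply: (@syz_inclP (syz k)); rewrite linear0.
    by have [x <-] := gs z; exists x.
  apply: etrans (linear0 (@syz_incl (syz k))).
  by apply: (congr1 (@syz_incl (syz k))); apply/e; eexists.
Qed.
End Resolution.

(** * Induction and restriction *)

Section TensorFacts.
Variables (A B : nzRingType) (f : B -> A) (M : lmodType B).

Lemma ptensorDl a a' (m : M) : ptensor f (a + a') m = ptensor f a m + ptensor f a' m.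
Proof.
by rewrite /ptensor -raddfD; apply/tpi_eqP; rewrite opprD addrA; apply: TRelDl.
Qed.

Lemma ptensorDr a (m m' : M) : ptensor f a (m + m') = ptensor f a m + ptensor f a m'.
Proof.
by rewrite /ptensor -raddfD; apply/tpi_eqP; rewrite opprD addrA; apply: TRelDr.
Qed.

Lemma ptensorZ a b (m : M) : ptensor f a (b *: m) = ptensor f (a * f b) m.
Proof. by apply/esym/tpi_eqP; apply: TRelZ. Qed.

Lemma ptensor0l (m : M) : ptensor f 0 m = 0.
Proof. by apply: (@addrI _ (ptensor f 0 m)); rewrite -ptensorDl !addr0. Qed.

Lemma ptensor0r a : ptensor f a (0 : M) = 0.
Proof. by apply: (@addrI _ (ptensor f a 0)); rewrite -ptensorDr !addr0. Qed.

Lemma ptensor_suml I (r : seq I) (F : I -> A) (m : M) :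
  ptensor f (\sum_(i <- r) F i) m = \sum_(i <- r) ptensor f (F i) m.
Proof.
elim: r => [|i r IH]; first by rewrite !big_nil ptensor0l.
by rewrite !big_cons ptensorDl IH.
Qed.

Lemma ptensorMz a (m : M) k : ptensor f (a *~ k) m = ptensor f a m *~ k.
Proof.
have g_add : zmod_morphism (fun a => ptensor f a m).
  move=> x y; apply: (@addIr _ (ptensor f y m)).
  by rewrite -ptensorDl !subrK.
pose g : {additive A -> tensor f M} :=
  HB.pack (fun a => ptensor f a m) (GRing.isZmodMorphism.Build _ _ _ g_add).
exact: (raddfMz g).
Qed.

Lemma tensor_ind_sum (P : tensor f M -> Prop) :
  P 0 -> (forall x y, P x -> P y -> P (x + y)) -> (forall a m, P (ptensor f a m)) ->
  forall t, P t.
Proof.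
move=> P0 PD Pp t; rewrite -[t]treprK -[trepr t]freeg_sumE raddf_sum.
elim/big_ind: _ => // -[a m] _ /=.
have -> k (p : A * M) : << k *g p >> = << p >> *~ k :> {freeg (A * M)%type / int}.
  by rewrite freeg_mulz -mulrzl; congr << _ *g _ >>; rewrite mulr1 intz.
by rewrite raddfMz -/(ptensor f a m) -ptensorMz.
Qed.

Lemma tensor_lift (V : zmodType) (h : A -> M -> V) :
  (forall a a' m, h (a + a') m = h a m + h a' m) ->
  (forall a m m', h a (m + m') = h a m + h a m') ->
  (forall a b m, h (a * f b) m = h a (b *: m)) ->
  exists g : {additive tensor f M -> V}, forall a m, g (ptensor f a m) = h a m.
Proof.
move=> hl hr hb.
(* Lifts from free groups are defined for modules, so [V] is regarded as a module over the
   integers. *)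
pose h' (p : A * M) : ssrint.zmodule V := h p.1 p.2.
pose L : {freeg (A * M)%type / int} -> ssrint.zmodule V := fglift h'.
have Lr x : tensor_rel f x -> L x = 0.
  elim=> [|u v _ IHu _ IHv|a a' m|a m m'|a b m].
  - exact: linear0.
  - by rewrite /L linearB [X in X - _]IHu [X in _ - X]IHv subrr.
  - rewrite /L !linearB /= !liftU !scale1r.
    rewrite -[LHS]/(h (a + a') m - h a m - h a' m : V).
    by rewrite hl -addrA -opprD subrr.
  - rewrite /L !linearB /= !liftU !scale1r.
    rewrite -[LHS]/(h a (m + m') - h a m - h a m' : V).
    by rewrite hr -addrA -opprD subrr.
  - rewrite /L !linearB /= !liftU !scale1r.
    by rewrite -[LHS]/(h (a * f b) m - h a (b *: m) : V) hb subrr.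
have Lpi x y : tpi f x = tpi f y -> L x = L y.
  move=> /tpi_eqP /Lr; rewrite /L linearB ; exact: subr0_eq.
pose g (t : tensor f M) : V := L (trepr t).
have g_add : zmod_morphism g.
  move=> t u; rewrite /g -[RHS]/((L (trepr t)) - (L (trepr u)) : ssrint.zmodule V).
  by rewrite -linearB; apply: Lpi; rewrite raddfB /= !treprK.
pose G : {additive tensor f M -> V} := HB.pack g (GRing.isZmodMorphism.Build _ _ _ g_add).
exists G => a m /=.
rewrite /g (Lpi _ << (a, m) >>) ?treprK //.
by rewrite /L liftU scale1r.
Qed.
End TensorFacts.

Section Induction.
Variables (K : fieldType) (A : falgType K) (B : {aspace A}) (B1 : 1 \in B).
Notation sB := (subvs_of B).

Lemma vsval1 : vsval (1 : sB) = 1.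
Proof. by apply/eqP; rewrite algid_eq1. Qed.

Fact vsval_monoid : monoid_morphism (@vsval _ _ B).
Proof. by split; first exact: vsval1. Qed.

Definition vincl : {rmorphism sB -> A} :=
  HB.pack (@vsval _ _ B) (GRing.isMonoidMorphism.Build _ _ _ vsval_monoid).

Lemma vsval_scalar (c : K) : vsval (c%:A : sB) = c%:A.
Proof. by rewrite linearZ -[RHS]/(c *: 1) -vsval1. Qed.

Definition res (X : lmodType A) : lmodType sB := resmod vincl X.

Lemma res_scaleE (X : lmodType A) (b : sB) (x : X) :
  b *: (x : res X) = vsval b *: x :> X.
Proof. by []. Qed.

Lemma findim_res (X : lmodType A) : findim X -> findim (res X).
Proof.
move=> [n [b hb]]; exists n, b => x; have [c e] := hb x; exists c.
rewrite [LHS]e; apply: (big_ind2 (fun (u : X) (v : res X) => u = v)) => //.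
  by move=> ? ? ? ? -> ->.
by move=> i _; rewrite res_scaleE vsval_scalar.
Qed.

Lemma res_linear (X Y : lmodType A) (g : {linear X -> Y}) :
  exists h : {linear res X -> res Y}, h =1 g.
Proof.
apply: mk_linear => b x y.
rewrite -[b *: x + y]/(vsval b *: (x : X) + (y : X)) linearP.
by [].
Qed.

Lemma tensor_unit (M : lmodType sB) :
  exists u : {linear M -> res (induced M)}, forall m, u m = ptensor (@vsval _ _ B) 1 m.
Proof.
apply: mk_linear => b x y; rewrite ptensorDr ptensorZ mul1r.
by rewrite res_scaleE tensor_scaleE mulr1.
Qed.

Lemma induced_adjoint (M : lmodType sB) (X : lmodType A) (h : {linear M -> res X}) :
  exists g : {linear induced M -> X},
    forall a m, g (ptensor (@vsval _ _ B) a m) = a *: (h m : X).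
Proof.
have [|||g gE] := @tensor_lift A sB (@vsval _ _ B) M X (fun a m => a *: (h m : X)).
- by move=> a a' m; rewrite scalerDl.
- by move=> a m m'; rewrite linearD -scalerDr.
- by move=> a b m; rewrite linearZ -scalerA.
have gs : scalable g.
  move=> a t.
  apply: (@tensor_ind_sum A sB _ M (fun t => g (a *: t) = a *: g t)) => [|x y hx hy|b m].
  - by rewrite scaler0 raddf0 scaler0.
  - apply: etrans (congr1 g (scalerDr a (x : induced M) y)) _.
    by rewrite !raddfD hx hy.
  - by rewrite tensor_scaleE !gE scalerA.
have gl : linear g by move=> a x y; rewrite raddfD gs.
have [G GE] := mk_linear gl.
by exists G => a m; rewrite GE gE.
Qed.

Lemma ptensor_scale (M : lmodType sB) a m :
  ptensor (@vsval _ _ B) a m = a *: (ptensor (@vsval _ _ B) 1 m : induced M).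
Proof. by rewrite [RHS]tensor_scaleE mulr1. Qed.

Lemma induced_ext (M : lmodType sB) (X : lmodType A) (g h : {linear induced M -> X}) :
  (forall m, g (ptensor (@vsval _ _ B) 1 m) = h (ptensor (@vsval _ _ B) 1 m)) -> g =1 h.
Proof.
move=> e; apply: tensor_ind_additive => a m.
transitivity (g (a *: (ptensor (@vsval _ _ B) 1 m : induced M))).
  by rewrite -ptensor_scale.
by rewrite linearZ e -linearZ -ptensor_scale.
Qed.

Lemma findim_induced (M : lmodType sB) : findim M -> findim (induced M).
Proof.
move=> /findimP [s hs]; apply/findimP.
exists [seq ptensor (@vsval _ _ B) a m | a <- vbasis {:A}, m <- s].
apply: tensor_ind_sum; [exact: kspan0|exact: kspanD|move=> a m].
apply: (@kspan_min _ _ _ s (fun m => kspan _ (ptensor (@vsval _ _ B) a m))) (hs m).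
- by rewrite ptensor0r; apply: kspan0.
- by move=> x y hx hy; rewrite ptensorDr; apply: kspanD.
- move=> c x hx; rewrite ptensorZ vsval_scalar mulr_algr -mulr_algl -tensor_scaleE.
  exact: kspanZ.
move=> x hx; rewrite (coord_vbasis (memvf a)) ptensor_suml; apply: kspan_sum => i.
rewrite -mulr_algl -tensor_scaleE; apply: kspanZ; apply: kspan_mem.
by apply: allpairs_f => //; rewrite mem_nth // size_tuple.
Qed.

(** Restriction to [B] preserves surjections and finite dimension, hence its left adjoint preserves
    projectives. *)
Lemma projective_induced (M : lmodType sB) : projective M -> projective (induced M).
Proof.
move=> [fM lM]; split=> [|X Y g h fX fY gs]; first exact: findim_induced.
have [u uE] := tensor_unit M.
have [g' g'E] := res_linear g; have [h' h'E] := res_linear h.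
have [|k kE] := lM (res X) (res Y) g' (h' \o u) (findim_res fX) (findim_res fY).
  by move=> y; have [x <-] := gs y; exists x; rewrite g'E.
have [k' k'E] := induced_adjoint k.
exists k'; apply: (@induced_ext M Y (g \o k') h) => m /=.
by rewrite k'E scale1r -g'E kE /= h'E uE.
Qed.
End Induction.

Lemma image_module (R : nzRingType) (M N : lmodType R) (g : {linear M -> N}) :
  exists (Z : lmodType R) (p : {linear M -> Z}) (k : {linear Z -> N}),
    [/\ forall z, exists x, p x = z, injective k & forall x, k (p x) = g x].
Proof.
have [|a x y [u <-] [w <-]|U hU] := @mk_submodClosed R N (fun y => exists x, g x = y).
- by exists 0; rewrite linear0.
- by exists (a *: u + w); rewrite linearP.
have ki := @submod_val_inj R N U.
have [|p pE] := @linear_lift_inj R M (submod U) N (submod_val U) g ki.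
  move=> x; have /hU h : exists x', g x' = g x by exists x.
  by exists (mksub h).
exists (submod U), p, (submod_val U); split=> // z.
have /hU [x xE] := submod_valP z.
by exists x; apply: ki; rewrite pE.
Qed.

Lemma pair_lift (R : nzRingType) (M N P : lmodType R) (f : {linear M -> P})
    (g : {linear N -> P}) :
  exists h : {linear (M * N)%type -> P}, forall x y, h (x, y) = f x + g y.
Proof.
have [h hE] : exists h : {linear (M * N)%type -> P}, h =1 (fun p => f p.1 + g p.2).
  by apply: mk_linear => a [x x'] [y y'] /=; rewrite !linearP addrACA scalerDr.
by exists h => x y; rewrite hE.
Qed.

(** * Modules generated by an idempotent and one-dimensional modules *)

Section GenModule.
Variables (K : fieldType) (A : falgType K).
Implicit Types (M N P S X Y Z : lmodType A) (e : A).

(* [P] is isomorphic to [A e] through [e |-> g] *)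
Definition gen_module e P (g : P) : Prop :=
  [/\ e *: g = g, forall x, exists a, x = a *: g & forall a, a *: g = 0 -> a * e = 0].

Lemma gen_module_hom e P (g : P) M (m : M) :
  gen_module e g -> e *: m = m ->
  exists h : {linear P -> M}, forall a, h (a *: g) = a *: m.
Proof.
move=> [eg gs gk] em; have [p pE] := scale_linear g; have [q qE] := scale_linear m.
have [||h hE] := @linear_factor _ _ _ _ p q.
- by move=> y; have [a ->] := gs y; exists a; rewrite pE.
- by move=> a; rewrite pE qE => /gk h; rewrite -em scalerA h scale0r.
by exists h => a; rewrite -pE hE qE.
Qed.

Lemma gen_module_projective e P (g : P) : gen_module e g -> projective P.
Proof.
move=> hg; have [eg gs gk] := hg; split=> [|X Y f h fX fY fs].
  have [p pE] := scale_linear g; apply: (findim_surj (g := p)).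
    by move=> y; have [a ->] := gs y; exists a; rewrite pE.
  exact: findim_regular.
have [x fx] := fs (h g).
have ee : e * e = e.
  have := gk (1 - e); rewrite scalerBl scale1r eg subrr mulrBl mul1r => /(_ erefl).
  by move=> /eqP; rewrite subr_eq0 => /eqP.
have [|h' h'E] := @gen_module_hom e P g X (e *: x) hg; first by rewrite scalerA ee.
exists h' => y; have [a ->] := gs y.
by rewrite h'E !linearZ fx /= -linearZ eg.
Qed.

Lemma gen_module_ex e : e * e = e -> exists P (g : P), gen_module e g.
Proof.
move=> ee; have [h hE] := scale_linear (e : A^o).
have [P [p [k [ps ki kE]]]] := image_module h.
have pe : p e = p 1 by apply: ki; rewrite !kE !hE -![_ *: _]/(_ * _) ee mul1r.
exists P, (p 1); split=> [|x|a].
- by rewrite -linearZ -pe; congr (p _); rewrite -[_ *: _]/(_ * _) mulr1.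
- by have [a <-] := ps x; exists a; rewrite -linearZ; congr (p _); rewrite -[RHS]/(_ * _) mulr1.
- rewrite -linearZ => /(congr1 k); rewrite kE linear0 hE => h0.
  by rewrite -[RHS]h0 -[RHS]/(a * 1 * e) mulr1.
Qed.

(** Once [f] kills the quotient [S], the vector [f *: x] comes from the submodule, where it is
    killed by a second application of [f]; idempotence makes this second application harmless. *)
Lemma filtered_kill C M (f : A) : f * f = f ->
  (forall S, C S -> forall x : S, f *: x = 0) -> filtered C M ->
  forall x : M, f *: x = 0.
Proof.
move=> ff hC; elim=> [{}M M0 x|{}M N S g h _ IH [gi ex hs] CS x]; first exact: M0.
have /ex [y yE] : h (f *: x) = 0 by rewrite linearZ; apply: (hC _ CS).
by rewrite -ff -scalerA -yE -linearZ IH linear0.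
Qed.

End GenModule.

Section CharModules.
Variables (K : fieldType) (A : falgType K) (I : finType).
Implicit Types (M N P S X Y Z : lmodType A) (i j k : I).

Definition char_module (ch : A -> K) M (u : M) : Prop :=
  [/\ u != 0, forall a, a *: u = (ch a)%:A *: u & forall x, exists c : K, x = c%:A *: u].

Lemma kscalC M a (c : K) (u : M) : a *: (c%:A *: u) = c%:A *: (a *: u).
Proof.
transitivity ((a * c%:A) *: u); first exact: scalerA.
transitivity ((c%:A * a) *: u); last exact/esym/scalerA.
by congr (_ *: _); rewrite mulr_algl mulr_algr.
Qed.

Lemma kscalA M (c d : K) (u : M) : c%:A *: (d%:A *: u) = (c * d)%:A *: u.
Proof.
transitivity ((c%:A * d%:A) *: u); first exact: scalerA.
by congr (_ *: _); rewrite mulr_algl scalerA.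
Qed.

Lemma kscalZ M (c : K) (a : A) (u : M) : (c *: a) *: u = c%:A *: (a *: u).
Proof.
transitivity ((c%:A * a) *: u); last exact/esym/scalerA.
by congr (_ *: _); rewrite mulr_algl.
Qed.

Lemma kscal1 M (u : M) : 1%:A *: u = u.
Proof. by rewrite [1%:A]scale1r; exact: scale1r. Qed.

Lemma kscal0 M (u : M) : (0 : K)%:A *: u = 0.
Proof. by rewrite [0%:A]scale0r; exact: scale0r. Qed.

Lemma kscalDl M (c d : K) (u : M) : (c + d)%:A *: u = c%:A *: u + d%:A *: u.
Proof. by rewrite [(c + d)%:A]scalerDl; exact: scalerDl. Qed.

Lemma kscalN M (c : K) (u : M) : (- c)%:A *: u = - (c%:A *: u).
Proof. by rewrite [(- c)%:A]scaleNr; exact: scaleNr. Qed.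

Lemma char_module_act ch M (u : M) : char_module ch u ->
  forall a (x : M), a *: x = (ch a)%:A *: x.
Proof.
move=> [_ h s] a x; have [c ->] := s x.
by rewrite [LHS]kscalC (h a) !kscalA mulrC.
Qed.

Lemma char_module_findim ch M (u : M) : char_module ch u -> findim M.
Proof.
move=> [_ _ h]; apply/findimP; exists [:: u] => x; have [c ->] := h x.
by apply: kspanZ; apply: kspan_mem; rewrite mem_head.
Qed.

Lemma kscal_eq0 M (c : K) (u : M) : u != 0 -> c%:A *: u = 0 -> c = 0.
Proof.
move=> u0 h; have [//|c0] := eqVneq c 0; move: u0.
have : (c^-1)%:A *: (c%:A *: u) = 0 by rewrite h; exact: scaler0.
by rewrite kscalA mulVf // kscal1 => ->; rewrite eqxx.
Qed.

Lemma char_module_hom ch M (u : M) N (w : N) : char_module ch u ->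
  (forall a, a *: w = (ch a)%:A *: w) ->
  exists h : {linear M -> N}, h u = w.
Proof.
move=> hM hw; have [u0 hu us] := hM.
have [p pE] := scale_linear u; have [q qE] := scale_linear w.
have [||h hE] := @linear_factor _ _ _ _ p q.
- by move=> y; have [c ->] := us y; exists c%:A; rewrite pE.
- by move=> a; rewrite pE qE hu hw => /(kscal_eq0 u0) ->; rewrite kscal0.
by exists h; rewrite -[u]scale1r -pE hE qE scale1r.
Qed.

Lemma char_module_isom ch M (u : M) N (w : N) :
  char_module ch u -> char_module ch w -> isom M N.
Proof.
move=> hM hN; have [_ hu us] := hM; have [_ hw ws] := hN.
have [f fu] := char_module_hom hM hw; have [g gw] := char_module_hom hN hu.
exists f; exists g => x.
  by have [c ->] := us x; rewrite !linearZ fu /= gw.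
by have [c ->] := ws x; rewrite !linearZ gw /= fu.
Qed.

Lemma char_module_isomr ch M (u : M) N :
  char_module ch u -> isom N M -> exists w : N, char_module ch w.
Proof.
move=> [u0 hu us] [g [f gK fK]]; exists (f u); split.
- by apply: contraNneq u0 => h; rewrite -[u]fK h linear0.
- by move=> a; apply: (can_inj gK); rewrite !linearZ /= fK hu.
- by move=> x; have [c gx] := us (g x); exists c; apply: (can_inj gK); rewrite linearZ /= fK.
Qed.

Lemma char_module_simple ch M (u : M) : char_module ch u -> simple_module M.
Proof.
move=> [u0 hu us]; split; first by exists u.
move=> U [U0 UP]; have [[x [Ux x0]]|no] := pselect (exists x, x \in U /\ x != 0); last first.
  left=> x Ux; apply/eqP; apply: contraT => x0; case: no; by exists x.
right=> y; have [c xE] := us x; have [d ->] := us y.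
have c0 : c != 0 by apply: contraNneq x0 => c0; rewrite xE c0 kscal0.
have -> : d%:A *: u = (d / c)%:A *: x + 0.
  by rewrite addr0 xE kscalA divfK.
exact: UP.
Qed.

Lemma char_module_ext ch ch' M (u : M) :
  char_module ch u -> (forall a, ch a = ch' a) -> char_module ch' u.
Proof. by move=> [u0 hu us] e; split=> // a; rewrite hu e. Qed.

Lemma char_module_uniq ch ch' M (u : M) (w : M) :
  char_module ch u -> char_module ch' w -> forall a, ch a = ch' a.
Proof.
move=> h [w0 hw _] a; have := char_module_act h a w; rewrite hw => /eqP.
rewrite eq_sym -subr_eq0 -kscalN -kscalDl => /eqP /(kscal_eq0 w0) /eqP.
by rewrite subr_eq0 => /eqP.
Qed.

Lemma char_module_ex (ch : {linear A -> K^o}) :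
  monoid_morphism ch -> exists M (u : M), char_module ch u.
Proof.
move=> hm; pose f : {rmorphism A -> K^o} :=
  HB.pack (GRing.Linear.sort ch) (GRing.isMonoidMorphism.Build _ _ _ hm).
exists (resmod f (K^o : lmodType K^o)), 1.
have fE c : ch c%:A = c.
  by rewrite linearZ /= hm.1 -[LHS]/(c * 1) mulr1.
split=> [|a|x]; first exact: oner_neq0.
- by rewrite !resmod_scaleE /= fE.
- by exists x; rewrite resmod_scaleE /= fE -[RHS]/(x * 1) mulr1.
Qed.
End CharModules.

(** * Split basic algebras *)

Section BasicAlgebra.
Variables (K : fieldType) (A : falgType K) (I : finType).
Variable chi : I -> {linear A -> K^o}.
Implicit Types (M N P S X Y Z : lmodType A) (i j : I).

Definition in_rad (x : A) : Prop := forall i, chi i x = 0.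

(* [A] has a nilpotent ideal whose quotient is a product of copies of [K]
   through the characters [chi i] *)
Record split_basic : Prop := SplitBasic {
  sb_mul : forall i, monoid_morphism (chi i);
  sb_nil : exists m, forall s : seq A, size s = m ->
    (forall x, x \in s -> in_rad x) -> \prod_(x <- s) x = 0 }.

Definition radv : {vspace A} := (\bigcap_i lker (linfun (chi i)))%VS.

Lemma memv_rad x : x \in radv <-> in_rad x.
Proof.
split=> [h i|h].
  have := h; rewrite !memvE => /subv_bigcapP /(_ i isT).
  by rewrite -memvE memv_ker lfunE /= => /eqP.
rewrite memvE; apply/subv_bigcapP => i _; rewrite -memvE memv_ker lfunE /=.
by rewrite h.
Qed.

Hypothesis sb : split_basic.

Lemma chiM i x y : chi i (x * y) = (chi i x : K) * chi i y.
Proof. exact: (sb_mul sb i).2. Qed.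
Lemma chi1 i : chi i 1 = 1 :> K. Proof. exact: (sb_mul sb i).1. Qed.
Lemma chi_scalar i (c : K) : chi i c%:A = c.
Proof. by rewrite linearZ /= chi1 -[LHS]/(c * 1) mulr1. Qed.
Lemma chiZ i (c : K) x : chi i (c *: x) = c * chi i x.
Proof. by rewrite linearZ. Qed.

Lemma in_radMl a x : in_rad x -> in_rad (a * x).
Proof. by move=> h i; rewrite chiM h mulr0. Qed.
Lemma in_radMr a x : in_rad x -> in_rad (x * a).
Proof. by move=> h i; rewrite chiM h mul0r. Qed.
Lemma in_radD x y : in_rad x -> in_rad y -> in_rad (x + y).
Proof. by move=> h h' i; rewrite linearD h h' addr0. Qed.
Lemma in_radN x : in_rad x -> in_rad (- x).
Proof. by move=> h i; rewrite linearN h oppr0. Qed.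
Lemma in_radZ (c : K) x : in_rad x -> in_rad (c *: x).
Proof. by move=> h i; rewrite linearZ h; exact: scaler0. Qed.

Lemma rad_expr : exists m, forall r, in_rad r -> r ^+ m = 0.
Proof.
have [m hm] := sb_nil sb; exists m => r hr.
have := hm (nseq m r) (size_nseq _ _); rewrite big_nseq iter_mulr_1.
by apply=> x; rewrite mem_nseq => /andP [_ /eqP ->].
Qed.

Lemma unit_1Brad r : in_rad r -> exists u, u * (1 - r) = 1 /\ (1 - r) * u = 1.
Proof.
have [m hm] := rad_expr => hr; exists (\sum_(i < m) r ^+ i).
have e : (1 - r) * (\sum_(i < m) r ^+ i) = 1.
  by rewrite -[LHS]opprK -mulNr opprB -subrX1 hm // sub0r opprK.
split=> //; rewrite -[RHS]e mulrBl mulrBr mulr1 mul1r; congr (_ - _).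
by rewrite mulr_suml mulr_sumr; apply: eq_bigr => i _; rewrite -exprS -exprSr.
Qed.

Section Nakayama.
Variable N : {vspace A}.
Hypothesis hN : (N <= radv)%VS.

Lemma rad_expv : exists m, (N ^+ m)%VS = 0%VS.
Proof.
have [m hm] := sb_nil sb; exists m.
(* The factors are traded one by one: k factors from [N] on the right make up for the k factors that
   the list lacks. *)
have H k : (k <= m)%N -> forall s, size s = (m - k)%N ->
    (forall x, x \in s -> in_rad x) ->
    forall y, y \in (N ^+ k)%VS -> (\prod_(x <- s) x) * y = 0.
  elim: k => [_ s|k IH km s] ss hs y.
    rewrite expv0 => /vlineP [c ->].
    by rewrite hm ?mul0r // ss subn0.
  rewrite expvSl.
  have : (N * N ^+ k <= lker (amull (\prod_(x <- s) x)))%VS.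
    apply/prodvP => u w hu hw; rewrite memv_ker lfunE /= mulrA.
    have -> : \prod_(x <- s) x * u = \prod_(x <- rcons s u) x by rewrite -cats1 big_cat big_seq1.
    apply/eqP; apply: IH => //; first exact: ltnW.
      by rewrite size_rcons ss subnSK.
    move=> x; rewrite mem_rcons inE => /predU1P [->|]; last exact: hs.
    by apply/memv_rad; apply: subvP hN _ hu.
  by move=> /subvP h /h; rewrite memv_ker lfunE => /eqP.
apply/eqP; rewrite -subv0; apply/subvP => y hy.
by have := H m (leqnn m) [::] _ _ y hy; rewrite subnn big_nil mul1r => ->; rewrite ?mem0v.
Qed.

Lemma nakayama_left (U : {vspace A}) : (U <= N * U)%VS -> U = 0%VS.
Proof.
move=> h; have [m hm] := rad_expv; apply/eqP; rewrite -subv0.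
have H k : (U <= N ^+ k * U)%VS.
  elim: k => [|k IH]; first by rewrite expv0 prod1v.
  by rewrite expvSr -prodvA; apply: subv_trans IH _; apply: prodvSr.
by have := H m; rewrite hm prod0v.
Qed.

(** Stability under [N] keeps G N^k inside [G], so iterating the hypothesis replaces A N by A N^k,
    which vanishes for large k. *)
Lemma nakayama_right (G : {vspace A}) :
  (G * N <= G)%VS -> ({:A} <= G + {:A} * N)%VS -> G = {:A}%VS.
Proof.
move=> hG h; have [m hm] := rad_expv; apply/eqP; rewrite eqEsubv subvf /=.
have GN k : (G * N ^+ k <= G)%VS.
  elim: k => [|k IH]; first by rewrite expv0 prodv1.
  by rewrite expvSl prodvA; apply: subv_trans IH; apply: prodvSl.
have H k : ({:A} <= G + {:A} * N ^+ k)%VS.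
  elim: k => [|k IH]; first by rewrite expv0 prodv1 addvSr.
  apply: subv_trans IH _; rewrite subv_add addvSl /=.
  apply: (@subv_trans _ _ ((G + {:A} * N) * N ^+ k)%VS); first exact: prodvSl.
  rewrite prodvDl -prodvA -expvSl; apply: addvS => //; exact: GN.
by have := H m; rewrite hm prodv0 addv0.
Qed.
End Nakayama.

(** If no character works, then for every i each nonzero x has some r in the kernel of [chi i] with
    r x nonzero. Composing over all i yields a radical element, and repeating this m times
    contradicts nilpotency. *)
Lemma simple_char M : simple_module M -> exists i (u : M), char_module (chi i) u.
Proof.
move=> [[u u0] sM].
suff [i hi] : exists i, forall r, chi i r = 0 -> forall x : M, r *: x = 0.
  exists i, u; have hu a : a *: u = (chi i a : K)%:A *: u.
    apply/eqP; rewrite -subr_eq0 -scalerBl; apply/eqP; apply: hi.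
    by rewrite linearB /= chi_scalar subrr.
  split=> //.
  have [|a x y [c ->] [d ->]|U hU] := @mk_submodClosed A M (fun x => exists c : K, x = c%:A *: u).
  - by exists 0; rewrite kscal0.
  - exists ((chi i a : K) * c + d); rewrite kscalDl; congr (_ + _).
    by rewrite kscalC hu kscalA mulrC.
  have [|h|h] := sM U.
  - by split=> [|a x y hx hy]; [exact: rpred0|apply: rpredD => //; apply: rpredZ].
  - have /h e : u \in U by apply/hU; exists 1; rewrite kscal1.
    by rewrite e eqxx in u0.
  - by move=> x; apply/hU.
apply: contrapT => no.
have step i (x : M) : x != 0 -> exists2 r, chi i r = 0 & r *: x != 0.
  move=> x0; apply: contrapT => nr; apply: no; exists i => r hr y.
  (* The vectors killed by the kernel of [chi i] form a submodule; it contains x, so by simplicity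
     it is everything, against the choice of i. *)
  have [|a y1 y2 h1 h2 s hs|U hU] :=
      @mk_submodClosed A M (fun y => forall s, chi i s = 0 -> s *: y = 0).
  - by move=> s _; rewrite scaler0.
  - by rewrite scalerDr scalerA h1 ?h2 ?addr0 // chiM hs mul0r.
  have [|h|h] := sM U.
  - by split=> [|a y1 y2 h1 h2]; [exact: rpred0|apply: rpredD => //; apply: rpredZ].
  - have /h e : x \in U; last by rewrite e eqxx in x0.
    apply/hU => s hs; apply/eqP/negPn/negP => hsx; apply: nr; by exists s.
  - by have /hU := h y; apply.
have rstep (x : M) : x != 0 -> exists2 r, in_rad r & r *: x != 0.
  move=> x0.
  have [r h1 h2] : exists2 r, (forall i, i \in enum I -> chi i r = 0) & r *: x != 0.
    elim: (enum I) => [|i s [r h1 h2]]; first by exists 1; rewrite ?scale1r.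
    have [r' h3 h4] := step i _ h2; exists (r' * r); last by rewrite -scalerA.
    move=> j; rewrite inE chiM => /predU1P [->|/h1 ->]; last by rewrite mulr0.
    by rewrite h3 mul0r.
  by exists r => // i; apply: h1; rewrite mem_enum.
have [m hm] := sb_nil sb.
have H k : exists s : seq A, [/\ size s = k, forall x, x \in s -> in_rad x
    & (\prod_(x <- s) x) *: u != 0].
  elim: k => [|k [s [s1 s2 s3]]]; first by exists [::]; rewrite big_nil scale1r.
  have [r hr hru] := rstep _ s3; exists (r :: s); rewrite big_cons -scalerA /= s1.
  by split=> // x; rewrite inE => /predU1P [->|/s2].
have [s [s1 s2]] := H m; by rewrite hm // scale0r eqxx.
Qed.

Variable e : I -> A.
Record idem_family : Prop := IdemFamily {
  if_chi : forall i j, chi i (e j) = (i == j)%:R :> K;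
  if_orth : forall i j, e i * e j = if i == j then e i else 0;
  if_sum : \sum_i e i = 1 }.
Hypothesis ef : idem_family.

Lemma eii i : e i * e i = e i. Proof. by rewrite (if_orth ef) eqxx. Qed.
Lemma eij i j : i != j -> e i * e j = 0.
Proof. by rewrite (if_orth ef) => /negbTE ->. Qed.
Lemma chi_e i : chi i (e i) = 1 :> K. Proof. by rewrite (if_chi ef) eqxx. Qed.
Lemma chi_en i j : i != j -> chi i (e j) = 0 :> K.
Proof. by rewrite (if_chi ef) => /negbTE ->. Qed.

Lemma sum_el x : x = \sum_i e i * x.
Proof. by rewrite -mulr_suml (if_sum ef) mul1r. Qed.
Lemma sum_er x : x = \sum_i x * e i.
Proof. by rewrite -mulr_sumr (if_sum ef) mulr1. Qed.

Lemma rad_part a i : in_rad (a * e i - (chi i a : K) *: e i).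
Proof.
move=> k; rewrite linearB /= chiM chiZ; have [->|ki] := eqVneq k i.
  by rewrite chi_e subrr.
by rewrite chi_en // !mulr0 subrr.
Qed.
Lemma rad_partl a i : in_rad (e i * a - (chi i a : K) *: e i).
Proof.
move=> k; rewrite linearB /= chiM chiZ; have [->|ki] := eqVneq k i.
  by rewrite chi_e mulr1 mul1r subrr.
by rewrite chi_en // mulr0 mul0r subrr.
Qed.

Lemma act_e M (z : M) i a : e i *: z = z ->
  a *: z = (chi i a : K)%:A *: z + (a * e i - (chi i a : K) *: e i) *: z.
Proof.
by move=> h; rewrite scalerBl (kscalZ _ (e i)) h -(scalerA a (e i) z) h addrC subrK.
Qed.

Lemma char_e M (u : M) i : char_module (chi i) u -> forall k (x : M), e k *: x = if k == i then x else 0.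
Proof.
move=> h k x; rewrite (char_module_act h); have [->|ki] := eqVneq k i.
  by rewrite chi_e kscal1.
by rewrite chi_en 1?eq_sym // kscal0.
Qed.

Lemma char_rad M (u : M) i r : char_module (chi i) u -> in_rad r -> forall x : M, r *: x = 0.
Proof. by move=> h hr x; rewrite (char_module_act h) hr kscal0. Qed.

Lemma char_isom_inj M (u : M) i N (w : N) k :
  char_module (chi i) u -> char_module (chi k) w -> isom M N -> i = k.
Proof.
move=> hu hw hi; have [w' hw'] := char_module_isomr hw hi.
have := char_module_uniq hu hw' (e i); rewrite chi_e (if_chi ef).
by case: eqP => // _ /eqP; rewrite oner_eq0.
Qed.

(** A composition series given by generators: the tails span submodules, and [z] adds a simple
    quotient at [i] to the span of its tail, or nothing if it already lies there. *)
Fixpoint adapted M (s : seq (I * M)) : Prop :=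
  if s is (i, z) :: s' then
    [/\ adapted s', e i *: z = z & forall r, in_rad r -> kspan (map snd s') (r *: z)]
  else True.

Lemma kspan_trans M (s t : seq M) x :
  (forall y, y \in s -> kspan t y) -> kspan s x -> kspan t x.
Proof. by move=> h; apply: kspan_min => // *; [exact: kspan0|exact: kspanD|exact: kspanZ]. Qed.

Lemma adapted_ex M : findim M ->
  exists s : seq (I * M), adapted s /\ forall x, kspan (map snd s) x.
Proof.
move=> /findimP [t ht]; have [m hm] := sb_nil sb.
(* Induction on the radical length p: if products of p+1 radical elements kill [t'], then products
   of p kill its multiples by a basis of the radical. *)
suff H p (t' : seq M) : (forall x, x \in t' -> forall rs, size rs = p ->
    (forall r, r \in rs -> in_rad r) -> (\prod_(r <- rs) r) *: x = 0) ->
    exists s, adapted s /\ forall x, x \in t' -> kspan (map snd s) x.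
  have [|s [s1 s2]] := H m t.
    by move=> x _ rs h1 h2; rewrite hm // scale0r.
  by exists s; split=> // x; apply: kspan_trans (ht x).
elim: p t' => [|p IH] t' h.
  exists [::]; split=> // x hx /=.
  by have := h x hx [::] erefl; rewrite big_nil scale1r; apply.
have [|s [s1 s2]] := IH [seq b *: x | b <- vbasis radv, x <- t'].
  move=> _ /allpairsP [[b x] [hb hx ->]] rs h1 h2 /=.
  have := h x hx (rcons rs b); rewrite -cats1 big_cat big_seq1 -scalerA cats1; apply.
    by rewrite size_rcons h1.
  move=> r; rewrite mem_rcons inE => /predU1P [->|]; last exact: h2.
  by apply/memv_rad; apply: vbasis_mem.
have radt x r : x \in t' -> in_rad r -> kspan (map snd s) (r *: x).
  move=> hx /memv_rad hr; rewrite (coord_vbasis hr) scaler_suml.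
  apply: kspan_sum => n; rewrite (kscalZ _ (vbasis radv)`_n); apply: kspanZ; apply: s2.
  by apply: allpairs_f => //; rewrite mem_nth // size_tuple.
exists ([seq (i, e i *: x) | i <- enum I, x <- t'] ++ s); split.
  set l := [seq _ | _ <- _, _ <- _].
  have : forall p, p \in l -> exists i x, x \in t' /\ p = (i, e i *: x).
    by move=> _ /allpairsP [[i x] [_ hx ->]]; exists i, x.
  elim: l => [//|q l IHl] hl.
  have [i [x [hx ->]]] := hl q (mem_head _ _) => /=; split.
  - by apply: IHl => q' hq'; apply: hl; rewrite inE hq' orbT.
  - by rewrite scalerA eii.
  - move=> r hr; rewrite map_cat; apply: kspan_catr.
    by rewrite scalerA; apply: radt => //; apply: in_radMr.
move=> x hx; rewrite -[x]scale1r -(if_sum ef) scaler_suml; apply: kspan_sum => i.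
apply: kspan_mem; rewrite map_cat mem_cat; apply/orP; left.
by apply/mapP; exists (i, e i *: x) => //; apply: allpairs_f; rewrite ?mem_enum.
Qed.

End BasicAlgebra.

(** * Standard modules and Baer's criterion *)

Section FilteredIso.
Variables (K : fieldType) (A : falgType K).

Lemma filtered_iso (C : lmodType A -> Prop) (M N : lmodType A) (j : {linear M -> N}) :
  injective j -> (forall y, exists x, j x = y) -> filtered C M -> filtered C N.
Proof.
move=> ji js fM; case: fM j ji js => [{}M M0|{}M M' S g h fM [gi ex hs] CS] j ji js.
  by apply: Filtered0 => y; have [x <-] := js y; rewrite (M0 x) linear0.
have [||h' h'E] := @linear_factor _ _ _ _ j h.
- exact: js.
- move=> x jx; have -> : x = 0 by apply: ji; rewrite jx linear0.
  exact: linear0.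
apply: (FilteredS (g := j \o g) (h := h') fM) CS; split.
- by move=> x y /ji /gi.
- move=> y; have [x <-] := js y; rewrite h'E; split=> [/ex [z <-]|[z /ji <-]].
    by exists z.
  by apply/ex; exists z.
- by move=> y; have [x <-] := hs y; exists (j x); rewrite h'E.
Qed.

Lemma inj_left_inverse (T U : Type) (t0 : T) (j : T -> U) : injective j ->
  exists s, cancel j s.
Proof.
move=> ji; pose s y := if pselect (exists x, j x = y) is left p then sval (cid p) else t0.
exists s => x; rewrite /s; case: pselect => [p|[]]; last by exists x.
exact/ji/(svalP (cid p)).
Qed.
End FilteredIso.

Section Standards.
Variables (K : fieldType) (A : falgType K) (I : finType).
Variable chi : I -> {linear A -> K^o}.
Hypothesis sb : split_basic chi.
Variable e : I -> A.
Hypothesis ef : idem_family chi e.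
Implicit Types (M N P S X Y Z D Q : lmodType A).

(** A partial converse of [filtered_kill]. The tails of an adapted list give the filtration: a
    generator in the span of its tail is skipped, any other contributes the simple module at its
    vertex. *)
Lemma filtered_intro (C : lmodType A -> Prop) M : findim M ->
  (forall S i (u : S), char_module (chi i) u -> (exists x : M, e i *: x != 0) -> C S) ->
  filtered C M.
Proof.
move=> fM hC; have [s [s1 s2]] := adapted_ex sb ef fM.
suff [Z [j [ji jE fZ]]] : exists Z (j : {linear Z -> M}),
   [/\ injective j, forall y, kspan (map snd s) y <-> exists x, j x = y & filtered C Z].
  by apply: filtered_iso ji _ fZ => y; apply/jE.
elim: s s1 {s2} => [_|[i z] s IH /= [s1 s2 s3]].
  have [h hE] := scale_linear (0 : M).
  have [Z [p [k [ps ki kE]]]] := image_module h.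
  have Z0 (x : Z) : x = 0.
    by have [a <-] := ps x; apply: ki; rewrite kE hE scaler0 linear0.
  exists Z, k; split=> //; last exact: Filtered0.
  by move=> y; split=> [->|[x <-]] /=; [exists 0|rewrite (Z0 x)]; rewrite linear0.
have [Z [j [ji jE fZ]]] := IH s1.
have [sz|sz] := pselect (kspan (map snd s) z).
  exists Z, j; split=> // y; split=> [[c /jE [x hx]]|/jE hy]; last first.
    by exists 0; rewrite kscal0 subr0.
  have /jE [x' hx'] := sz; exists (x + c%:A *: x').
  by rewrite linearD linearZ /= hx hx' subrK.
have z0 : z != 0 by apply/eqP => z0; apply: sz; rewrite z0; apply: kspan0.
have [sc scE] := scale_linear z; have [f fE] := pair_lift j sc.
have [Z' [p [k [ps ki kE]]]] := image_module f.
have [S [u hu]] := char_module_ex (sb_mul sb i).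
have [su suE] := scale_linear u.
have [zr zrE] : exists zr : {linear Z -> S}, forall x, zr x = 0.
  by apply: (@mk_linear _ _ _ (fun=> 0)) => a x y; rewrite scaler0 addr0.
have [t tE] := pair_lift zr su.
(* On [z] the element [a] acts as the scalar [chi i a] up to the radical, hence up to the tail. A
   nonzero scalar would put [z] into the span of the tail; so the map to the simple module at [i] is
   well defined. *)
have keyz x a : j x + a *: z = 0 -> chi i a = 0 :> K.
  move=> h; apply/eqP/negPn/negP => c0; apply: sz.
  have hz : kspan (map snd s) ((chi i a : K)%:A *: z).
    have -> : (chi i a : K)%:A *: z = - j x - (a * e i - (chi i a : K) *: e i) *: z.
      apply/eqP; rewrite eq_sym subr_eq -(act_e chi a s2) eq_sym -addr_eq0 addrC h.
      by rewrite eqxx.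
    rewrite -linearN; apply: kspanD; first by apply/jE; eexists.
    by rewrite -scaleNr; apply: s3; apply: in_radN; apply: (rad_part sb ef).
  have := kspanZ (chi i a : K)^-1 hz.
  by rewrite kscalA mulVf // kscal1.
have kz a : kspan (map snd s) (a *: z - (chi i a : K)%:A *: z).
  by rewrite [a *: z](act_e chi a s2) addrAC subrr add0r; apply/s3/(rad_part sb ef).
have [||h hE] := @linear_factor _ _ _ _ p t.
- exact: ps.
- move=> [x a] /(congr1 k); rewrite kE fE scE linear0 tE zrE suE add0r => /keyz h.
  by have [_ -> _] := hu; rewrite h kscal0.
have [g gE] : exists g : {linear Z -> Z'}, forall x, g x = p (x, 0).
  apply: (@mk_linear _ _ _ (fun x => p (x, 0))) => a x y; rewrite -linearP.
  by congr (p _); congr pair; rewrite /= scaler0 addr0.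
have kg x : k (g x) = j x by rewrite gE kE fE linear0 addr0.
exists Z', k; split=> // [y|].
- split=> [[c /jE [x hx]]|[x' <-]].
    exists (p (x, c%:A)); rewrite kE fE scE hx; exact: subrK.
  have [[x a] <-] := ps x'; exists (chi i a : K); rewrite kE fE scE -addrA.
  by apply: kspanD; [apply/jE; exists x|apply: kz].
- apply: (FilteredS (g := g) (h := h) fZ); last first.
    by apply: (hC S i u hu); exists z; rewrite s2.
  split.
  + by move=> x y hxy; apply: ji; rewrite -!kg hxy.
  + move=> y; have [[x a] <-] := ps y; rewrite hE tE zrE suE add0r; split.
      have [u0 hu' _] := hu; rewrite hu' => /(kscal_eq0 u0) ca.
      have /jE [x' hx'] := kz a; exists (x + x'); apply: ki.
      by rewrite kg kE fE scE linearD hx' ca kscal0 subr0.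
    move=> [x' /(congr1 k)]; rewrite kg kE fE scE => hx'.
    have /keyz ca : j (x - x') + a *: z = 0 by rewrite linearB hx' opprD addrA subrr sub0r addNr.
    by have [_ -> _] := hu; rewrite ca kscal0.
  + move=> y; have [_ _ us] := hu; have [c ->] := us y.
    by exists (p (0, c%:A)); rewrite hE tE linear0 add0r suE.
Qed.

(* With [C] the quotient of a standard module by its top, this is injectivity
   of [C], in the form of Baer's criterion. *)
Definition baer (C : lmodType A) : Prop := forall i (phi : A -> C),
  (forall r s, in_rad chi r -> r * e i = r -> in_rad chi s -> s * e i = s ->
     phi (r + s) = phi r + phi s) ->
  (forall a r, in_rad chi r -> r * e i = r -> phi (a * r) = a *: phi r) ->
  exists c, forall r, in_rad chi r -> r * e i = r -> phi r = r *: c.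

(** The map is defined on the image of [d] and extended over an adapted list, one generator at a
    time. A new generator z at i yields r |-> h (r z) on the radical of A e_i, and the component at
    i of the element supplied by [baer] is the value at z. *)
Lemma baer_extend (C : lmodType A) Q Y (d : {linear Q -> Y}) (f : {linear Q -> C}) :
  baer C -> findim Y -> (forall q, d q = 0 -> f q = 0) ->
  exists h : {linear Y -> C}, forall q, h (d q) = f q.
Proof.
move=> bC fY kdf; have [s [s1 s2]] := adapted_ex sb ef fY.
suff [Z [j [h [ji jE hE]]]] : exists Z (j : {linear Z -> Y}) (h : {linear Z -> C}),
   [/\ injective j, forall y, kspan (map snd s) y -> exists x, j x = y &
     forall q, exists2 x, j x = d q & h x = f q].
  have [||h' h'E] := @linear_factor _ _ _ _ j h.
  - by move=> y; apply: jE.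
  - by move=> x jx; have -> : x = 0 by [apply: ji; rewrite jx linear0]; exact: linear0.
  by exists h' => q; have [x <- <-] := hE q.
elim: s s1 {s2} => [_|[i z] s IH /= [s1 s2 s3]].
  have [Z [p [k [ps ki kE]]]] := image_module d.
  have [||h hE] := @linear_factor _ _ _ _ p f.
  - exact: ps.
  - by move=> q /(congr1 k); rewrite kE linear0; apply: kdf.
  exists Z, k, h; split=> // [y ->|q]; first by exists 0; rewrite linear0.
  by exists (p q); rewrite ?kE ?hE.
have [Z [j [h [ji jE hE]]]] := IH s1.
have [sz|sz] := pselect (exists x, j x = z).
  exists Z, j, h; split=> // y [c /jE [x hx]].
  have [x' hx'] := sz; exists (x + c%:A *: x').
  by rewrite linearD linearZ /= hx hx' subrK.
have [jv jvK] := inj_left_inverse (0 : Z) ji.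
pose phi a := h (jv (a *: z)).
have phiE a x : j x = a *: z -> phi a = h x by rewrite /phi => <-; rewrite jvK.
have [r r' hr re hs se|a r hr re|c0 c0E] := bC i phi.
- have [x hx] := jE _ (s3 r hr); have [y hy] := jE _ (s3 r' hs).
  rewrite (phiE _ _ hx) (phiE _ _ hy) -linearD; apply: phiE.
  by rewrite linearD hx hy scalerDl.
- have [x hx] := jE _ (s3 r hr).
  by rewrite (phiE _ _ hx) -linearZ; apply: phiE; rewrite linearZ hx /= scalerA.
have [sc scE] := scale_linear z; have [f' f'E] := pair_lift j sc.
have [Z' [p [k [ps ki kE]]]] := image_module f'.
have [su suE] := scale_linear (e i *: c0).
have [t tE] := pair_lift h su.
have key x a : j x + a *: z = 0 -> h x + a *: (e i *: c0) = 0.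
  move=> hx; pose r := a * e i - (chi i a : K) *: e i.
  have rr : in_rad chi r by apply: (rad_part sb ef).
  have re : r * e i = r by rewrite /r mulrBl -mulrA -scalerAl (eii ef).
  have [x' hx'] := jE _ (s3 r rr).
  have az : a *: z = (chi i a : K)%:A *: z + j x'.
    by rewrite hx' [LHS](act_e chi a s2).
  have [ca|ca] := eqVneq (chi i a : K) 0; last first.
    case: sz; exists ((chi i a : K)^-1%:A *: - (x + x')).
    rewrite linearZ linearN linearD /=.
    have -> : - (j x + j x') = (chi i a : K)%:A *: z.
      by apply/eqP; rewrite eq_sym -addr_eq0 addrCA -az hx.
    by rewrite kscalA mulVf // kscal1.
  move: az; rewrite ca kscal0 add0r => az.
  have -> : a *: (e i *: c0) = r *: c0.
    by rewrite scalerA /r ca scale0r subr0.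
  rewrite -c0E // (phiE r x') // -linearD.
  have -> : x + x' = 0 by apply: ji; rewrite linearD -az hx linear0.
  exact: linear0.
have [||h' h'E] := @linear_factor _ _ _ _ p t.
- exact: ps.
- move=> [x a] /(congr1 k); rewrite kE f'E scE linear0 tE suE; exact: key.
exists Z', k, h'; split=> // [y [c /jE [x hx]]|q].
- exists (p (x, c%:A)); rewrite kE f'E scE hx; exact: subrK.
- have [x hx1 hx2] := hE q.
  exists (p (x, 0)); first by rewrite kE f'E linear0 addr0.
  by rewrite h'E tE linear0 addr0.
Qed.

Variables (L : I -> lmodType A) (ord : rel I).
Hypothesis hL : forall i, exists u : L i, char_module (chi i) u.
Hypothesis ord_refl : reflexive ord.

Lemma factors_below_kill i M : factors_below L ord i M ->
  forall k, ~~ ord k i -> forall x : M, e k *: x = 0.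
Proof.
move=> fM k nk; apply: (filtered_kill (eii ef k) _ fM) => S [j oj iS] x.
have [u hu] := hL j; have [w hw] := char_module_isomr hu iS.
rewrite (char_e ef hw); case: eqP => // kj.
by rewrite kj oj in nk.
Qed.

Lemma factors_below_intro i M : findim M ->
  (forall k, ~~ ord k i -> forall x : M, e k *: x = 0) -> factors_below L ord i M.
Proof.
move=> fM h; apply: filtered_intro fM _ => S k u hu [x hx].
exists k; last by have [w hw] := hL k; apply: char_module_isom hu hw.
by apply: contraT => nk; rewrite h // eqxx in hx.
Qed.

(** This is locality of e_i A e_i: the corner of [a] differs from e_i by a radical element, and 1
    minus a radical element is invertible. *)
Lemma local_unit i a : chi i a = 1 :> K -> exists b, b * a * e i = e i.
Proof.
move=> ha; pose r := e i - e i * a * e i.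
have hr : in_rad chi r.
  move=> k; rewrite linearB /= !(chiM sb); have [->|ki] := eqVneq k i.
    by rewrite (chi_e ef) ha !mulr1 subrr.
  by rewrite (chi_en ef ki) mulr0 subr0.
have [u [hu _]] := unit_1Brad sb hr; exists (u * e i).
have re : (1 - r) * e i = e i * a * e i.
  rewrite mulrBl mul1r /r mulrBl (eii ef) -(mulrA (e i * a)) (eii ef).
  by rewrite opprB addrC subrK.
by rewrite -!mulrA [X in u * X]mulrA -re mulrA hu mul1r.
Qed.

Lemma gen_module_cover i P (g : P) (p : {linear P -> L i}) :
  gen_module (e i) g -> p g != 0 -> projective_cover p.
Proof.
move=> hg pg; have [eg gs gk] := hg; have [u hu] := hL i; have [u0 hu' us] := hu.
have [c pgE] := us (p g).
have c0 : c != 0 by apply: contraNneq pg => c0; rewrite pgE c0 kscal0.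
have ps : surj_lin p.
  move=> y; have [d ->] := us y; exists ((d / c)%:A *: g).
  by rewrite linearZ /= pgE kscalA divfK.
split=> //; first exact: gen_module_projective hg.
move=> X t ts; have [x hx] := ts (p g); have [a ha] := gs (t x).
have ca : chi i a = 1 :> K.
  move: hx; rewrite /= ha linearZ /= (char_module_act hu) => /eqP.
  rewrite -subr_eq0 -{2}[p g]kscal1 -kscalN -kscalDl => /eqP /(kscal_eq0 pg) /eqP.
  by rewrite subr_eq0 => /eqP.
have [b hb] := local_unit ca.
move=> y; have [d ->] := gs y; exists ((d * b) *: x).
rewrite linearZ /= ha scalerA -[in LHS]eg scalerA.
have -> : d * b * a * e i = d * e i by rewrite -!mulrA (mulrA b) hb.
by rewrite -scalerA eg.
Qed.

(** If k differed from i, then e_i would kill [S], and the kernel of P -> S would contain a vector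
    lying over the top [L i]; by the cover property it would be all of P. *)
Lemma standard_top i D k S (u : S) (s : {linear D -> S}) :
  standard L ord i D -> char_module (chi k) u -> (exists x, s x != 0) -> k = i.
Proof.
move=> [P [p [q [[pP ps pe] [qs _ _]]]]] hu [x0 sx0].
have [|/eqP ki] := eqVneq k i; first by [].
have [Z [z [zi zE]]] := kernel_module (s \o q).
have [w hw] := hL i; have [y py] := ps w.
have [x hx] : exists x, z x = e i *: y.
  apply/zE => /=; rewrite !linearZ /= (char_e ef hu).
  by case: eqP => // ik; case: ki.
have zs : surj_lin z.
  apply: pe => t; have [_ _ us] := hw; have [c ->] := us t; exists (c%:A *: x).
  by rewrite linearZ /= hx linearZ /= py (char_e ef hw) eqxx.
have [y0 qy] := qs x0; have [x1 hx1] := zs y0.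
have : (s \o q) y0 = 0 by apply/zE; exists x1.
by rewrite /= qy => h; rewrite h eqxx in sx0.
Qed.

Lemma standard_kill i D : standard L ord i D ->
  forall k, ~~ ord k i -> forall x : D, e k *: x = 0.
Proof. by move=> [P [p [q [_ [_ fb _]]]]]; apply: factors_below_kill fb. Qed.

(** Standard modules depend on the choice of a projective cover. A surjection between any two is
    enough to transfer that an element acts as zero. *)
Lemma standard_surj i D D' : standard L ord i D -> standard L ord i D' ->
  exists h : {linear D -> D'}, surj_lin h.
Proof.
move=> [P [p [q [[[fP lP] ps _] [qs _ qu]]]]].
move=> [P' [p' [q' [[[fP' _] ps' pe'] [qs' fb' _]]]]].
have [u hu] := hL i.
have [a aE] := lP P' (L i) p' p fP' (char_module_findim hu) ps'.
have as' : surj_lin a.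
  by apply: pe' => y; have [x px] := ps y; exists x; rewrite /= aE.
have [||h hE] := qu D' (q' \o a).
- by move=> y; have [z <-] := qs' y; have [x <-] := as' z; exists x.
- exact: fb'.
exists h => y; have [z <-] := qs' y; have [x <-] := as' z.
by exists (q x); rewrite hE.
Qed.

(* [w] plays the role of the image of the idempotent [e i] in the standard module *)
Lemma standard_intro i D (w : D) (u : L i) (P : lmodType A) (g : P)
    (p : {linear P -> L i}) (q : {linear P -> D}) :
  gen_module (e i) g -> p g != 0 -> q g = w ->
  (forall x, exists a, x = a *: w) -> findim D ->
  (forall k, ~~ ord k i -> forall x : D, e k *: x = 0) ->
  (forall X (x : X), e i *: x = x -> (forall k, ~~ ord k i -> forall y : X, e k *: y = 0) ->
     exists h : {linear D -> X}, h w = x) ->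
  projective_cover p /\ standard_quotient L ord i q.
Proof.
move=> hg pg qg ws fD kD uD; split; first exact: gen_module_cover hg pg.
have [eg gs gk] := hg; split.
- by move=> y; have [a ->] := ws y; exists (a *: g); rewrite linearZ qg.
- exact: factors_below_intro.
move=> X f fs fb; have [||h hE] := uD X (f g).
- by rewrite -linearZ eg.
- exact: factors_below_kill fb.
by exists h => x; have [a ->] := gs x; rewrite !linearZ qg /= hE.
Qed.
End Standards.

(** * Products of subspaces, dual bases and exactness of induction *)

Section ProdInd.
Variables (K : fieldType) (A : falgType K).
Implicit Types U V W : {vspace A}.

Lemma prodv_ind U V (P : A -> Prop) :
  P 0 -> (forall x y, P x -> P y -> P (x + y)) -> (forall (c : K) x, P x -> P (c *: x)) ->
  (forall u v, u \in U -> v \in V -> P (u * v)) -> forall x, x \in (U * V)%VS -> P x.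
Proof.
move=> P0 PD PZ PM x; rewrite /prodv locked_withE => /coord_span ->.
elim/big_ind: _ => // i _; apply: PZ => /=.
set s := [seq _ | _ <- _, _ <- _]; have : s`_i \in s.
  by rewrite mem_nth // size_allpairs !size_tuple.
by move=> /allpairsP [[u v] [/vbasis_mem hu /vbasis_mem hv ->]]; apply: PM.
Qed.

Lemma aspace_mul (B : {aspace A}) x y : x \in B -> y \in B -> x * y \in B.
Proof. by move=> hx hy; rewrite -(prodv_id B) memv_mul. Qed.

(** Stands for the quotient map A -> A/W: a linear map with kernel [W] that still takes values in
    [A]. *)
Definition modv W : 'End(A) := (\1 - projv W)%VF.

Lemma modvE W x : (modv W x == 0) = (x \in W).
Proof.
rewrite /modv add_lfunE opp_lfunE id_lfunE subr_eq0; apply/eqP/idP => [->|h].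
  exact: memv_proj.
by rewrite projv_id.
Qed.

Lemma exists_functional W x : x \notin W ->
  exists2 f : {linear A -> K^o}, f x != 0 & forall y, y \in W -> f y = 0.
Proof.
rewrite -modvE => h.
have [i hi] : exists i, coord (vbasis {:A}) i (modv W x) != 0.
  apply: contrapT => no; move/eqP: h; apply.
  rewrite (coord_vbasis (memvf (modv W x))) big1 // => i _.
  have [->|ni] := eqVneq (coord (vbasis {:A}) i (modv W x)) 0; first by rewrite scale0r.
  by case: no; exists i.
have [f fE] : exists f : {linear A -> K^o}, f =1 (fun y => coord (vbasis {:A}) i (modv W y)).
  by apply: mk_linear => a y z; rewrite !linearP.
exists f; rewrite ?fE // => y; rewrite -modvE fE => /eqP ->.
by rewrite linear0.
Qed.
End ProdInd.

Section Exactness.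
Variables (K : fieldType) (A : falgType K) (B : {aspace A}).
Notation sB := (subvs_of B).
Notation pt := (ptensor (@vsval _ _ B)).

(* A dual basis exhibits [A] as a projective right [B]-module. *)
Definition dual_basis (s : seq (A * 'End(A))) : Prop :=
  [/\ forall p, p \in s -> forall a, p.2 a \in B,
      forall p, p \in s -> forall a b, b \in B -> p.2 (a * b) = p.2 a * b
    & forall a, a = \sum_(p <- s) p.1 * p.2 a].

Variables (s : seq (A * 'End(A))) (hs : dual_basis s).

Lemma dual_coord p (M : lmodType sB) : p \in s ->
  exists k : {additive tensor (@vsval _ _ B) M -> M},
    forall a m, k (pt a m) = vsproj B (p.2 a) *: m.
Proof.
move=> ps; have [h1 h2 _] := hs.
apply: (tensor_lift (h := fun a m => vsproj B (p.2 a) *: m)).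
- by move=> a a' m; rewrite !linearD /= scalerDl.
- by move=> a m m'; rewrite scalerDr.
move=> a b m; rewrite h2 ?subvsP // scalerA; congr (_ *: _).
have pa := h1 p ps a.
have m' : p.2 a * vsval b \in B by apply: aspace_mul => //; apply: subvsP.
by apply: val_inj; rewrite /= !vsprojK.
Qed.

(** The coordinates of [t] are natural in [M], so an induced map kills [t] only if the original map
    kills every coordinate. Exactness of induction is thereby checked coordinatewise. *)
Lemma dual_expand (M : lmodType sB) (t : induced M) :
  exists m : A * 'End(A) -> M, t = \sum_(p <- s) pt p.1 (m p) /\
   forall (P : lmodType sB) (h : {linear M -> P}), induced_map h t = 0 ->
     forall p, p \in s -> h (m p) = 0.
Proof.
have [h1 h2 h3] := hs.
(* Coordinates exist for the members of [s]; elsewhere 0 is a default value. *)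
pose k p : {additive tensor (@vsval _ _ B) M -> M} :=
  if pselect (p \in s) is left ps then sval (cid (dual_coord M ps)) else \0.
have kE p : p \in s -> forall a m, k p (pt a m) = vsproj B (p.2 a) *: m.
  by move=> ps; rewrite /k; case: pselect => // ps'; exact: (svalP (cid (dual_coord M ps'))).
exists (fun p => k p t); split.
  move: t; apply: tensor_ind_sum => [|x y hx hy|a m].
  - by rewrite big1 // => p _; rewrite raddf0 ptensor0r.
  - rewrite [in LHS]hx [in LHS]hy -big_split; apply: eq_bigr => p _.
    by rewrite raddfD ptensorDr.
  rewrite [in LHS](h3 a) ptensor_suml big_seq [RHS]big_seq.
  apply: eq_bigr => p ps; rewrite kE // ptensorZ; congr (pt (_ * _) _).
  by rewrite vsprojK // h1.
move=> P h ht p ps; have [k' k'E] := dual_coord P ps.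
rewrite -(raddf0 k') -ht.
apply: (tensor_ind_additive (u := h \o k p) (v := k' \o induced_map h)) => a m.
by rewrite /= kE // [induced_map h _]tmap_ptensor k'E linearZ.
Qed.

Lemma dual_exact_at (M N P : lmodType sB) (g : {linear M -> N}) (h : {linear N -> P}) :
  exact_at g h -> exact_at (induced_map g) (induced_map h).
Proof.
move=> ex y; split=> [hy|[x <-]].
  have [m [ye hm]] := dual_expand y.
  have {}hm p : exists x, p \in s -> g x = m p.
    have [ps|ps] := boolP (p \in s); last by exists 0.
    by have /ex [x hx] := hm _ _ hy p ps; exists x.
  have {hm} /choice [x hx] := hm.
  exists (\sum_(p <- s) pt p.1 (x p)).
  rewrite [RHS]ye raddf_sum big_seq [RHS]big_seq; apply: eq_bigr => p ps.
  by rewrite [LHS]tmap_ptensor hx.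
have gh0 z : h (g z) = 0 by apply/ex; exists z.
move: x; apply: tensor_ind_sum => [|x y' hx hy|a m].
- by rewrite !raddf0.
- apply: etrans (linearD (induced_map h \o induced_map g) x y') _ => /=.
  by rewrite [X in X + _]hx [X in _ + X]hy addr0.
- by rewrite [induced_map g _]tmap_ptensor [LHS]tmap_ptensor gh0 ptensor0r.
Qed.

Lemma dual_injective (M N : lmodType sB) (g : {linear M -> N}) :
  injective g -> injective (induced_map g).
Proof.
move=> gi x y hxy; apply/eqP; rewrite -subr_eq0; apply/eqP.
have [m [e hm]] := dual_expand (x - y); rewrite e.
rewrite big_seq big1 // => p ps.
have -> : m p = 0.
  by apply: gi; rewrite linear0; apply: hm => //; rewrite linearB hxy subrr.
exact: ptensor0r.
Qed.

Lemma induced_map_surj (M N : lmodType sB) (g : {linear M -> N}) :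
  surj_lin g -> surj_lin (induced_map g).
Proof.
move=> gs; apply: tensor_ind_sum => [|x y [u <-] [w <-]|a m].
- by exists 0; rewrite linear0.
- by exists (u + w); rewrite linearD.
- by have [x <-] := gs m; exists (pt a x); rewrite [LHS]tmap_ptensor.
Qed.

Lemma dual_induction_exact : induction_exact B.
Proof.
move=> M N P g h _ _ _ [gi ex hs']; split.
- exact: dual_injective.
- exact: dual_exact_at.
- exact: induced_map_surj.
Qed.

Definition ind_chain (P : chain_data sB) : chain_data A :=
  ChainData (fun k => induced_map (cdiff P k)).

Lemma ind_resolution (B1 : 1 \in B) (P : chain_data sB) (M : lmodType sB)
    (eps : {linear P 0%N -> M}) :
  proj_resolution eps -> @proj_resolution K A (induced M) (ind_chain P) (induced_map eps).
Proof.
move=> [h1 h2 h3 h4]; split.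
- by move=> k; apply: projective_induced.
- exact: induced_map_surj.
- exact: dual_exact_at.
- by move=> k; apply: dual_exact_at.
Qed.
End Exactness.

(** * Regularity as equations in the algebra *)

Section ConcreteBorel.
Variables (K : fieldType) (A : falgType K) (I : finType).
Variable chi : I -> {linear A -> K^o}.
Variable e : I -> A.
Variable ord : rel I.

Definition eset (V : {set I}) : A := \sum_(i in V) e i.
Definition cornerv (V : {set I}) : {vspace A} :=
  (<[eset V]> * {:A} * <[eset V]>)%VS.
Definition nradv (B : {vspace A}) : {vspace A} := (B :&: radv chi)%VS.

(* The elements of [A B_rad] in the corner at [V]; its part ending in [e i] is
   the kernel of [A e_i ->> A (x)_B L_B(i)]. *)
Definition cradv V (B : {vspace A}) : {vspace A} := (cornerv V * nradv B)%VS.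

(* A description of the regular exact Borel subalgebras of the corner of [A] at
   [V] inside [A].  Writing [D j = A e_j / A B_rad e_j] for the standard module
   and [C j] for its quotient by [L_B(j)], regularity amounts to two conditions:
   [C j] is injective over [B] ([cb_baer]), and every map from a simple
   [B]-module to [C j] lifts to [D j] ([cb_socle]). *)
Record cborel (V : {set I}) (B : {vspace A}) : Prop := CBorel {
  cb_idem : forall i, i \in V -> e i \in B;
  cb_corner : (B <= cornerv V)%VS;
  cb_mul : forall x y, x \in B -> y \in B -> x * y \in B;
  cb_tri : forall n i k, n \in nradv B -> i \in V -> k \in V ->
    e k * n * e i != 0 -> sord ord i k;
  cb_dual : exists s : seq (A * 'End(A)),
    [/\ forall p, p \in s -> forall a, a \in cornerv V -> p.2 a \in B,
        forall p, p \in s -> forall a b, a \in cornerv V -> b \in B ->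
          p.2 (a * b) = p.2 a * b
      & forall a, a \in cornerv V -> a = \sum_(p <- s) p.1 * p.2 a];
  cb_std : forall i k a, i \in V -> k \in V -> ~~ ord k i -> a \in cornerv V ->
    e k * a * e i \in cradv V B;
  cb_socle : forall j x, j \in V -> x \in cornerv V -> x * e j = x ->
    (forall n, n \in nradv B -> exists c : K, n * x - c *: e j \in cradv V B) ->
    forall n, n \in nradv B -> n * x \in cradv V B;
  cb_baer : forall i j (phi : 'End(A)), i \in V -> j \in V ->
    (forall n, n \in nradv B -> n * e i = n -> phi n \in cornerv V /\ phi n * e j = phi n) ->
    (forall n b, n \in nradv B -> n * e i = n -> b \in B ->
       exists c : K, phi (b * n) - b * phi n - c *: e j \in cradv V B) ->
    exists x, [/\ x \in cornerv V, x * e j = x & forall n, n \in nradv B -> n * e i = n ->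
       exists c : K, phi n - n * x - c *: e j \in cradv V B] }.

Hypothesis ef : idem_family chi e.

Lemma esetT : eset setT = 1.
Proof. by rewrite /eset -(if_sum ef); apply: eq_bigl => i; rewrite inE. Qed.

Lemma cornerT : cornerv setT = {:A}%VS.
Proof. by rewrite /cornerv esetT prodv1 prod1v. Qed.
End ConcreteBorel.

(** * From a regular exact Borel subalgebra to the equations *)

Section Forward.
Variables (K : fieldType) (A : falgType K) (I : finType).
Variable chi : I -> {linear A -> K^o}.
Hypothesis sb : split_basic chi.
Variables (B : {aspace A}).
Hypothesis B1 : 1 \in B.
Notation sB := (subvs_of B).
Notation pt := (ptensor (@vsval _ _ B)).
Variables (L : I -> lmodType A) (ord : rel I).
Hypothesis hL : forall i, exists u : L i, char_module (chi i) u.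

Definition chiB i : {linear sB -> K^o} := (chi i \o @vsval _ _ B).

Lemma split_basicB : split_basic chiB.
Proof.
split=> [i|].
  split; last by move=> x y; rewrite /= (chiM sb).
  by apply: etrans (chi1 sb i); congr (chi i _); apply: vsval1.
have [m hm] := sb_nil sb; exists m => s ss hs; apply: val_inj => /=.
have -> : vsval (\prod_(x <- s) x) = \prod_(x <- map val s) x.
  elim: s {ss hs} => [|x s IH]; first by rewrite !big_nil vsval1.
  by rewrite /= !big_cons -IH.
rewrite hm ?size_map // => _ /mapP [x hx ->] i; exact: (hs x hx i).
Qed.

Section Tops.
Variables (e : I -> A) (ef : idem_family chi e).
Variable LB : I -> lmodType sB.
Hypothesis LBsimple : forall i, simple_module (LB i).
Hypothesis LBstd : forall i, exists2 D, standard L ord i D & isom (induced (LB i)) D.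

(** If L_B(i) has the character of k, adjunction gives a nonzero map from its induced module to the
    simple A-module at k. The induced module is standard at i, and its simple quotients are all at
    i. This also serves for a Borel subalgebra that does not contain the family [e]. *)
Lemma borel_simple_char i : exists u : LB i, char_module (chiB i) u.
Proof.
have [k [u hu]] := simple_char split_basicB (LBsimple i).
suff ki : k = i by exists u; move: hu; rewrite ki.
have [S [w hw]] := char_module_ex (sb_mul sb k).
have [|h hE] := @char_module_hom _ _ _ _ _ (res B1 S) w hu.
  move=> b; rewrite !res_scaleE vsval_scalar //; exact: (char_module_act hw).
have [g gE] := induced_adjoint h.
have [D sD [f [f' fK f'K]]] := LBstd i.
have [||g' g'E] := @linear_factor _ _ _ _ f g.
- by move=> y; exists (f' y).
- by move=> x fx; rewrite -[x]fK fx -(linear0 f) fK linear0.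
apply: (standard_top ef hL (s := g') sD hw).
by exists (f (pt 1 u)); rewrite g'E gE scale1r hE; case: hw.
Qed.
End Tops.

Variables (e : I -> A) (ef : idem_family chi e).
Hypothesis eB : forall i, e i \in B.
Variable LB : I -> lmodType sB.
Hypothesis LBchar : forall i, exists u : LB i, char_module (chiB i) u.

Definition eBs i : sB := Subvs (eB i).

Lemma idem_familyB : idem_family chiB eBs.
Proof.
split=> [i j|i j|]; first exact: (if_chi ef).
- by apply: val_inj; rewrite /= (if_orth ef); case: eqP => [->|].
- apply: val_inj; apply: (@etrans _ _ 1); last exact/esym/vsval1.
  by rewrite -(if_sum ef) linear_sum.
Qed.

Notation N := (nradv chi B).
Notation AN := (({:A} * N)%VS).

Lemma mem_N n : n \in N <-> n \in B /\ in_rad chi n.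
Proof.
by rewrite memv_cap; split=> [/andP [h /memv_rad]|[h /memv_rad]] //; rewrite h.
Qed.

Lemma N_rad : (N <= radv chi)%VS. Proof. exact: capvSr. Qed.

Lemma N_mull b n : b \in B -> n \in N -> b * n \in N.
Proof.
move=> hb /mem_N [hn rn]; apply/mem_N; split; first exact: aspace_mul.
exact: in_radMl.
Qed.

Lemma N_mulr b n : b \in B -> n \in N -> n * b \in N.
Proof.
move=> hb /mem_N [hn rn]; apply/mem_N; split; first exact: aspace_mul.
exact: in_radMr.
Qed.

Lemma N_part b i : b \in B -> b * e i - (chi i b : K) *: e i \in N.
Proof.
move=> hb; apply/mem_N; split; last exact: (rad_part sb ef).
by rewrite rpredB ?rpredZ ?eB // aspace_mul.
Qed.

Lemma AN_rad x : x \in AN -> in_rad chi x.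
Proof.
move: x; apply: prodv_ind => [i|x y hx hy|c x hx|u v hu /mem_N [_ hv]].
- by rewrite linear0.
- exact: in_radD.
- exact: in_radZ.
- exact: in_radMl.
Qed.

Section InducedChar.
Variables (M : lmodType sB) (u : M) (i : I).
Hypothesis hu : char_module (chiB i) u.

Lemma ind_char_gen (t : induced M) : exists a, t = pt a u.
Proof.
move: t; apply: tensor_ind_sum => [|x y [a ->] [b ->]|a m].
- by exists 0; rewrite ptensor0l.
- by exists (a + b); rewrite ptensorDl.
have [_ _ us] := hu; have [c ->] := us m.
by exists (a * c%:A); rewrite ptensorZ vsval_scalar.
Qed.

Lemma ind_char_e a : pt (a * e i) u = pt a u.
Proof. by rewrite -[e i]/(vsval (eBs i)) -ptensorZ (char_e idem_familyB hu) eqxx. Qed.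

Lemma ind_char_AN a : a \in AN -> pt a u = 0.
Proof.
move: a; apply: prodv_ind => [|x y hx hy|c x hx|a n _ hn].
- exact: ptensor0l.
- by rewrite ptensorDl hx hy addr0.
- transitivity (c%:A *: (pt x u : induced M)).
    by rewrite [RHS]tensor_scaleE mulr_algl.
  by rewrite hx; exact: scaler0.
have /mem_N [nB rn] := hn.
rewrite -[n]/(vsval (Subvs nB)) -ptensorZ (char_rad hu) ?ptensor0r //.
Qed.

(** Together with [ind_char_AN] this identifies the induced module with A e_i / A N e_i. Sending (a,
    m) to the coordinate of m times a e_i modulo A N is balanced, because b e_i equals chi_i(b) e_i
    up to N. *)
Lemma ind_char0 a : pt a u = 0 -> a * e i \in AN.
Proof.
have [u0 _ us] := hu; have /choice [k kE] := us.
have kP m (c : K) : m = c%:A *: u -> k m = c.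
  move=> mE; apply/eqP; rewrite -subr_eq0; apply/eqP/(kscal_eq0 u0).
  by rewrite kscalDl kscalN -kE -mE subrr.
pose w := modv AN.
have [|||g gE] := @tensor_lift A sB (@vsval _ _ B) M A (fun a m => k m *: w (a * e i)).
- by move=> b b' m; rewrite mulrDl linearD scalerDr.
- move=> b m m'; rewrite -scalerDl; congr (_ *: _); apply: kP.
  by rewrite kscalDl -!kE.
- move=> b c m.
  have -> : k (c *: m) = k m * (chi i (vsval c) : K).
    apply: kP; rewrite (char_module_act hu) {1}(kE m) kscalA mulrC.
    by [].
  rewrite -scalerA; congr (_ *: _); rewrite -linearZ; apply/eqP.
  rewrite -subr_eq0 -linearB modvE.
  rewrite -mulrA scalerAr -mulrBr; apply: memv_mul; first exact: memvf.
  exact/N_part/subvsP.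
move=> h; have := gE a u; rewrite h raddf0 (kP u 1) ?kscal1 // scale1r => /esym/eqP.
by rewrite modvE.
Qed.
End InducedChar.

Lemma gen_moduleB i : exists (P : lmodType sB) (g : P), gen_module (eBs i) g.
Proof. exact: gen_module_ex (eii idem_familyB i). Qed.

Section Triangular.
Hypothesis LBqh : quasi_hereditary LB ord.
Hypothesis LBstd : forall i, standard LB ord i (LB i).

Let std_kill i (S : lmodType sB) k (x : S) : standard LB ord i S -> k != i -> eBs k *: x = 0.
Proof.
move=> sS ki; have [h hs] := standard_surj LBchar (LBstd i) sS.
have [y <-] := hs x; have [u hu] := LBchar i.
by rewrite -linearZ (char_e idem_familyB hu) (negbTE ki) linear0.
Qed.

(** The kernel of P(i) -> Delta(i) is filtered by standard, hence simple, modules at vertices above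
    i, and it contains n e_i because Delta(i) is simple. So e_k kills n e_i unless k is above i. *)
Lemma borel_tri n i k : n \in N -> e k * n * e i != 0 -> sord ord i k.
Proof.
move=> /mem_N [nB rn]; apply: contraNT => nik.
have [P [D [p [q [r [cov sq rq [Z [z [zi ez fZ]]] _]]]]]] := LBqh i.
have [[fP lP] ps _] := cov.
have [P' [g hg]] := gen_moduleB i; have [u hu] := LBchar i.
have [eg gs gk] := hg.
have [|p' p'E] := @gen_module_hom _ _ _ P' g (LB i) u hg.
  by rewrite (char_e idem_familyB hu) eqxx.
have p'g : p' g = u by rewrite -[g]scale1r p'E scale1r.
have p's : surj_lin p'.
  by move=> y; have [_ _ us] := hu; have [c ->] := us y; exists (c%:A *: g); rewrite p'E.
(* The definition provides some projective cover [P]; mapping it onto B e_i allows the conclusion to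
   be read off as an equation in B. *)
have [b bE] := lP P' (LB i) p' p (proj1 (gen_module_projective hg))
  (char_module_findim hu) p's.
have [_ _ cP'] : projective_cover p'.
  apply: (gen_module_cover split_basicB idem_familyB LBchar hg).
  by rewrite p'g; case: hu.
have [y hy] : exists y, b y = g.
  by apply: cP' => t; have [x px] := ps t; exists x; rewrite /= bE.
have sD : standard LB ord i D.
  by exists P, p, q.
have qn : q (Subvs nB *: (eBs i *: y)) = 0.
  have [h hs] := standard_surj LBchar (LBstd i) sD.
  by rewrite linearZ; have [w <-] := hs (q (eBs i *: y)); rewrite -linearZ (char_rad hu) ?linear0.
have kz : forall x : Z, eBs k *: x = 0.
  apply: (filtered_kill _ _ fZ) => [|S [j oj sS] x]; first exact: (eii idem_familyB).
  have [kj|kj] := eqVneq k j; last exact: std_kill sS kj.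
  by rewrite kj oj in nik.
have /ez [x0 hx0] := qn.
have : b (eBs k *: (Subvs nB *: (eBs i *: y))) = 0 by rewrite -hx0 -linearZ kz !linear0.
rewrite !linearZ /= hy !scalerA => /gk /(congr1 (@vsval _ _ B)) /=.
by rewrite -!mulrA (eii ef) !mulrA => ->.
Qed.
End Triangular.

Lemma N_partl b i : b \in B -> e i * b - (chi i b : K) *: e i \in N.
Proof.
move=> hb; apply/mem_N; split; last exact: (rad_partl sb ef).
by rewrite rpredB ?rpredZ ?eB // aspace_mul.
Qed.

Section DualBasis.
Hypothesis ex : induction_exact B.

(** A complement of A N in A e_k. Over all k, these lift a basis of A / A N, that is, a minimal
    generating set of A as a right B-module. *)
Let X k : {vspace A} := (limg (amulr (e k)) :\: AN)%VS.
Let T := {k : I & 'I_(\dim (X k))}.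
Let tg k (t : 'I_(\dim (X k))) : T := existT _ k t.
Let xb (s : T) : A := (vbasis (X (tag s)))`_(tagged s).
(** Since x_s = x_s e_k with k the vertex of s, a coefficient of x_s can be unique only inside e_k
    B. *)
Let coeffs (f : T -> A) := forall s, f s \in B /\ e (tag s) * f s = f s.

Let mem_limg k x : (x \in limg (amulr (e k))) = (x * e k == x).
Proof.
apply/memv_imgP/eqP => [[y _ ->]|h]; first by rewrite lfunE /= -mulrA (eii ef).
by exists x; rewrite ?memvf // lfunE /= h.
Qed.

Let xb_mem s : xb s \in X (tag s).
Proof. by apply: vbasis_mem; rewrite mem_nth // size_tuple. Qed.

Let xb_e s k : xb s * e k = if tag s == k then xb s else 0.
Proof.
have := subvP (diffvSl _ _) _ (xb_mem s); rewrite mem_limg => /eqP h.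
by rewrite -h -mulrA (if_orth ef); case: eqP => [->|]; rewrite ?mulr0.
Qed.

Let surj a : exists2 f, coeffs f & a = \sum_s xb s * f s.
Proof.
pose G := ((\sum_k X k) * B)%VS.
have hG : G = {:A}%VS.
  apply: (nakayama_right sb N_rad); rewrite -/G.
    rewrite /G -prodvA; apply: prodvSr; apply/prodvP => b n hb hn.
    by have /mem_N [] := N_mull hb hn.
  apply/subvP => x _; rewrite [x](sum_er ef); apply: rpred_sum => k _.
  have : x * e k \in limg (amulr (e k)) by rewrite mem_limg -mulrA (eii ef).
  rewrite -[limg _](addv_diff_cap _ AN) => /memv_addP [y hy [z hz ->]].
  apply: memv_add; last by move: hz; rewrite memv_cap => /andP [].
  rewrite -[y]mulr1; apply: memv_mul => //.
  by rewrite -[y]add0r (bigD1 k) //= addrC; apply: memv_add => //; apply: mem0v.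
have : a \in G by rewrite hG memvf.
move: a; apply: prodv_ind => [|x y [f hf ->] [f' hf' ->]|c x [f hf ->]|u v hu hv].
- exists (fun=> 0); last by rewrite big1 // => s _; rewrite mulr0.
  by move=> s; rewrite mem0v mulr0.
- exists (fun s => f s + f' s).
    move=> s; have [h1 h2] := hf s; have [h3 h4] := hf' s.
    by rewrite rpredD // mulrDr h2 h4.
  by rewrite -big_split; apply: eq_bigr => s _; rewrite mulrDr.
- exists (fun s => c *: f s).
    by move=> s; have [h1 h2] := hf s; rewrite rpredZ // -scalerAr h2.
  by rewrite scaler_sumr; apply: eq_bigr => s _; rewrite scalerAr.
have [w hw ->] := memv_sumP hu.
exists (fun s => coord (vbasis (X (tag s))) (tagged s) (w (tag s)) *: (e (tag s) * v)).
  move=> s; rewrite rpredZ ?aspace_mul //; split=> //.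
  by rewrite -scalerAr mulrA (eii ef).
rewrite mulr_suml.
transitivity (\sum_k \sum_(t < \dim (X k))
    (vbasis (X k))`_t * (coord (vbasis (X k)) t (w k) *: (e k * v))); last first.
  by rewrite sig_big_dep.
apply: eq_bigr => k _; rewrite {1}(coord_vbasis (hw k isT)) mulr_suml.
apply: eq_bigr => t _; rewrite -scalerAl -scalerAr mulrA; congr (_ *: (_ * _)).
by have := xb_e (tg t) k; rewrite /= eqxx /xb /= => ->.
Qed.

(** A relation has its coefficients in the left ideal J that they generate. By exactness, A (x) J
    embeds in A (x) B = A, so the relation holds in A (x) J. Reducing modulo A N and N J puts all
    coefficients into N J, and Nakayama's lemma gives J = 0. *)
Let uniq0 f : coeffs f -> \sum_s xb s * f s = 0 -> forall s, f s = 0.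
Proof.
move=> hf f0; pose J := (\sum_s B * <[f s]>)%VS.
have fJ s : f s \in J.
  apply: (subvP (sumv_sup s (P := xpredT) isT (subvv _))).
  by rewrite -[X in X \in _]mul1r memv_mul // memv_line.
have BJ b x : b \in B -> x \in J -> b * x \in J.
  move=> hb /memv_sumP [w hw ->]; rewrite mulr_sumr; apply: rpred_sum => s _.
  apply: (subvP (sumv_sup s (P := xpredT) isT (subvv _))).
  have : (B * (B * <[f s]>) <= B * <[f s]>)%VS by rewrite prodvA prodv_id.
  by move=> /prodvP; apply=> //; apply: hw.
suff JN : (J <= N * J)%VS.
  move=> s; apply/eqP; rewrite -memv0 -(nakayama_left sb N_rad JN); exact: fJ.
suff fN s : f s \in (N * J)%VS.
  apply/subv_sumP => s _; apply: (@subv_trans _ _ (B * (N * J))%VS).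
    by apply: prodvSr; rewrite -memvE.
  rewrite prodvA; apply: prodvSl; apply/prodvP => b n; exact: N_mull.
have [|b x y hx hy|U hU] := @mk_submodClosed sB (sB^o : lmodType sB) (fun b => vsval b \in J).
- by rewrite linear0 mem0v.
- by rewrite linearD rpredD //; apply: BJ => //; apply: subvsP.
pose jm := submod_val U.
have Fex t : exists x : submod U, vsval (jm x) = f t.
  have [fB _] := hf t.
  have /hU h : vsval (Subvs fB) \in J by apply: fJ.
  by exists (mksub h).
have /choice [F FE] := Fex.
have exq : exact_at jm (@qproj _ _ U).
  move=> x; rewrite qproj0; split=> [hx|[y <-]]; last exact: submod_valP.
  by exists (mksub hx).
have [ij _ _] : short_exact (induced_map jm) (induced_map (@qproj _ _ U)).
  apply: ex.
  - exact: (findim_inj (@submod_val_inj _ _ U) (findim_regular _)).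
  - exact: findim_regular.
  - exact: (findim_surj (@qproj_surj _ _ U) (findim_regular _)).
  - by split=> //; [exact: submod_val_inj|exact: qproj_surj].
have t0 : \sum_t pt (xb t) (F t) = 0 :> induced (submod U).
  apply: ij; rewrite linear0 raddf_sum.
  transitivity (pt (\sum_t xb t * f t) (1 : sB^o)); last by rewrite f0 ptensor0l.
  rewrite ptensor_suml; apply: eq_bigr => t _.
  rewrite [LHS]tmap_ptensor -FE -ptensorZ; congr (pt _ _).
  by rewrite -[RHS]/(_ * _) mulr1.
(* A functional [xi] that vanishes on N J but not at [f s] makes (a, b) |-> xi(e_k b) (a e_k mod A
   N) balanced; applied to the relation, it contradicts the independence of the x_t modulo A N. *)
apply: contraT => fs; have [xi xis xiN] := exists_functional fs.
set k := tag s.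
have [|||g gE] := @tensor_lift A sB (@vsval _ _ B) (submod U) A
    (fun a b => (xi (e k * vsval (jm b)) : K) *: modv AN (a * e k)).
- by move=> a a' m; rewrite mulrDl linearD scalerDr.
- by move=> a m m'; rewrite -scalerDl !linearD mulrDr linearD.
- move=> a c m.
  have -> : modv AN (a * vsval c * e k) = (chi k (vsval c) : K) *: modv AN (a * e k).
    rewrite -linearZ; apply/eqP; rewrite -subr_eq0 -linearB modvE.
    rewrite -mulrA scalerAr -mulrBr; apply: memv_mul; first exact: memvf.
    exact/N_part/subvsP.
  have -> : xi (e k * vsval (jm (c *: m))) = chi k (vsval c) * xi (e k * vsval (jm m)) :> K.
    set y := vsval (jm m).
    have h0 : xi ((e k * vsval c - (chi k (vsval c) : K) *: e k) * y) = 0.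
      apply: xiN; apply: memv_mul; first exact/N_partl/subvsP.
      by apply/hU; apply: submod_valP.
    have -> : vsval (jm (c *: m)) = vsval c * y by rewrite linearZ.
    apply/eqP; rewrite -subr_eq0 mulrA; apply/eqP; rewrite -[RHS]h0.
    by rewrite mulrBl -scalerAl linearB linearZ.
  by rewrite scalerA mulrC.
have := congr1 g t0; rewrite raddf0 raddf_sum => /eqP.
rewrite (eq_bigr (fun t => modv AN ((xi (e k * f t) : K) *: (xb t * e k)))); last first.
  by move=> t _; rewrite gE linearZ FE.
rewrite -linear_sum modvE /= => yN.
have yE : \sum_t (xi (e k * f t) : K) *: (xb t * e k) =
    \sum_(t < \dim (X k)) (xi (f (tg t)) : K) *: (vbasis (X k))`_t.
  transitivity (\sum_l \sum_(t < \dim (X l))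
     (xi (e k * f (tg t)) : K) *:
       (xb (tg t) * e k)).
    by rewrite sig_big_dep; apply: eq_bigr => -[].
  rewrite (bigD1 k) //= [X in _ + X]big1 ?addr0 => [|l lk].
    apply: eq_bigr => t _; have [_ h] := hf (tg t).
    by rewrite xb_e /= eqxx; rewrite /= in h; rewrite h.
  by rewrite big1 // => t _; rewrite xb_e /= (negbTE lk) scaler0.
rewrite yE in yN.
have y0 : \sum_(t < \dim (X k)) (xi (f (tg t)) : K) *: (vbasis (X k))`_t = 0.
  apply/eqP; rewrite -memv0 -(capv_diff (limg (amulr (e k))) AN) memv_cap yN andbT.
  by apply: rpred_sum => t _; apply: rpredZ; apply: vbasis_mem; rewrite mem_nth // size_tuple.
have /freeP fr := basis_free (vbasisP (X k)).
have e1 : @tg k (tagged s) = s by rewrite /tg /k; case: (s).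
by have := fr _ y0 (tagged s); rewrite /= e1 => h; rewrite h eqxx in xis.
Qed.

(** Uniqueness of the coefficients makes them linear in a and compatible with right multiplication
    by B. *)
Lemma borel_dual_basis : exists s, dual_basis B s.
Proof.
have /choice [f hf] : forall a, exists f, coeffs f /\ a = \sum_s xb s * f s.
  by move=> a; have [f h1 h2] := surj a; exists f.
have coeffsB g h : coeffs g -> coeffs h -> coeffs (fun s => g s - h s).
  move=> cg ch s; have [g1 g2] := cg s; have [h1 h2] := ch s.
  by rewrite rpredB // mulrBr g2 h2.
have funiq a g : coeffs g -> a = \sum_s xb s * g s -> forall s, f a s = g s.
  move=> cg ag s; apply/eqP; rewrite -subr_eq0; apply/eqP.
  apply: (uniq0 (f := fun s => f a s - g s)); first by apply: coeffsB => //; case: (hf a).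
  transitivity (\sum_t xb t * f a t - \sum_t xb t * g t).
    by rewrite -sumrB; apply: eq_bigr => t _; rewrite mulrBr.
  by rewrite -ag -(hf a).2 subrr.
have flin s : linear (fun a => f a s).
  move=> c x y; apply: (funiq _ (fun s => c *: f x s + f y s)).
    move=> t; have [h1 h2] := (hf x).1 t; have [h3 h4] := (hf y).1 t.
    by rewrite rpredD ?rpredZ // mulrDr -scalerAr h2 h4.
  rewrite {1}(hf x).2 {1}(hf y).2 scaler_sumr -big_split.
  by apply: eq_bigr => t _; rewrite mulrDr scalerAr.
pose k s : {linear A -> A} := HB.pack (fun a => f a s) (GRing.isLinear.Build _ _ _ _ _ (flin s)).
exists [seq (xb s, linfun (k s)) | s <- enum {: {k : I & 'I_(\dim (X k))}}]; split.
- by move=> _ /mapP [s _ ->] a; rewrite lfunE /=; case: ((hf a).1 s).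
- move=> _ /mapP [s _ ->] a b hb; rewrite !lfunE /=.
  apply: (funiq _ (fun s => f a s * b)).
    move=> t; have [h1 h2] := (hf a).1 t.
    by rewrite aspace_mul // mulrA h2.
  by rewrite {1}(hf a).2 mulr_suml; apply: eq_bigr => t _; rewrite mulrA.
- move=> a; rewrite big_map big_enum; apply: etrans (hf a).2 _.
  by apply: eq_bigr => t _; congr (_ * _); rewrite -[RHS]/(linfun (k t) a) lfunE.
Qed.
End DualBasis.

End Forward.

Section ForwardExt.
Variables (K : fieldType) (A : falgType K) (I : finType).
Variable chi : I -> {linear A -> K^o}.
Hypothesis sb : split_basic chi.
Variables (B : {aspace A}).
Hypothesis B1 : 1 \in B.
Notation sB := (subvs_of B).
Notation pt := (ptensor (@vsval _ _ B)).
Variables (e : I -> A) (ef : idem_family chi e).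
Hypothesis eB : forall i, e i \in B.
Variable LB : I -> lmodType sB.
Hypothesis LBchar : forall i, exists u : LB i, char_module (chiB chi B i) u.
Variable s : seq (A * 'End(A)).
Hypothesis hs : dual_basis B s.
Hypothesis LBext : forall k i j, ext_iso k (LB i) (LB j).

Notation N := (nradv chi B).
Notation AN := (({:A} * N)%VS).
Notation eBs := (eBs eB).

Section Fix.
Variables (i j : I) (ui : LB i) (uj : LB j).
Hypotheses (hui : char_module (chiB chi B i) ui) (huj : char_module (chiB chi B j) uj).
Variables (P : chain_data sB) (g : P 0%N) (eps : {linear P 0%N -> LB i}).
Hypotheses (hg : gen_module (eBs i) g) (epsg : forall b, eps (b *: g) = b *: ui).

Hypothesis Pres : proj_resolution eps.

Let eps0 (b : sB) : eps (b *: g) = 0 -> vsval b * e i \in N.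
Proof.
rewrite epsg; have [u0 h _] := hui; rewrite h => /(kscal_eq0 u0) hb.
have := N_part sb ef eB i (subvsP b).
by rewrite [chi i (vsval b)]hb scale0r subr0.
Qed.

Let N0 n (nB : n \in B) : n \in N -> eps (Subvs nB *: g) = 0.
Proof.
move=> /mem_N [_ rn]; rewrite epsg (char_module_act hui).
by rewrite [chiB _ _ _ _](rn i) kscal0.
Qed.

Let d0_ex n (nB : n \in B) : n \in N -> exists p : P 1%N, cdiff P 0 p = Subvs nB *: g.
Proof. by move=> /N0 h; case: Pres => _ _ e0 _; apply/e0; apply: h. Qed.

Let d0_gen (p : P 1%N) : exists b : sB, cdiff P 0 p = b *: g /\ vsval b * e i \in N.
Proof.
have [_ gs _] := hg; have [b hb] := gs (cdiff P 0 p); exists b; split=> //.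
by apply: eps0; rewrite -hb; case: Pres => _ _ e0 _; apply/e0; exists p.
Qed.

Let dd0 (q : P 2) : cdiff P 0 (cdiff P 1 q) = 0.
Proof. by case: Pres => _ _ _ /(_ 0%N) e1; apply/e1; exists q. Qed.

Let Rres := ind_resolution hs B1 Pres.

Let unit_ex := tensor_unit B1 (LB j).

Let idc n : {linear induced (P n) -> induced (P n)} := idfun.

(** The degree is shifted by one in [ext_iso]: [ext0] concerns Ext^1 and [ext1] concerns Ext^2. The
    induced resolution serves for the induced module, with identities as the chain map. *)
Let ext0 := @LBext 0 i j P eps (ind_chain P) (induced_map eps) idc Pres Rres (fun x => erefl) (fun n x => erefl).
Let ext1 := @LBext 1 i j P eps (ind_chain P) (induced_map eps) idc Pres Rres (fun x => erefl) (fun n x => erefl).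

Let pt_ins a : a * e j \in AN -> pt a uj = 0.
Proof. by move=> h; rewrite -(ind_char_e B1 ef eB huj) (ind_char_AN huj h). Qed.

Let pt_scal (c : K) : pt (c *: e j) uj = pt 1 (c%:A *: uj).
Proof.
rewrite -(ind_char_e B1 ef eB huj) -scalerAl (eii ef) ptensorZ vsval_scalar // mul1r.
by rewrite -[RHS](ind_char_e B1 ef eB huj) mulr_algl.
Qed.

Let pt_mul (b : sB) a : pt (vsval b * a) uj = b *: (pt a uj : res B1 (induced (LB j))).
Proof. by rewrite res_scaleE tensor_scaleE. Qed.

Let ptB a a' : pt (a - a') uj = pt a uj - pt a' uj.
Proof. by apply: (@addIr _ (pt a' uj)); rewrite -ptensorDl !subrK. Qed.

Let unit_inj (u : {linear LB j -> res B1 (induced (LB j))}) :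
  (forall m, u m = pt 1 m) -> injective u.
Proof.
move=> uE x y hxy; have [u0 _ us] := huj.
have [c cE] := us (x - y); apply/eqP; rewrite -subr_eq0 cE; apply/eqP.
have : pt (c *: e j) uj = 0.
  by rewrite pt_scal -cE -uE linearB hxy subrr.
move=> /(ind_char0 sb ef eB huj); rewrite -scalerAl (eii ef) => h.
have := AN_rad sb h j; rewrite (chiZ chi) (chi_e ef) mulr1 => ->.
exact: kscal0.
Qed.

(** The element gives a map B e_i -> D j under which the radical goes to L_B(j). Its restriction is
    a class in Ext^1(L_B(i), L_B(j)) that dies after induction, so by injectivity it extends to a
    map B e_i -> L_B(j); such a map vanishes on the radical. *)
Lemma socle_key x' : (forall n, n \in N -> exists c : K, n * x' - c *: e j \in AN) ->
  e i * x' = x' -> x' * e j = x' -> forall n, n \in N -> n * x' \in AN.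
Proof.
move=> hx ex' xe; have [u uE] := unit_ex; have ui' := unit_inj uE.
have [|s0 s0E] := @gen_module_hom _ _ _ _ g (res B1 (induced (LB j))) (pt x' uj) hg.
  by rewrite -pt_mul /= ex'.
have hn b : vsval b * e i \in N -> exists m, u m = s0 (b *: g).
  move=> hb; have [c hc] := hx _ hb; exists (c%:A *: uj).
  rewrite s0E -pt_mul uE -pt_scal; apply/eqP; rewrite eq_sym -subr_eq0 -ptB; apply/eqP.
  apply: pt_ins; rewrite mulrBl -scalerAl (eii ef) -!mulrA xe -{1}ex' mulrA.
  exact: hc.
have [|g1 g1E] := @linear_lift_inj _ _ _ _ u (s0 \o cdiff P 0) ui'.
  by move=> p; have [b [hb hN]] := d0_gen p; have /hn [m hm] := hN; exists m; rewrite hm -hb.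
have g1c : cocycle g1.
  move=> q; apply: ui'; rewrite g1E linear0.
  by apply: etrans (congr1 s0 (dd0 q)) _; rewrite linear0.
have [s1 s1E] := induced_adjoint s0.
have [|h hE] := (ext0.1 g1 g1c).
  exists s1 => t; apply: (induced_ext (g := induced_map g1)
    (h := s1 \o induced_map (cdiff P 0))) => p.
  rewrite [LHS]tmap_ptensor -uE g1E.
  by apply/esym; apply: etrans (congr1 s1 (tmap_ptensor _ _ _ _)) _; rewrite s1E scale1r.
move=> n hN; have [nB _] := (mem_N chi B n).1 hN.
have [p hp] := d0_ex nB hN.
have : u (g1 p) = 0.
  rewrite hE hp; have -> : h (Subvs nB *: g) = 0; last exact: linear0.
  by rewrite linearZ; apply: (char_rad huj); case: ((mem_N chi B n).1 hN).
rewrite g1E; move/(etrans (esym (congr1 s0 hp))); rewrite s0E -pt_mul => /(ind_char0 sb ef eB huj) /=.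
by rewrite -mulrA xe.
Qed.

(** The class of [phi] in Ext^1(L_B(i), C j) has its boundary in the kernel of Ext^2(L_B(i), L_B(j))
    -> Ext^2(L_B(i), D j), which is 0. So it comes from Ext^1(L_B(i), D j), hence from Ext^1(L_B(i),
    L_B(j)), and therefore vanishes. *)
Lemma baer_key (phi : 'End(A)) :
  (forall n, n \in N -> n * e i = n -> phi n * e j = phi n) ->
  (forall n b, n \in N -> n * e i = n -> b \in B ->
       exists c : K, phi (b * n) - b * phi n - c *: e j \in AN) ->
  exists x, x * e j = x /\ forall n, n \in N -> n * e i = n ->
       exists c : K, phi n - n * x - c *: e j \in AN.
Proof.
move=> phie phib; have [u uE] := unit_ex; have ui' := unit_inj uE.
pose X := res B1 (induced (LB j)).
have fX : findim X.
  by apply: findim_res; apply: findim_induced => //; exact: char_module_findim huj.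
have [|a x y [m <-] [m' <-]|U hU] := @mk_submodClosed _ X (fun x => exists m, u m = x).
- by exists 0; rewrite linear0.
- by exists (a *: m + m'); rewrite linearP.
pose q := @qproj _ X U.
have q0 x y (c : K) : x - y - c *: e j \in AN -> x * e j = x -> y * e j = y ->
    q (pt x uj) = q (pt y uj).
  move=> h xe ye; apply/qproj_eq/hU; exists (c%:A *: uj).
  rewrite uE -pt_scal; apply/eqP; rewrite eq_sym -subr_eq0 -ptB -[_ - _ : X]ptB; apply/eqP/pt_ins.
  by rewrite !mulrBl -scalerAl (eii ef) xe ye.
have /choice [bb hbb] := d0_gen.
pose m p := vsval (bb p) * e i.
have mN p : m p \in N by case: (hbb p).
have me p : m p * e i = m p by rewrite /m -mulrA (eii ef).
have mE p (b : sB) : cdiff P 0 p = b *: g -> m p = vsval b * e i.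
  have [-> _] := hbb p => /eqP; rewrite -subr_eq0 -scalerBl => /eqP.
  have [_ _ gk] := hg => /gk /(congr1 (@vsval _ _ B)) /eqP.
  by rewrite /= mulrBl subr_eq0 => /eqP.
pose f p : quotmod U := q (pt (phi (m p)) uj).
have fl : linear f.
  move=> a x y; rewrite /f.
  have -> : m (a *: x + y) = vsval a * m x + m y.
    have e0 : cdiff P 0 (a *: x + y) = (a * bb x + bb y) *: g.
      by rewrite linearP (hbb x).1 (hbb y).1 scalerA scalerDl.
    by rewrite (mE _ _ e0) /= mulrDl mulrA.
  transitivity (q (pt (phi (vsval a * m x)) uj) + q (pt (phi (m y)) uj)).
    by rewrite linearD ptensorDl; apply: etrans (linearD q _ _) _.
  congr (_ + _); have [c hc] := phib _ _ (mN x) (me x) (subvsP a).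
  transitivity (q (pt (vsval a * phi (m x)) uj)); last first.
    by apply: etrans (congr1 q (pt_mul _ _)) _; exact: (linearZ_LR q a).
  apply: q0 hc _ _; last by rewrite -mulrA phie.
  by apply: phie; [exact: (N_mull sb (subvsP a) (mN x))|rewrite -mulrA me].
have [f0 f0E] := mk_linear fl.
have fq : findim (quotmod U) by apply: findim_surj (@qproj_surj _ _ U) fX.
(* A lift of [phi] to D j, which need not be a cocycle; its defect [g2] takes values in L_B(j) and
   represents the boundary in Ext^2. *)
have [f' f'E] : exists f' : {linear P 1%N -> X}, forall p, q (f' p) = f0 p.
  by case: Pres => /(_ 1%N) [_ lP] _ _ _; apply: lP => //; exact: qproj_surj.
have [|g2 g2E] := @linear_lift_inj _ _ _ _ u (f' \o cdiff P 1) ui'.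
  move=> p; apply/hU/qproj0; rewrite -/q f'E f0E /f (mE _ 0); last by rewrite dd0 scale0r.
  by rewrite (linear0 (@vsval _ _ B)) mul0r linear0 ptensor0l; exact: (linear0 q).
have dd1 x : cdiff P 1 (cdiff P 2 x) = 0.
  by case: Pres => _ _ _ /(_ 1%N) ee; apply/ee; exists x.
have g2c : cocycle g2.
  move=> x; apply: ui'; rewrite g2E linear0.
  by apply: etrans (congr1 f' (dd1 x)) _; rewrite linear0.
have [s1 s1E] := induced_adjoint f'.
have [|g' g'E] := ext1.1 g2 g2c.
  exists s1 => t; apply: (induced_ext (g := induced_map g2)
    (h := s1 \o induced_map (cdiff P 1))) => p.
  rewrite [LHS]tmap_ptensor -uE g2E.
  by apply/esym; apply: etrans (congr1 s1 (tmap_ptensor _ _ _ _)) _; rewrite s1E scale1r.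
(* Corrected by [g'], the lift is a cocycle with values in D j and still induces [phi] in C j. *)
have [f2 f2E] : exists f2 : {linear P 1%N -> X}, f2 =1 (fun p => f' p - u (g' p)).
  by apply: mk_linear => a x y; rewrite !linearP /= addrACA -scalerDr.
have [s2 s2E] := induced_adjoint f2.
have s2c : @cocycle _ _ (ind_chain P) _ _ s2.
  move=> t; apply: etrans (_ : _ = (\0 : {linear induced (P 2) -> induced (LB j)}) t) _ => //.
  apply: (induced_ext (g := s2 \o induced_map (cdiff P 1))) => p /=.
  apply: etrans (congr1 s2 (tmap_ptensor _ _ _ _)) _.
  by rewrite s2E scale1r f2E -g'E g2E subrr.
have [g'' _ [s' s'E]] := ext0.2 s2 s2c.
(* The wanted x is the value, at the generator of [P 0], of the cochain whose boundary is the
   remaining difference. *)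
have [a aE] := ind_char_gen B1 huj (s' (pt 1 g)).
exists (a * e j); split; first by rewrite -mulrA (eii ef).
move=> n nN ne; have [nB _] := (mem_N chi B n).1 nN.
have [p hp] := d0_ex nB nN.
have mp : m p = n by rewrite (mE p _ hp) /= ne.
have key : f' p - u (g' p) - u (g'' p) = pt (n * a) uj.
  have := s'E (pt 1 p).
  rewrite [X in _ - X]tmap_ptensor s2E scale1r f2E -(uE (g'' p)) => ->.
  apply: etrans (congr1 s' (tmap_ptensor _ _ _ _)) _.
  rewrite hp ptensorZ mul1r ptensor_scale linearZ /= aE.
  by rewrite [LHS]tensor_scaleE.
have : q (pt (phi n) uj) = q (pt (n * a) uj).
  rewrite -key -mp -[LHS]/(f p) -f0E -f'E; apply/qproj_eq/hU.
  exists (g' p + g'' p).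
  by rewrite linearD -addrA -opprD subKr.
move=> /qproj_eq /hU [y]; have [_ _ us] := huj; have [c ->] := us y.
rewrite uE -pt_scal => h; exists c.
have : pt (phi n - n * a - c *: e j) uj = 0.
  by rewrite !ptB h; apply: subrr.
move=> /(ind_char0 sb ef eB huj).
by rewrite !mulrBl -scalerAl (eii ef) phie // -mulrA.
Qed.
End Fix.
End ForwardExt.

Section BorelForward.
Variables (K : fieldType) (A : falgType K) (I : finType).
Variable chi : I -> {linear A -> K^o}.
Hypothesis sb : split_basic chi.
Variables (e : I -> A) (ef : idem_family chi e).
Variables (L : I -> lmodType A) (ord : rel I).
Hypothesis hL : forall i, exists u : L i, char_module (chi i) u.

Theorem borel_cborel (U : {vspace A}) :
  regular_exact_Borel L ord U -> (forall i, e i \in U) -> cborel chi e ord setT U.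
Proof.
case=> B <- [B1 [LB [[LBs _ _] [LBqh LBst] LBex LBstd LBext]]] eB.
have LBc := borel_simple_char sb B1 hL ef LBs LBstd.
have [s hs] := borel_dual_basis sb B1 ef eB LBex.
have CN : cradv chi e setT B = ({:A} * nradv chi B)%VS by rewrite /cradv (cornerT ef).
have mCN x : x \in cradv chi e setT B <-> x \in ({:A} * nradv chi B)%VS by rewrite CN.
split.
- by move=> i _; apply: eB.
- by rewrite (cornerT ef) subvf.
- by move=> x y; apply: aspace_mul.
- by move=> n i k hn _ _; exact: (borel_tri sb B1 ef eB LBc LBqh LBst hn).
- by exists s; have [h1 h2 h3] := hs; split=> [p hp a _|p hp a b _ hb|a _];
  [exact: h1|exact: h2|exact: h3].
- move=> i k a _ _ nki _; apply/mCN.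
  have [D sD [f [f' fK f'K]]] := LBstd i; have [u hu] := LBc i.
  have h0 : ptensor (@vsval _ _ B) (e k * a * e i) u = 0.
    apply: (can_inj fK); rewrite linear0 -mulrA -tensor_scaleE.
    by rewrite [LHS]linearZ; apply: (standard_kill ef hL sD nki).
  by have := ind_char0 sb ef eB hu h0; rewrite -[_ * e i * e i]mulrA (eii ef).
(* [socle_key] treats maps out of a single simple module, so x is split along the idempotents. *)
- move=> j x _ _ xe hx n hn; apply/mCN; rewrite (sum_el ef x) mulr_sumr.
  have [uj huj] := LBc j.
  apply: rpred_sum => i _; have [ui hui] := LBc i.
  have [P0 [g hg]] := gen_moduleB B1 ef eB i.
  have [|eps epsE] := @gen_module_hom _ _ _ P0 g (LB i) ui hg.
    by rewrite (char_e (idem_familyB B1 ef eB) hui) eqxx.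
  have epss : surj_lin eps.
    by move=> y; have [_ _ us] := hui; have [c ->] := us y; exists (c%:A *: g).
  have Pres := resolutionP (gen_module_projective hg) epss.
  pose P := resolution eps (gen_module_projective hg).
  apply: (@socle_key K A I chi sb B B1 e ef eB LB s hs LBext i j ui uj hui huj P g eps
    hg epsE Pres) => //.
  + move=> n' hn'; have he : n' * e i \in nradv chi B by apply: N_mulr.
    have [c hc] := hx _ he; exists c; apply/mCN; by rewrite mulrA.
  + by rewrite mulrA (eii ef).
  + by rewrite -mulrA xe.
- move=> i j phi _ _ phie phib; have [uj huj] := LBc j; have [ui hui] := LBc i.
  have [P0 [g hg]] := gen_moduleB B1 ef eB i.
  have [|eps epsE] := @gen_module_hom _ _ _ P0 g (LB i) ui hg.
    by rewrite (char_e (idem_familyB B1 ef eB) hui) eqxx.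
  have epss : surj_lin eps.
    by move=> y; have [_ _ us] := hui; have [c ->] := us y; exists (c%:A *: g).
  have Pres := resolutionP (gen_module_projective hg) epss.
  have [n hn ne|n b hn ne hb|x [xe hx]] :=
      @baer_key K A I chi sb B B1 e ef eB LB s hs LBext i j ui uj hui huj
        (resolution eps (gen_module_projective hg)) g eps hg epsE Pres phi.
  + by case: (phie n hn ne).
  + by have [c hc] := phib n b hn ne hb; exists c; apply/mCN.
  + exists x; split=> // [|n hn ne]; first by rewrite (cornerT ef) memvf.
    by have [c hc] := hx n hn ne; exists c; apply/mCN.
Qed.
End BorelForward.

(** * From the equations back to regularity *)

Section BorelBackward.
Variables (K : fieldType) (A : falgType K) (I : finType).
Variable chi : I -> {linear A -> K^o}.
Hypothesis sb : split_basic chi.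
Variables (e : I -> A) (ef : idem_family chi e).
Variables (L : I -> lmodType A) (ord : rel I).
Hypothesis hL : forall i, exists u : L i, char_module (chi i) u.
Hypothesis hord : partial_order ord.
Variable B : {aspace A}.
Hypothesis hB : cborel chi e ord setT B.
Notation sB := (subvs_of B).
Notation pt := (ptensor (@vsval _ _ B)).
Notation N := (nradv chi B).
Notation AN := (({:A} * N)%VS).

Let eB i : e i \in B. Proof. by apply: (cb_idem hB); rewrite inE. Qed.

Let B1 : 1 \in B.
Proof. by rewrite -(if_sum ef); apply: rpred_sum. Qed.

Let mCN x : x \in cradv chi e setT B <-> x \in AN.
Proof. by rewrite /cradv (cornerT ef). Qed.

Notation eBs := (eBs eB).
Notation chiB := (chiB chi B).
Let sbB := split_basicB sb B1.
Let efB := idem_familyB B1 ef eB.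

Let sord_ord i k : sord ord i k -> ~~ ord k i.
Proof.
case: hord => _ anti _ /andP [ik oik]; apply: contraNN ik => oki.
by apply/eqP/anti; rewrite oik oki.
Qed.

Let tri n i k : n \in N -> e k * n * e i != 0 -> sord ord i k.
Proof. by move=> hn; apply: (cb_tri hB hn); rewrite inE. Qed.

(* A vector at [i] of a module without composition factors outside of the down-set
   of [i] spans a simple [B]-module, since [B] only goes up. *)
Let low_act i (X : lmodType sB) (x : X) : eBs i *: x = x ->
  (forall k, ~~ ord k i -> forall y : X, eBs k *: y = 0) ->
  forall b, b *: x = (chiB i b : K)%:A *: x.
Proof.
move=> ex kX b; rewrite (act_e chiB b ex) -[RHS]addr0; congr (_ + _).
set n := b * _ - _; have nN : vsval n \in N by exact: (N_part sb ef eB i (subvsP b)).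
have ne : n * eBs i = n.
  by rewrite /n mulrBl -mulrA -scalerAl (eii efB).
rewrite -ex scalerA ne -[n]mul1r -(if_sum efB) mulr_suml scaler_suml big1 // => k _.
have [h|h] := eqVneq (e k * vsval n * e i) 0.
  have -> : eBs k * n = 0; last by rewrite scale0r.
  by rewrite -ne mulrA; apply: val_inj.
by rewrite -scalerA kX // sord_ord // (tri nN h).
Qed.

Section WithSimples.
Variable LB : I -> lmodType sB.
Hypothesis LBc : forall i, exists u : LB i, char_module (chiB i) u.

Let LBsimple : simple_modules LB.
Proof.
split=> [i|i j|M sM].
- by have [u hu] := LBc i; apply: char_module_simple hu.
- by have [u hu] := LBc i; have [w hw] := LBc j; apply: (char_isom_inj efB hu hw).
- have [i [u hu]] := simple_char sbB sM; have [w hw] := LBc i.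
  by exists i; apply: char_module_isom hu hw.
Qed.

Let std_char i (S : lmodType sB) (w : S) (P : lmodType sB) (g : P) (p : {linear P -> LB i})
    (q : {linear P -> S}) :
  char_module (chiB i) w -> gen_module (eBs i) g -> p g != 0 -> q g = w ->
  projective_cover p /\ standard_quotient LB ord i q.
Proof.
move=> hw hg pg qg; have [u _] := LBc i.
apply: (standard_intro sbB efB LBc u hg pg qg).
- by have [_ _ ws] := hw => x; have [c ->] := ws x; exists c%:A.
- exact: char_module_findim hw.
- move=> k nki x; rewrite (char_e efB hw); case: eqP => // ki.
  by case: hord nki => r _ _; rewrite ki r.
- move=> X x ex kX; exact: (char_module_hom hw (low_act ex kX)).
Qed.

Let gen_pq i (S : lmodType sB) (w : S) : char_module (chiB i) w -> exists (P : lmodType sB) (g : P) (p : {linear P -> LB i})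
    (q : {linear P -> S}), [/\ gen_module (eBs i) g, p g != 0, char_module (chiB i) (p g) & q g = w].
Proof.
move=> hw; have [u hu] := LBc i; have [P [g hg]] := gen_moduleB B1 ef eB i.
have [|p pE] := @gen_module_hom _ _ _ P g (LB i) u hg.
  by rewrite (char_e efB hu) eqxx.
have [|q qE] := @gen_module_hom _ _ _ P g S w hg.
  by rewrite (char_e efB hw) eqxx.
have pg : p g = u by rewrite -[g]scale1r pE scale1r.
exists P, g, p, q; rewrite pg; split=> //; first by case: hu.
by rewrite -[g]scale1r qE scale1r.
Qed.

Let std_charP i (S : lmodType sB) (w : S) : char_module (chiB i) w -> standard LB ord i S.
Proof.
move=> hw; have [P [g [p [q [hg pg _ qg]]]]] := gen_pq hw.
by exists P, p, q; apply: std_char hw hg pg qg.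
Qed.

Let LBqh : quasi_hereditary LB ord.
Proof.
move=> i; have [u hu] := LBc i; have [P [g [p [q [hg pg hp qg]]]]] := gen_pq hu.
have [cov sq] := std_char hp hg pg erefl.
have [id idE] : exists r : {linear LB i -> LB i}, r =1 id by apply: mk_linear.
exists P, (LB i), p, p, id; split=> //.
- have [Z [z [zi zE]]] := kernel_module p; exists Z, z; split=> //.
  have fZ : findim Z by apply: findim_inj zi _; case: (gen_module_projective hg).
  apply: (filtered_intro sbB efB fZ) => S k w hw [x xk]; exists k; last exact: std_charP hw.
  have [eg gs gk] := hg; have [b hb] := gs (z x).
  have pz : p (z x) = 0 by apply/zE; exists x.
  have cb : chiB i b = 0 :> K.
    move: pz; rewrite hb linearZ /=; have [p0 pa _] := hp.
    by rewrite pa => /(kscal_eq0 p0).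
  have bN : vsval (b * eBs i) \in N.
    have := N_part sb ef eB i (subvsP b).
    by rewrite [chi i (vsval b)]cb scale0r subr0.
  apply: (tri (n := vsval (b * eBs i)) bN).
  apply: contraNneq xk => h; apply/eqP/zi; rewrite linear0 linearZ hb.
  transitivity ((eBs k * (b * eBs i) * eBs i) *: g); first by rewrite -!scalerA !eg.
  have -> : eBs k * (b * eBs i) * eBs i = 0 by apply: val_inj.
  exact: scale0r.
- have [Z [z [zi zE]]] := kernel_module id; exists Z, z; split=> //.
  apply: Filtered0 => x; apply: zi; rewrite linear0.
  by apply: etrans (esym (idE _)) _; apply/zE; exists x.
Qed.

Let dual : exists s, dual_basis B s.
Proof.
have [s [h1 h2 h3]] := cb_dual hB; rewrite (cornerT ef) in h1 h2 h3; exists s; split.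
- by move=> p hp a; apply: h1 => //; apply: memvf.
- by move=> p hp a b hb; apply: h2 => //; apply: memvf.
- by move=> a; apply: h3; apply: memvf.
Qed.

(** The induced module is A e_i / A N e_i. A vector at i in a module with factors below i spans a
    simple or zero B-module by [low_act], so it receives a B-map from L_B(i), and adjunction gives
    the universal property of the standard module. *)
Let LBstd i : exists2 D, standard L ord i D & isom (induced (LB i)) D.
Proof.
have [u hu] := LBc i; exists (induced (LB i)); last first.
  by exists idfun; exists id.
have [w hw] := hL i; have [P [g hg]] := gen_module_ex (eii ef i).
have [|p pE] := @gen_module_hom _ _ _ P g (L i) w hg.
  by rewrite (char_e ef hw) eqxx.
have [|q qE] := @gen_module_hom _ _ _ P g (induced (LB i)) (pt 1 u) hg.
  by rewrite tensor_scaleE mulr1 -{1}[e i]mul1r (ind_char_e B1 ef eB hu).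
exists P, p, q; apply: (standard_intro sb ef hL w hg).
- by rewrite -[g]scale1r pE scale1r; case: hw.
- by rewrite -[g]scale1r qE scale1r.
- move=> x; have [a ->] := ind_char_gen B1 hu x; exists a.
  by rewrite [RHS]tensor_scaleE mulr1.
- exact: (findim_induced B1 (char_module_findim hu)).
- move=> k nki x; have [a ->] := ind_char_gen B1 hu x.
  rewrite [LHS]tensor_scaleE -(ind_char_e B1 ef eB hu); apply: (ind_char_AN hu).
  by apply/mCN; apply: (cb_std hB) => //; rewrite ?inE // (cornerT ef) memvf.
- move=> X x ex kX.
  have h b : b *: (x : res B1 X) = (chiB i b : K)%:A *: (x : res B1 X).
    by apply: low_act => // k nki y; exact: kX.
  have [f fE] := char_module_hom hu h; have [f' f'E] := induced_adjoint f.
  by exists f'; rewrite f'E fE scale1r.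
Qed.

Section Ext.
Variables (i j : I) (ui : LB i) (uj : LB j).
Hypotheses (hui : char_module (chiB i) ui) (huj : char_module (chiB j) uj).
Notation X := (res B1 (induced (LB j))).
Variable u : {linear LB j -> X}.
Hypothesis uE : forall m, u m = pt 1 m.

Let u_inj : injective u.
Proof.
have [s hs] := dual; have [m [_ hm]] := dual_expand hs (pt 1 uj : induced (LB j)).
move=> x y hxy; apply/eqP; rewrite -subr_eq0; apply/eqP.
have [u0 _ us] := huj; have [c cE] := us (x - y); rewrite cE.
have : pt c%:A uj = 0.
  rewrite -[c%:A]mul1r -(vsval_scalar B1 c) -ptensorZ -cE -uE linearB hxy; exact: subrr.
move=> /(ind_char0 sb ef eB huj); rewrite mulr_algl => h.
by have := AN_rad sb h j; rewrite (chiZ chi) (chi_e ef) mulr1 => ->; exact: kscal0.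
Qed.

Let pt_ins a : a * e j \in AN -> pt a uj = 0.
Proof. by move=> h; rewrite -(ind_char_e B1 ef eB huj) (ind_char_AN huj h). Qed.

Let pt_scal (c : K) : pt (c *: e j) uj = u (c%:A *: uj).
Proof.
rewrite uE -(ind_char_e B1 ef eB huj) -scalerAl (eii ef) ptensorZ (vsval_scalar B1) mul1r.
by rewrite -[RHS](ind_char_e B1 ef eB huj) mulr_algl.
Qed.

Let pt_mul (b : sB) a : pt (vsval b * a) uj = b *: (pt a uj : X).
Proof. by rewrite res_scaleE tensor_scaleE. Qed.

Let ptB a a' : pt (a - a') uj = pt a uj - pt a' uj.
Proof. by apply: (@addIr _ (pt a' uj)); rewrite -ptensorDl !subrK. Qed.

Variables (C : lmodType sB) (q : {linear X -> C}).
Hypothesis q_surj : surj_lin q.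
Hypothesis q_ker : forall x, q x = 0 <-> exists m, u m = x.

Let fX : findim X.
Proof. exact: findim_res (findim_induced B1 (char_module_findim huj)). Qed.
Let fC : findim C. Proof. exact: findim_surj q_surj fX. Qed.

Let q_eq a a' : q (pt a uj) = q (pt a' uj) <->
  exists c : K, (a - a' - c *: e j) * e j \in AN.
Proof.
split=> [h|[c hc]].
  have /q_ker [m hm] : q (pt (a - a') uj) = 0.
    by rewrite ptB; apply: etrans (linearB q _ _) _; rewrite h subrr.
  have [_ _ us] := huj; have [c cE] := us m; exists c.
  apply: (ind_char0 sb ef eB huj); rewrite ptB pt_scal -cE hm; exact: subrr.
apply/eqP; rewrite -subr_eq0 -[X in X == 0](linearB q); apply/eqP/q_ker.
exists (c%:A *: uj); rewrite -pt_scal; apply/eqP; rewrite eq_sym -subr_eq0.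
by rewrite -[X in X - _]ptB -ptB; apply/eqP/pt_ins.
Qed.

(** [cb_baer] speaks of endomorphisms of A, whereas here the values lie in C j. Lifting the values
    on a basis of N e_l and extending linearly gives an endomorphism that represents [phi] up to e_j
    and A N. *)
Let C_baer : baer chiB eBs C.
Proof.
move=> l phi phiD phiM.
pose V := (N :&: limg (amulr (e l)))%VS.
have memV n : n \in V <-> n \in N /\ n * e l = n.
  rewrite memv_cap; split=> [/andP [h /memv_imgP [y _ ny]]|[-> h]].
    by split=> //; rewrite ny lfunE /= -mulrA (eii ef).
  by apply/memv_imgP; exists n; rewrite ?memvf // lfunE /= h.
have VB n : n \in V -> n \in B by move=> /memV [/mem_N []].
have Vrad (nB : sB) : vsval nB \in V -> in_rad chiB nB /\ nB * eBs l = nB.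
  by move=> /memV [/mem_N [_ h] h']; split; [exact: h|apply: val_inj].
pose ps (a : A) : sB := vsproj B a.
have psK a : a \in V -> vsval (ps a) = a by move=> /VB; exact: vsprojK.
have lift t : exists y, y * e j = y /\ q (pt y uj) = phi (ps (vbasis V)`_t).
  have [x xE] := q_surj (phi (ps (vbasis V)`_t)).
  have [a aE] := ind_char_gen B1 huj x; exists (a * e j); split; first by rewrite -mulrA (eii ef).
  by rewrite -xE aE (ind_char_e B1 ef eB huj).
have [y yE] := choice lift.
have Fl : linear (fun a : A => \sum_(t < \dim V) coord (vbasis V) t a *: y t).
  move=> c a b; rewrite scaler_sumr -big_split; apply: eq_bigr => t _.
  by rewrite linearP scalerDl scalerA.
pose F : {linear A -> A} := HB.pack (fun a : A => \sum_(t < \dim V) coord (vbasis V) t a *: y t)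
  (GRing.isLinear.Build _ _ _ _ _ Fl).
have Fe a : F a * e j = F a.
  rewrite /= mulr_suml; apply: eq_bigr => t _; rewrite -scalerAl; congr (_ *: _).
  by case: (yE t).
have phi0 : phi 0 = 0.
  have r0 : in_rad chiB 0 by move=> k; rewrite linear0.
  have := phiD 0 0 r0 (mul0r _) r0 (mul0r _); rewrite addr0 => /eqP.
  by rewrite -subr_eq0 opprD addrA subrr sub0r oppr_eq0 => /eqP.
have FE n : n \in V -> q (pt (F n) uj) = phi (ps n).
  move=> nV; rewrite [in RHS](coord_vbasis nV) /=.
  pose Q a b := b \in V /\ q (pt a uj) = phi (ps b).
  suff [] : Q (F n) (\sum_t coord (vbasis V) t n *: (vbasis V)`_t) by [].
  apply: (big_ind2 Q).
  - split; first exact: mem0v.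
    have -> : ps 0 = 0 by exact: linear0.
    by rewrite phi0 ptensor0l; exact: linear0.
  - move=> a b a' b' [h1 h2] [h3 h4]; split; first exact: rpredD.
    rewrite ptensorDl; apply: etrans (linearD q _ _) _; rewrite h2 h4.
    have -> : ps (b + b') = ps b + ps b' by exact: linearD.
    have [r1 e1] := Vrad (ps b) (etrans (congr1 (fun x => x \in V) (psK _ h1)) h1).
    have [r2 e2] := Vrad (ps b') (etrans (congr1 (fun x => x \in V) (psK _ h3)) h3).
    by rewrite phiD.
  - move=> t _; set c := coord _ _ _; set v := (vbasis V)`_t.
    have vV : v \in V by apply: vbasis_mem; rewrite mem_nth // size_tuple.
    have [r1 e1] := Vrad (ps v) (etrans (congr1 (fun x => x \in V) (psK _ vV)) vV).
    split; first exact: rpredZ.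
    have -> : ps (c *: v) = c%:A * ps v.
      by rewrite mulr_algl; exact: (linearZ_LR (vsproj B)).
    rewrite phiM // -(yE t).2; apply: etrans (linearZ_LR q _ _); congr (q _).
    by rewrite -pt_mul (vsval_scalar B1) mulr_algl.
have F_N n : n \in N -> n * e l = n -> q (pt (F n) uj) = phi (ps n).
  by move=> h1 h2; apply: FE; apply/memV.
have [||||x [_ xe hx]] := cb_baer hB (i := l) (j := j) (phi := linfun F).
- by rewrite inE.
- by rewrite inE.
- by move=> n _ _; rewrite lfunE (cornerT ef) memvf /= Fe.
- move=> n b hn ne hb; rewrite !lfunE.
  have bn : b * n \in N by apply: N_mull.
  have bne : b * n * e l = b * n by rewrite -mulrA ne.
  have [|c hc] := (q_eq (F (b * n)) (b * F n)).1.
    rewrite F_N //.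
    have -> : ps (b * n) = ps b * ps n.
      apply: val_inj; rewrite /= !vsprojK //; first by case: ((mem_N chi B n).1 hn).
      by case: ((mem_N chi B _).1 bn).
    have [r1 e1] := Vrad (ps n) (etrans (congr1 (fun x => x \in V) (psK _ ((memV n).2 (conj hn ne)))) ((memV n).2 (conj hn ne))).
    rewrite phiM // -F_N // -[b in RHS](vsprojK hb).
    by apply: etrans (esym (linearZ_LR q _ _)) _; rewrite -pt_mul.
  exists c; apply/mCN; move: hc.
  by rewrite !mulrBl -scalerAl (eii ef) Fe -(mulrA b) Fe.
exists (q (pt x uj)) => r rr re.
have rN : vsval r \in N by apply/mem_N; split; [exact: subvsP|exact: rr].
have re' : vsval r * e l = vsval r by rewrite -[in RHS]re.
have psr : ps (vsval r) = r by apply: val_inj; apply: vsprojK; exact: subvsP.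
rewrite -[in LHS]psr -F_N //; apply: etrans (linearZ_LR q _ _); rewrite -pt_mul.
have [c hc] := hx _ rN re'; apply/q_eq; exists c; move: hc; rewrite lfunE => /mCN hc.
by rewrite !mulrBl -scalerAl (eii ef) Fe -(mulrA _ x) xe.
Qed.

Let q_lift (P : lmodType sB) (f : {linear P -> C}) : projective P ->
  exists f' : {linear P -> X}, forall x, q (f' x) = f x.
Proof. by move=> [_ lP]; apply: lP. Qed.

Let u_factor (P : lmodType sB) (f : {linear P -> X}) : (forall x, q (f x) = 0) ->
  exists g : {linear P -> LB j}, forall x, u (g x) = f x.
Proof. by move=> h; apply: linear_lift_inj => // x; apply/q_ker. Qed.

Let linB (P Y : lmodType sB) (f g : {linear P -> Y}) :
  exists h : {linear P -> Y}, forall x, h x = f x - g x.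
Proof. by apply: mk_linear => a x y; rewrite !linearP /= addrACA -scalerDr. Qed.

Variables (P : chain_data sB) (eps : {linear P 0%N -> LB i}).
Hypothesis Pres : proj_resolution eps.

Let Pp k : projective (P k). Proof. by case: Pres. Qed.
Let dd k x : cdiff P k (cdiff P k.+1 x) = 0.
Proof. by case: Pres => _ _ _ /(_ k) ee; apply/ee; exists x. Qed.

(** It suffices to find a cocycle r with the same image in C j as t, since t - r then takes values
    in L_B(j). For k = 0 it comes from lifting a map L_B(i) -> C j by [cb_socle]. For larger k,
    injectivity of C j makes q t a coboundary, and the bounding map lifts to D j. *)
Let ext_inj k (g : {linear P k.+1 -> LB j}) (t : {linear P k -> X}) :
  (forall p, u (g p) = t (cdiff P k p)) -> coboundary g.
Proof.
move=> ht.
have qtd p : q (t (cdiff P k p)) = 0 by rewrite -ht; apply/q_ker; exists (g p).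
suff [r rE] : exists r : {linear P k -> X}, (forall p, r (cdiff P k p) = 0) /\
    forall p, q (r p) = q (t p).
  case: rE => r0 rE; have [f fE] := linB t r.
  have [g' g'E] : exists g' : {linear P k -> LB j}, forall x, u (g' x) = f x.
    by apply: u_factor => x; rewrite fE linearB rE subrr.
  by exists g' => p; apply: u_inj; rewrite ht g'E fE r0 subr0.
case: k g t ht qtd => [|k] g t ht qtd.
  have [_ es e0 _] := Pres.
  have [||rb rbE] := @linear_factor _ _ _ _ eps (q \o t).
  - exact: es.
  - by move=> p /e0 [p' <-]; apply: qtd.
  have [y yE] := q_surj (rb ui).
  have ex : eBs i *: (eBs i *: y) = eBs i *: y by rewrite scalerA (eii efB).
  set x := eBs i *: y in ex.
  have qx : q x = rb ui.
    by rewrite linearZ /= yE -linearZ (char_e efB hui) eqxx.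
  have [a aE] := ind_char_gen B1 huj x.
  have nx n : n \in N -> n * (a * e j) \in AN.
    move=> hn; apply/mCN.
    apply: (cb_socle hB (j := j) (x := a * e j)) hn; rewrite ?inE ?(cornerT ef) ?memvf //.
      by rewrite -mulrA (eii ef).
    move=> n' hn'; have [nB rn] := (mem_N chi B n').1 hn'.
    have [|c hc] := (q_eq (n' * a) 0).1.
      rewrite ptensor0l; apply: etrans (esym (linear0 q)).
      apply: etrans (congr1 q (pt_mul (Subvs nB) a)) _; rewrite linearZ.
      rewrite -aE qx; apply: etrans (esym (linearZ_LR rb _ _)) _.
      by rewrite (char_rad hui) ?linear0.
    exists c; apply/mCN; move: hc.
    by rewrite subr0 mulrBl -scalerAl (eii ef) mulrA.
  have xact b : b *: x = (chiB i b : K)%:A *: x.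
    rewrite (act_e chiB b ex) -[RHS]addr0; congr (_ + _).
    set n := b * _ - _; have nN : vsval n \in N by exact: (N_part sb ef eB i (subvsP b)).
    by rewrite aE -pt_mul; apply: pt_ins; rewrite -mulrA; apply: nx.
  have [r rE] := char_module_hom hui xact.
  have qr m : q (r m) = rb m.
    have [_ _ us] := hui; have [c ->] := us m.
    by rewrite !linearZ rE /= qx.
  exists (r \o eps); split=> p /=; last by rewrite qr rbE.
  have -> : eps (cdiff P 0 p) = 0 by apply/e0; exists p.
  exact: linear0.
have [||rb rbE] := @baer_extend _ _ _ _ sbB _ efB C _ _ (cdiff P k) (q \o t) C_baer.
- by case: (Pp k).
- by move=> p h; have [_ _ _ /(_ k)/(_ p)[/(_ h) [p' <-] _]] := Pres; apply: qtd.
have [r rE] := q_lift rb (Pp k).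
exists (r \o cdiff P k); split=> p /=; last by rewrite rE rbE.
by rewrite dd linear0.
Qed.

(** Injectivity of C j makes q f a coboundary. Its bounding map lifts to D j, and subtracting the
    boundary of the lift from f leaves a cocycle with values in L_B(j). *)
Let ext_surj k (f : {linear P k.+1 -> X}) : (forall p, f (cdiff P k.+1 p) = 0) ->
  exists (g : {linear P k.+1 -> LB j}) (t : {linear P k -> X}),
    cocycle g /\ forall p, f p - u (g p) = t (cdiff P k p).
Proof.
move=> f0.
have [||rb rbE] := @baer_extend _ _ _ _ sbB _ efB C _ _ (cdiff P k) (q \o f) C_baer.
- by case: (Pp k).
- move=> p h; have [_ _ _ /(_ k)/(_ p)[/(_ h) [p' <-] _]] := Pres.
  by rewrite /= f0 linear0.
have [t tE] := q_lift rb (Pp k).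
have [h hE] := linB f (t \o cdiff P k).
have [g gE] : exists g : {linear P k.+1 -> LB j}, forall x, u (g x) = h x.
  by apply: u_factor => x; rewrite hE linearB /= tE rbE subrr.
exists g, t; split=> p; last by rewrite gE hE subKr.
by apply: u_inj; rewrite gE hE f0 /= dd (linear0 t) subr0 (linear0 u).
Qed.

Let ind_comp0 (M1 M2 M3 : lmodType sB) (d : {linear M1 -> M2}) (g : {linear M2 -> M3}) :
  (forall m, g (d m) = 0) -> forall t, induced_map g (induced_map d t) = 0.
Proof.
move=> h; apply: tensor_ind_sum => [|x y hx hy|a m].
- by rewrite !raddf0.
- apply: etrans (linearD (induced_map g \o induced_map d) x y) _ => /=.
  by rewrite [X in X + _]hx [X in _ + X]hy addr0.
- by rewrite [induced_map d _]tmap_ptensor [LHS]tmap_ptensor h ptensor0r.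
Qed.

(** [ext_comparison] passes from [R] to the induced resolution, and adjunction passes from A-maps on
    induced modules to B-maps into D j. *)
Lemma borel_ext_iso k (R : chain_data A) (eta : {linear R 0%N -> induced (LB i)})
    (c : forall n, {linear R n -> induced (P n)}) :
  proj_resolution eta ->
  (forall x, induced_map eps (c 0%N x) = eta x) ->
  (forall n x, c n (cdiff R n x) = induced_map (cdiff P n) (c n.+1 x)) ->
  (forall g : {linear P k.+1 -> LB j}, cocycle g ->
     coboundary (induced_map g \o c k.+1) -> coboundary g) /\
  (forall h : {linear R k.+1 -> induced (LB j)}, cocycle h ->
     exists2 g : {linear P k.+1 -> LB j}, cocycle g
       & coboundary (fun x => h x - induced_map g (c k.+1 x))).
Proof.
move=> Rres c0 cS; have [s hs] := dual.
have FPres := ind_resolution hs B1 Pres.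
have [E1 E2] := @ext_comparison K A (induced (LB i)) (induced (LB j)) R (ind_chain P) eta
  (induced_map eps) Rres FPres c c0 cS k.
have [w0 w0E] := tensor_unit B1 (P k); have [w1 w1E] := tensor_unit B1 (P k.+1).
split=> [g gc gb|h hc].
- have [|t tE] := E1 (induced_map g) _ gb.
    by move=> x; apply: (ind_comp0 (g := g)).
  have [t' t'E] := res_linear B1 t.
  apply: (@ext_inj k g (t' \o w0)) => p.
  rewrite uE [RHS]t'E w0E -[LHS](tmap_ptensor (@vsval _ _ B)) [LHS]tE.
  by congr (t _); apply: etrans (tmap_ptensor _ _ _ _) _.
- have [g gc [s' s'E]] := E2 h hc.
  have [g' g'E] := res_linear B1 g.
  have [|g0 [t [g0c g0E]]] := @ext_surj k (g' \o w1).
    move=> p; apply: etrans (g'E _) _; rewrite w1E -[RHS](gc (pt 1 p)).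
    by congr (g _); apply/esym; apply: etrans (tmap_ptensor _ _ _ _) _.
  exists g0 => //; have [t1 t1E] := induced_adjoint t.
  have [g1 g1E] : exists g1 : {linear induced (P k.+1) -> induced (LB j)},
      g1 =1 (fun x => g x - induced_map g0 x).
    by apply: mk_linear => a x y; rewrite !linearP /= addrACA -scalerDr.
  have g1t x : g1 x = t1 (induced_map (cdiff P k) x).
    apply: (induced_ext (g := g1) (h := t1 \o induced_map (cdiff P k))) => p.
    apply/esym; apply: etrans (congr1 t1 (tmap_ptensor _ _ _ _)) _.
    rewrite t1E scale1r -g0E g1E [X in _ = _ - X]tmap_ptensor -uE; congr (_ - _).
    by apply: etrans (g'E _) _; rewrite w1E.
  have [r rE] : exists r : {linear R k -> induced (LB j)}, r =1 (fun y => s' y + t1 (c k y)).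
    by apply: mk_linear => a x y; rewrite !linearP /= addrACA -scalerDr.
  exists r => x; rewrite rE cS -s'E -g1t g1E addrA; congr (_ - _).
  by rewrite subrK.
Qed.
End Ext.

Let LBext k i j : ext_iso k (LB i) (LB j).
Proof.
move=> P eps R eta c Pres Rres c0 cS.
have [ui hui] := LBc i; have [uj huj] := LBc j.
have [u uE] := tensor_unit B1 (LB j).
have [|a x y [m <-] [m' <-]|U hU] := @mk_submodClosed _ (res B1 (induced (LB j)))
  (fun x => exists m, u m = x).
- by exists 0; rewrite linear0.
- by exists (a *: m + m'); rewrite linearP.
apply: (@borel_ext_iso i j ui uj hui huj u uE (quotmod U) (@qproj _ _ U) _ _ P eps Pres
  k R eta c Rres c0 cS).
- exact: qproj_surj.
- by move=> x; rewrite qproj0; apply: hU.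
Qed.

Lemma cborel_borel_simples : regular_exact_Borel L ord B.
Proof.
exists B => //; split; first exact: B1.
exists LB; split.
- exact: LBsimple.
- split=> // i; have [u hu] := LBc i; exact: std_charP hu.
- by have [s hs] := dual; apply: dual_induction_exact hs.
- exact: LBstd.
- exact: LBext.
Qed.
End WithSimples.

Lemma cborel_aspace_borel : regular_exact_Borel L ord B.
Proof.
have /choice [LB hLB] : forall i, exists M : lmodType sB, exists u : M, char_module (chiB i) u.
  by move=> i; apply: char_module_ex; apply: (sb_mul sbB).
exact: cborel_borel_simples hLB.
Qed.
End BorelBackward.

Theorem cborel_borel (K : fieldType) (A : falgType K) (I : finType)
    (chi : I -> {linear A -> K^o}) (e : I -> A) (L : I -> lmodType A) (ord : rel I)
    (B : {vspace A}) :
  split_basic chi -> idem_family chi e ->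
  (forall i, exists u : L i, char_module (chi i) u) -> partial_order ord ->
  cborel chi e ord setT B -> regular_exact_Borel L ord B.
Proof.
move=> sb ef hL hord hB.
have B1 : 1 \in B.
  by rewrite -(if_sum ef); apply: rpred_sum => i _; apply: (cb_idem hB); rewrite inE.
have aB : is_aspace B.
  rewrite /is_aspace has_algid1 //=; apply/prodvP => x y hx hy.
  exact: (cb_mul hB).
exact: (@cborel_aspace_borel K A I chi sb e ef L ord hL hord (ASpace aB) hB).
Qed.

(** * Gluing *)

Section Glue.
Variables (K : fieldType) (A : falgType K) (I : finType).
Variable chi : I -> {linear A -> K^o}.
Hypothesis sb : split_basic chi.
Variables (e : I -> A) (ef : idem_family chi e).
Variable (ord : rel I).
Variable v : I.
Notation ev := (e v).
Notation chv a := (chi v a : K).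

(** The quiver enters the gluing through these relations. The last one says that e_v A e_v is K e_v,
    which holds because v is a sink or a source. *)
Record deconcat (V1 V2 : {set I}) : Prop := Deconcat {
  dc_cover : V1 :|: V2 = [set: I];
  dc_meet : V1 :&: V2 = [set v];
  dc_zero : forall a i k, i \in V1 -> i != v -> k \in V2 -> k != v ->
    e k * a * e i = 0 /\ e i * a * e k = 0;
  dc_ev : forall a, ev * a * ev = chv a *: ev }.

Lemma deconcat_sym V1 V2 : deconcat V1 V2 -> deconcat V2 V1.
Proof.
case=> h1 h2 h3 h4; split=> //; rewrite 1?setUC 1?setIC // => a i k iV iv kV kv.
by have [] := h3 a k i kV kv iV iv.
Qed.

Lemma eset_el V i : eset e V * e i = if i \in V then e i else 0.
Proof.
rewrite /eset mulr_suml; case: ifP => iV.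
  rewrite (bigD1 i) //= (eii ef) big1 ?addr0 // => k /andP [_ ki].
  exact: eij ef _ _ ki.
by rewrite big1 // => k kV; apply: (eij ef); apply: contraFneq iV => <-.
Qed.

Lemma eset_er V i : e i * eset e V = if i \in V then e i else 0.
Proof.
rewrite /eset mulr_sumr; case: ifP => iV.
  rewrite (bigD1 i) //= (eii ef) big1 ?addr0 // => k /andP [_ ki].
  by apply: (eij ef); rewrite eq_sym.
by rewrite big1 // => k kV; apply: (eij ef); apply: contraFneq iV => ->.
Qed.

Lemma chi_eset V i : chi i (eset e V) = (i \in V)%:R :> K.
Proof.
rewrite /eset linear_sum /=; have [iV|iV] := boolP (i \in V).
  rewrite (bigD1 i) //= (chi_e ef) big1 ?addr0 // => k /andP [_ ki].
  by apply: (chi_en ef); rewrite eq_sym.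
by rewrite big1 // => k kV; apply: (chi_en ef); apply: contraNneq iV => ->.
Qed.

Lemma eset_id V : eset e V * eset e V = eset e V.
Proof.
rewrite {2 3}/eset mulr_sumr; apply: eq_bigr => i iV.
by rewrite eset_el iV.
Qed.

Lemma memv_corner V x : x \in cornerv e V <-> eset e V * x * eset e V = x.
Proof.
split=> [|<-]; last first.
  by apply: memv_mul; [apply: memv_mul; rewrite ?memv_line ?memvf|rewrite memv_line].
move: x; apply: prodv_ind => [|x y hx hy|c x hx|u w hu /vlineP [c ->]].
- by rewrite mulr0 mul0r.
- by rewrite mulrDr mulrDl hx hy.
- by rewrite -scalerAr -scalerAl hx.
rewrite -!scalerAr -scalerAl; congr (_ *: _).
move: u hu; apply: prodv_ind => [|x y hx hy|d x hx|x y /vlineP [d ->] _].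
- by rewrite !(mul0r, mulr0).
- by rewrite !mulrDl mulrDr mulrDl hx hy.
- by rewrite -!scalerAl -scalerAr -scalerAl hx.
by rewrite -!scalerAl -scalerAr -scalerAl !mulrA eset_id -!mulrA eset_id.
Qed.

Section Side.
Variables (V1 V2 : {set I}).
Hypothesis dc : deconcat V1 V2.
Notation E1 := (eset e V1).
Notation E2 := (eset e V2).
Notation H1 := (E1 - ev).
Notation H2 := (E2 - ev).
Notation c1 a := (E1 * a * E1).
Notation c2 a := (E2 * a * E2).

Lemma dc_v1 : v \in V1. Proof. by have := set11 v; rewrite -(dc_meet dc) inE => /andP []. Qed.
Lemma dc_v2 : v \in V2. Proof. by have := set11 v; rewrite -(dc_meet dc) inE => /andP []. Qed.

Lemma dc_in12 i : i \in V1 -> i != v -> i \notin V2.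
Proof.
move=> i1; apply: contraNN => i2; have : i \in V1 :&: V2 by rewrite inE i1.
by rewrite (dc_meet dc) inE.
Qed.

Lemma dc_notin1 i : i \notin V1 -> i \in V2 /\ i != v.
Proof.
move=> i1; have : i \in V1 :|: V2 by rewrite (dc_cover dc) inE.
rewrite inE (negbTE i1) /= => i2; split=> //.
by apply: contraNneq i1 => ->; apply: dc_v1.
Qed.

Lemma E1v : E1 * ev = ev. Proof. by rewrite eset_el dc_v1. Qed.
Lemma vE1 : ev * E1 = ev. Proof. by rewrite eset_er dc_v1. Qed.
Lemma vE2 : ev * E2 = ev. Proof. by rewrite eset_er dc_v2. Qed.

Lemma E12_sum : E1 + H2 = 1.
Proof.
have -> : H2 = \sum_(i in V2 | i != v) e i.
  by rewrite /eset (bigD1 v) ?dc_v2 //= addrAC subrr add0r.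
rewrite -(if_sum ef) [RHS](bigID (mem V1)) /=; congr (_ + _).
apply: eq_bigl => i; apply/andP/idP => [[i2 iv]|/dc_notin1 //].
by apply/negP => i1; move: (dc_in12 i1 iv); rewrite i2.
Qed.

Lemma H1sum : H1 = \sum_(i in V1 | i != v) e i.
Proof.
rewrite /eset (bigD1 v) ?dc_v1 //= addrAC subrr add0r.
by [].
Qed.

Lemma E1E1 : E1 * E1 = E1. Proof. exact: eset_id. Qed.
Lemma H1v : H1 * ev = 0. Proof. by rewrite mulrBl E1v (eii ef) subrr. Qed.
Lemma vH1 : ev * H1 = 0. Proof. by rewrite mulrBr vE1 (eii ef) subrr. Qed.
Lemma H1H1 : H1 * H1 = H1. Proof. by rewrite mulrBr H1v subr0 mulrBl E1E1 vE1. Qed.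
Lemma E1H1 : E1 * H1 = H1. Proof. by rewrite mulrBr E1E1 E1v. Qed.
Lemma H1E1 : H1 * E1 = H1. Proof. by rewrite mulrBl E1E1 vE1. Qed.
End Side.

Section Side2.
Variables (V1 V2 : {set I}).
Hypothesis dc : deconcat V1 V2.
Let cd := deconcat_sym dc.
Notation E1 := (eset e V1).
Notation E2 := (eset e V2).
Notation H1 := (E1 - ev).
Notation H2 := (E2 - ev).
Notation c1 a := (E1 * a * E1).
Notation c2 a := (E2 * a * E2).

Lemma H12 a : H1 * a * H2 = 0.
Proof.
rewrite (H1sum dc) (H1sum cd) !mulr_suml big1 // => i /andP [iV iv].
rewrite mulr_sumr big1 // => k /andP [kV kv].
by have [] := dc_zero dc a iV iv kV kv.
Qed.
Lemma H21 a : H2 * a * H1 = 0.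
Proof.
rewrite (H1sum dc) (H1sum cd) !mulr_suml big1 // => i /andP [iV iv].
rewrite mulr_sumr big1 // => k /andP [kV kv].
by have [] := dc_zero dc a kV kv iV iv.
Qed.

Lemma E2E1 : E2 * E1 = ev.
Proof.
have h := E12_sum dc; have -> : E2 = 1 - E1 + ev by rewrite -h [E1 + _]addrC addrK subrK.
by rewrite mulrDl mulrBl mul1r (E1E1 V1) subrr add0r (vE1 dc).
Qed.
Lemma E1E2 : E1 * E2 = ev.
Proof.
have h := E12_sum dc; have -> : E2 = 1 - E1 + ev by rewrite -h [E1 + _]addrC addrK subrK.
by rewrite mulrDr mulrBr mulr1 (E1E1 V1) subrr add0r (E1v dc).
Qed.

Lemma E1aH2 a : E1 * a * H2 = ev * a * H2.
Proof. by apply/eqP; rewrite -subr_eq0 -!mulrBl H12. Qed.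
Lemma H2aE1 a : H2 * a * E1 = H2 * a * ev.
Proof. by apply/eqP; rewrite -subr_eq0 -mulrBr H21. Qed.

(** Every path lies on one of the sides, and the trivial path at v, lying on both, is counted
    twice. *)
Lemma c_dec a : a = c1 a + c2 a - chv a *: ev.
Proof.
have h1 : E1 * a = c1 a + ev * a * H2.
  by rewrite -E1aH2 -mulrDr (E12_sum dc) mulr1.
have h2 : H2 * a = H2 * a * E2.
  by rewrite -[LHS]mulr1 -(E12_sum cd) mulrDr H21 addr0.
rewrite -(dc_ev dc) -{1}[a]mul1r -(E12_sum dc) mulrDl [in LHS]h1 [in LHS]h2 -!addrA; congr (_ + _).
by rewrite mulrBr !mulrBl addrC addrA subrK.
Qed.

Lemma c1_corner a : c1 a \in cornerv e V1.
Proof. by apply/memv_corner; rewrite !mulrA (E1E1 V1) -!mulrA (E1E1 V1). Qed.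

(** A product that leaves V1 and comes back passes through v both times, so its contribution lies in
    e_v A H2 A e_v; this is 0 because e_v A e_v = K e_v and chi_v vanishes on H2. *)
Lemma c1_mul a b : c1 (a * b) = c1 a * c1 b.
Proof.
have z : E1 * a * H2 * b * E1 = 0.
  transitivity (ev * (a * H2 * b) * ev).
    by rewrite E1aH2 -(mulrA (ev * a) H2 b) -(mulrA (ev * a) _ E1) H2aE1 !mulrA.
  rewrite (dc_ev dc) !(chiM sb) linearB /= chi_eset (dc_v2 dc) (chi_e ef) subrr.
  by rewrite mulr0 mul0r scale0r.
have -> : E1 * (a * b) * E1 = E1 * a * (E1 + H2) * b * E1.
  by rewrite (E12_sum dc) mulr1 !mulrA.
rewrite mulrDr !mulrDl z addr0 !mulrA -(mulrA (E1 * a) E1 E1) (E1E1 V1).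
by [].
Qed.

Lemma chv_c1 a : chi v (c1 a) = chi v a.
Proof. by rewrite !(chiM sb) chi_eset (dc_v1 dc) mulr1 mul1r. Qed.

End Side2.

Section Side3.
Variables (V1 V2 : {set I}).
Hypothesis dc : deconcat V1 V2.
Let cd := deconcat_sym dc.
Notation E1 := (eset e V1).
Notation E2 := (eset e V2).
Notation H1 := (E1 - ev).
Notation H2 := (E2 - ev).
Notation c1 a := (E1 * a * E1).
Notation c2 a := (E2 * a * E2).
Variables (B1 B2 : {vspace A}).
Hypotheses (hB1 : cborel chi e ord V1 B1) (hB2 : cborel chi e ord V2 B2).
Notation B := (B1 + B2)%VS.
Notation N := (nradv chi B).
Notation N1 := (nradv chi B1).
Notation N2 := (nradv chi B2).
Notation AN := (({:A} * N)%VS).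
Notation CN1 := (cradv chi e V1 B1).

Lemma ev1 : ev \in B1. Proof. exact: (cb_idem hB1) (dc_v1 dc). Qed.

Lemma E1B : E1 \in B1. Proof. by apply: rpred_sum => i; apply: (cb_idem hB1). Qed.

Lemma B1c1 b : b \in B1 -> c1 b = b.
Proof. by move=> hb; apply/memv_corner; apply: subvP (cb_corner hB1) _ hb. Qed.

Lemma B1E1 b : b \in B1 -> b * E1 = b.
Proof. by move=> hb; rewrite -{1}(B1c1 hb) -[LHS]mulrA (E1E1 V1) B1c1. Qed.

Lemma E1B1 b : b \in B1 -> E1 * b = b.
Proof. by move=> hb; rewrite -{1}(B1c1 hb) !mulrA (E1E1 V1) B1c1. Qed.

Lemma B1c2 b : b \in B1 -> c2 b = chv b *: ev.
Proof.
move=> /B1c1 <-; rewrite -(dc_ev dc) !mulrA (E2E1 dc) -!mulrA (E1E2 dc) !mulrA.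
by rewrite (vE1 dc) -!mulrA (E1v dc).
Qed.

Lemma B1sub b : b \in B1 -> b \in B.
Proof. by move=> hb; rewrite -[b]addr0 memv_add // mem0v. Qed.

Lemma N1P n : n \in N1 <-> n \in B1 /\ in_rad chi n.
Proof. by rewrite memv_cap; split=> [/andP [h /memv_rad]|[h /memv_rad]] //; rewrite h. Qed.

Lemma N1c1 n : n \in N1 -> c1 n = n. Proof. by move=> /N1P [/B1c1]. Qed.

Lemma col1 j x : j \in V1 -> j != v -> x * e j = x -> c1 x = x.
Proof.
move=> j1 jv xe; have xE : x * E1 = x by rewrite -xe -mulrA eset_er j1.
rewrite -mulrA xE; have H2x : H2 * x = 0.
  have -> : x = x * H1 by rewrite mulrBr xE -[x in X in _ = _ - X]xe -mulrA (eij ef) // mulr0 subr0.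
  by rewrite mulrA (H21 dc).
by rewrite -[RHS]mul1r -(E12_sum dc) mulrDl H2x addr0.
Qed.
End Side3.

Section Side4.
Variables (V1 V2 : {set I}).
Hypothesis dc : deconcat V1 V2.
Let cd := deconcat_sym dc.
Notation E1 := (eset e V1).
Notation E2 := (eset e V2).
Notation H1 := (E1 - ev).
Notation H2 := (E2 - ev).
Notation c1 a := (E1 * a * E1).
Notation c2 a := (E2 * a * E2).
Variables (B1 B2 : {vspace A}).
Hypotheses (hB1 : cborel chi e ord V1 B1) (hB2 : cborel chi e ord V2 B2).
Notation B := (B1 + B2)%VS.
Notation N := (nradv chi B).
Notation N1 := (nradv chi B1).
Notation N2 := (nradv chi B2).
Notation AN := (({:A} * N)%VS).
Notation CN1 := (cradv chi e V1 B1).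

(** Membership is tested corner by corner, because cutting B2 down to the first corner leaves only K
    e_v, which B1 contains, and conversely. *)
Lemma memB x : x \in B <-> c1 x \in B1 /\ c2 x \in B2.
Proof.
split=> [/memv_addP [b1 h1 [b2 h2 ->]]|[h1 h2]].
  rewrite !mulrDr !mulrDl (B1c1 hB1 h1) (B1c2 dc hB1 h1) (B1c1 hB2 h2) (B1c2 cd hB2 h2).
  by split; rewrite rpredD // rpredZ // ?(ev1 dc hB1) ?(ev1 cd hB2).
rewrite (c_dec dc x) -addrA; apply: memv_add => //.
by rewrite rpredB // rpredZ // (ev1 cd hB2).
Qed.

Lemma NP n : n \in N <-> n \in B /\ in_rad chi n.
Proof. by rewrite memv_cap; split=> [/andP [h /memv_rad]|[h /memv_rad]] //; rewrite h. Qed.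

Lemma N_c1 n : n \in N -> c1 n \in N1.
Proof.
move=> /NP [/memB [h _] rn]; apply/N1P; split=> //.
by apply: (in_radMr sb); apply: (in_radMl sb).
Qed.

Lemma N1N n : n \in N1 -> n \in N.
Proof. by move=> /N1P [h rn]; apply/NP; split=> //; apply: B1sub. Qed.

Lemma N_split n : n \in N -> n = c1 n + c2 n.
Proof.
by move=> /NP [_ rn]; rewrite {1}(c_dec dc n) (rn v) scale0r subr0.
Qed.

Lemma AN_c1 x : x \in AN -> c1 x \in CN1.
Proof.
move: x; apply: prodv_ind => [|x y hx hy|c x hx|u w hu hw].
- by rewrite mulr0 mul0r mem0v.
- by rewrite mulrDr mulrDl rpredD.
- by rewrite -scalerAr -scalerAl rpredZ.
- by rewrite (c1_mul dc) memv_mul ?N_c1 // (c1_corner V1).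
Qed.

Lemma CN1_AN x : x \in CN1 -> x \in AN.
Proof.
move: x; apply: subvP; apply: (@subv_trans _ _ ({:A} * N1)%VS).
  by apply: prodvSl; apply: subvf.
by apply: prodvSr; apply/subvP => n; apply: N1N.
Qed.

Lemma B_mul x y : x \in B -> y \in B -> x * y \in B.
Proof.
move=> /memB [x1 x2] /memB [y1 y2]; apply/memB.
by rewrite (c1_mul dc) (c1_mul cd); split; [exact: (cb_mul hB1)|exact: (cb_mul hB2)].
Qed.

Lemma glue_AN_mull a x : x \in AN -> a * x \in AN.
Proof.
move: x; apply: prodv_ind => [|x y hx hy|c x hx|u w hu hw].
- by rewrite mulr0 mem0v.
- by rewrite mulrDr rpredD.
- by rewrite -scalerAr rpredZ.
- by rewrite mulrA memv_mul // memvf.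
Qed.

Lemma N_AN n : n \in N -> n \in AN.
Proof. by move=> hn; rewrite -[n]mul1r memv_mul // memvf. Qed.

Lemma glue_tri n i k : n \in N -> i \in V1 -> k \in V1 -> e k * n * e i != 0 -> sord ord i k.
Proof.
move=> hn i1 k1 h; apply: (cb_tri hB1 (N_c1 hn) i1 k1); apply: contraNneq h => h.
by rewrite -h !mulrA eset_er k1 -!mulrA eset_el i1.
Qed.

Lemma glue_std i k a : i \in V1 -> k \in V1 -> ~~ ord k i -> e k * a * e i \in AN.
Proof.
move=> i1 k1 nki; apply: CN1_AN.
have := cb_std hB1 i1 k1 nki (c1_corner V1 a).
by rewrite !mulrA eset_er k1 -!mulrA eset_el i1.
Qed.

Hypothesis so : (forall a, a * ev = chv a *: ev) \/ (forall a, ev * a = chv a *: ev).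

(** The part of n in B1 is covered by the condition on B1. The part in B2 reaches x only through e_v
    x: at a sink n e_v = 0 for radical n, and at a source e_v x = 0 since j is not v. *)
Lemma glue_socle j x : j \in V1 -> j != v -> x * e j = x ->
  (forall n, n \in N -> exists c : K, n * x - c *: e j \in AN) ->
  forall n, n \in N -> n * x \in AN.
Proof.
move=> j1 jv xe hx n hn; have x1 := col1 dc j1 jv xe.
rewrite (N_split hn) mulrDl rpredD //.
  apply: CN1_AN; apply: (cb_socle hB1 j1 _ xe) (N_c1 hn); first by apply/memv_corner.
  move=> m hm; have [c hc] := hx m (N1N hm); exists c; have := AN_c1 hc.
  rewrite mulrBr mulrBl (c1_mul dc) x1 (N1c1 hB1 hm) -scalerAr -scalerAl.
  by rewrite eset_el j1 eset_er j1.
have -> : c2 n * x = E2 * n * (ev * x).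
  have h : E2 * x = ev * x by rewrite -x1 !mulrA (E2E1 dc) (vE1 dc).
  by rewrite -mulrA h.
case: so => [so1|so2].
  by rewrite mulrA so1 !(chiM sb) ((NP n).1 hn).2 mulr0 scale0r mul0r mem0v.
have -> : ev * x = 0 by rewrite -xe mulrA so2 -scalerAl (eij ef) 1?eq_sym // scaler0.
by rewrite mulr0 mem0v.
Qed.

Lemma glue_baer_same i j (phi : 'End(A)) : i \in V1 -> j \in V1 -> j != v ->
  (forall n, n \in N -> n * e i = n -> phi n * e j = phi n) ->
  (forall n b, n \in N -> n * e i = n -> b \in B ->
       exists c : K, phi (b * n) - b * phi n - c *: e j \in AN) ->
  exists x, [/\ c1 x = x, x * e j = x & forall n, n \in N1 -> n * e i = n ->
       exists c : K, phi n - n * x - c *: e j \in AN].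
Proof.
move=> i1 j1 jv phie phib.
have [||x [/memv_corner x1 xe hx]] := cb_baer hB1 i1 j1 (phi := phi).
- move=> n hn ne; have h := phie n (N1N hn) ne; split=> //.
  by apply/memv_corner; apply: (col1 dc j1 jv h).
- move=> n b hn ne hb; have [c hc] := phib n b (N1N hn) ne (B1sub B2 hb).
  exists c; have bn : b * n \in N1.
    apply/N1P; have [nB rn] := (N1P B1 n).1 hn.
    by split; [exact: (cb_mul hB1)|exact: (in_radMl sb)].
  have := AN_c1 hc; rewrite (col1 dc j1 jv) //.
  rewrite !mulrBl -scalerAl (eii ef) -mulrA !phie ?N1N //.
  by rewrite -mulrA ne.
exists x; split=> // n hn ne; have [c hc] := hx n hn ne; exists c; exact: CN1_AN.
Qed.
End Side4.

(** * Dual bases and Baer's criterion for the glued algebra *)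

Section Rep.
Variable B : {vspace A}.
(* The operator [psi] factors over a free right [B]-module. *)
Definition right_rep (psi : A -> A) : Prop := exists s : seq (A * 'End(A)),
  [/\ forall p, p \in s -> forall a, p.2 a \in B,
      forall p, p \in s -> forall a b, b \in B -> p.2 (a * b) = p.2 a * b
    & forall a, psi a = \sum_(p <- s) p.1 * p.2 a].

Lemma right_rep_add psi psi' :
  right_rep psi -> right_rep psi' -> right_rep (fun a => psi a + psi' a).
Proof.
move=> [s [s1 s2 s3]] [t [t1 t2 t3]]; exists (s ++ t); split.
- by move=> p; rewrite mem_cat => /orP [/s1|/t1].
- by move=> p; rewrite mem_cat => /orP [/s2|/t2].
- by move=> a; rewrite big_cat s3 t3.
Qed.

Lemma right_rep_ext psi psi' : (forall a, psi a = psi' a) -> right_rep psi -> right_rep psi'.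
Proof. by move=> h [s [s1 s2 s3]]; exists s; split=> // a; rewrite -h. Qed.
End Rep.

Section Side5.
Variables (V1 V2 : {set I}).
Hypothesis dc : deconcat V1 V2.
Let cd := deconcat_sym dc.
Notation E1 := (eset e V1).
Notation E2 := (eset e V2).
Notation H1 := (E1 - ev).
Notation H2 := (E2 - ev).
Notation c1 a := (E1 * a * E1).
Notation c2 a := (E2 * a * E2).
Variables (B1 B2 : {vspace A}).
Hypotheses (hB1 : cborel chi e ord V1 B1) (hB2 : cborel chi e ord V2 B2).
Notation B := (B1 + B2)%VS.
Notation N := (nradv chi B).
Notation N1 := (nradv chi B1).
Notation AN := (({:A} * N)%VS).
Notation CN1 := (cradv chi e V1 B1).

Lemma c1_lfun : exists f : 'End(A), forall a, f a = c1 a.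
Proof.
by exists (amull E1 \o amulr E1)%VF => a; rewrite comp_lfunE !lfunE /= mulrA.
Qed.

Lemma H1B : H1 \in B1.
Proof. by rewrite rpredB ?(E1B hB1) ?(ev1 dc hB1). Qed.

Lemma H1a a : H1 * a = H1 * (c1 a).
Proof.
have h : H1 * a = H1 * a * E1 + H1 * a * H2 by rewrite -mulrDr (E12_sum dc) mulr1.
by rewrite h (H12 dc) addr0 !mulrA (H1E1 dc).
Qed.

Lemma N1E1 n : n \in N1 -> n * E1 = n.
Proof. by move=> /(N1c1 hB1) <-; rewrite -mulrA (E1E1 V1). Qed.
Lemma E1N1 n : n \in N1 -> E1 * n = n.
Proof. by move=> /(N1c1 hB1) <-; rewrite !mulrA (E1E1 V1). Qed.

Lemma N1_mulr n b : n \in N1 -> b \in B1 -> n * b \in N1.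
Proof.
move=> /N1P [nB rn] hb; apply/N1P; split; first exact: (cb_mul hB1).
exact: (in_radMr sb).
Qed.

(** Applied to idempotents b that fix n: then [phi n] may be replaced by [b * phi n], up to e_j and
    A N. *)
Lemma nother i j (phi : 'End(A)) n (b : A) : n \in N -> n * e i = n -> b \in B -> b * n = n ->
  (forall n b, n \in N -> n * e i = n -> b \in B ->
       exists c : K, phi (b * n) - b * phi n - c *: e j \in AN) ->
  exists c : K, phi n - b * phi n - c *: e j \in AN.
Proof. by move=> hn ne hb bn /(_ n b hn ne hb) [c]; rewrite bn; exists c. Qed.

Section Source.
Hypothesis so : forall a, ev * a = chv a *: ev.

Lemma source_evN n : in_rad chi n -> ev * n = 0.
Proof. by move=> rn; rewrite so (rn v) scale0r. Qed.

Lemma source_H1N n : n \in N1 -> H1 * n = n.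
Proof. by move=> hn; rewrite mulrBl E1N1 // source_evN ?subr0 //; have /N1P [] := hn. Qed.

Lemma source_rep : right_rep B (fun a => H1 * a).
Proof.
have [s [s1 s2 s3]] := cb_dual hB1; have [c1e c1eE] := c1_lfun.
exists [seq (H1 * p.1, (p.2 \o c1e)%VF) | p <- s]; split.
- move=> _ /mapP [p ps ->] a /=; rewrite comp_lfunE c1eE; apply: B1sub.
  by apply: s1 => //; apply: c1_corner.
- move=> _ /mapP [p ps ->] a b /(memB dc hB1 hB2) [b1 b2] /=.
  rewrite !comp_lfunE !c1eE (c1_mul dc) s2 ?(c1_corner V1) //.
  have pB := s1 p ps _ (c1_corner V1 a).
  have pE : p.2 (c1 a) * E1 = p.2 (c1 a) := B1E1 hB1 pB.
  transitivity (p.2 (c1 a) * (E1 * b)); last by rewrite mulrA pE.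
  (* The corner of b may be replaced by b: E1 b H2 = e_v b H2, which vanishes at a source since e_v
     b is a multiple of e_v. *)
  congr (_ * _).
  rewrite -[RHS]mulr1 -(E12_sum dc) mulrDr (E1aH2 dc) so -scalerAl.
  by rewrite (vH1 cd) scaler0 addr0.
move=> a; rewrite H1a {1}(s3 _ (c1_corner V1 a)) mulr_sumr big_map.
by apply: eq_bigr => p _ /=; rewrite comp_lfunE c1eE mulrA.
Qed.

Lemma source_rep_v : right_rep B (fun a => ev * a).
Proof.
exists [:: (ev, amull ev)]; split.
- move=> p; rewrite inE => /eqP -> a /=; rewrite lfunE /= so rpredZ //.
  by apply: B1sub; exact: (ev1 dc hB1).
- by move=> p; rewrite inE => /eqP -> a b _ /=; rewrite !lfunE /= mulrA.
- by move=> a; rewrite big_seq1 lfunE /= mulrA (eii ef).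
Qed.

(** At a source the column at v meets both sides. [cb_socle] applies to its part y = H1 x, and the
    rest changes n x by a multiple of n e_v, which lies in N. *)
Lemma source_socle x : x * ev = x ->
  (forall n, n \in N -> exists c : K, n * x - c *: ev \in AN) ->
  forall n, n \in N1 -> n * x \in AN.
Proof.
move=> xe hx; pose y := H1 * x.
have nx n : n \in N1 -> n * x = n * y + chv x *: (n * ev).
  move=> hn; rewrite /y mulrBl so mulrBr mulrA N1E1 // -scalerAr.
  by rewrite subrK.
have nv n : n \in N1 -> n * ev \in AN.
  by move=> hn; apply/N_AN/N1N/N1_mulr => //; exact: (ev1 dc hB1).
have xE : x * E1 = x by rewrite -xe -mulrA (vE1 dc).
have y1 : c1 y = y by rewrite /y !mulrA (E1H1 dc) -mulrA xE.
have ny n : n \in N1 -> n * y \in CN1.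
  apply: (cb_socle hB1 (dc_v1 dc)); first by apply/memv_corner.
    by rewrite /y -mulrA xe.
  move=> m hm; have [c hc] := hx m (N1N B2 hm); exists c.
  have := AN_c1 dc hB1 hB2 (rpredB hc (rpredZ (chv x) (nv m hm))).
  have -> : m * x - c *: ev - chv x *: (m * ev) = m * y - c *: ev.
    by rewrite (nx m hm) addrAC addrK.
  by rewrite mulrBr mulrBl (c1_mul dc) y1 (N1c1 hB1 hm) -scalerAr -scalerAl (E1v dc) (vE1 dc).
move=> n hn; rewrite nx // rpredD ?rpredZ ?nv //.
exact: CN1_AN (ny n hn).
Qed.

(** As [phi] takes values on both sides, it is replaced by H1 phi. Moving H1 past b costs a multiple
    of H1 b e_v, an element of N, and n = H1 n at a source allows phi n to be compared with H1 phi
    n. *)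
Lemma source_baer_v i (phi : 'End(A)) : i \in V1 ->
  (forall n, n \in N -> n * e i = n -> phi n * ev = phi n) ->
  (forall n b, n \in N -> n * e i = n -> b \in B ->
       exists c : K, phi (b * n) - b * phi n - c *: ev \in AN) ->
  exists x, [/\ c1 x = x, x * ev = x & forall n, n \in N1 -> n * e i = n ->
       exists c : K, phi n - n * x - c *: ev \in AN].
Proof.
move=> i1 phie phib; pose psi : 'End(A) := (amull H1 \o phi)%VF.
have psiE n : psi n = H1 * phi n by rewrite comp_lfunE lfunE.
have psi1 n : n \in N1 -> n * e i = n -> c1 (psi n) = psi n.
  move=> hn ne; rewrite psiE !mulrA (E1H1 dc) -[phi n](phie _ (N1N B2 hn) ne).
  by rewrite -!mulrA (vE1 dc).
have [||x [/memv_corner x1 xe hx]] := cb_baer hB1 i1 (dc_v1 dc) (phi := psi).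
- move=> n hn ne; split; first by apply/memv_corner; exact: psi1.
  by rewrite psiE -mulrA phie // N1N.
(* The multiple of e_v disappears because H1 e_v = 0. *)
- move=> n b hn ne hb; exists 0; rewrite scale0r subr0.
  have [c hc] := phib n b (N1N B2 hn) ne (B1sub B2 hb).
  have bn : b * n \in N1.
    have /N1P [nB rn] := hn; apply/N1P; split; first exact: (cb_mul hB1).
    exact: (in_radMl sb).
  have bne : b * n * e i = b * n by rewrite -mulrA ne.
  have -> : psi (b * n) - b * psi n = c1 (psi (b * n) - b * psi n).
    by rewrite mulrBr mulrBl (c1_mul dc) !psi1 // (B1c1 hB1 hb).
  apply: (AN_c1 dc hB1 hB2); rewrite !psiE.
  have bE : H1 * b * E1 = H1 * b by rewrite -mulrA (B1E1 hB1 hb).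
  have e1 : b * (H1 * phi n) = H1 * b * H1 * phi n.
    have h : b = H1 * b + ev * b by rewrite -mulrDl subrK (E1B1 hB1 hb).
    by rewrite mulrA {1}h mulrDl (so b) -scalerAl (vH1 dc) scaler0 addr0.
  have e2 : H1 * (b * phi n) = H1 * b * H1 * phi n + chv (phi n) *: (H1 * b * ev).
    have h : H1 * b = H1 * b * H1 + H1 * b * ev by rewrite -mulrDr subrK bE.
    by rewrite mulrA [in LHS]h mulrDl -(mulrA (H1 * b) ev) (so (phi n)) -scalerAr.
  have -> : H1 * phi (b * n) - b * (H1 * phi n) =
     H1 * (phi (b * n) - b * phi n - c *: ev) + chv (phi n) *: (H1 * b * ev).
    rewrite !mulrBr -scalerAr (H1v dc) scaler0 subr0 e2 e1 opprD addrA subrK.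
    by [].
  rewrite rpredD ?glue_AN_mull // rpredZ //; apply/N_AN/N1N/N1P; split.
    apply: (cb_mul hB1); last exact: (ev1 dc hB1).
    by apply: (cb_mul hB1) => //; apply: H1B.
  move=> k; rewrite !(chiM sb) linearB /= chi_eset.
  have [->|kv] := eqVneq k v; first by rewrite (dc_v1 dc) (chi_e ef) subrr !mul0r.
  by rewrite (chi_en ef kv) mulr0.
exists x; split=> // n hn ne; have [c hc] := hx n hn ne.
have [d hd] := nother (N1N B2 hn) ne (B1sub B2 H1B) (source_H1N hn) phib.
exists (d + c); have := rpredD hd (CN1_AN B2 hc); rewrite psiE.
by rewrite scalerDl opprD !addrA [phi n - _ - _ + _]addrAC subrK [_ - d *: _ - _]addrAC.
Qed.
End Source.

Section Sink.
Hypothesis so : forall a, a * ev = chv a *: ev.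

(** At a sink q e_v is a multiple of e_v, which H1 kills. Hence q = q H1, and H1 b H2 = 0. *)
Lemma sink_mul q b : q \in B1 -> H1 * q = q -> q * c1 b = q * b.
Proof.
move=> qB qH; have qe : q * E1 = q := B1E1 hB1 qB.
have qv : q * ev = 0 by rewrite -qH -mulrA so -scalerAr (H1v dc) scaler0.
have qh : q = q * H1 by rewrite mulrBr qe qv subr0.
have h : q * b * H2 = 0 by rewrite qh -2!mulrA (mulrA H1) (H12 dc) mulr0.
rewrite -[RHS]mulr1 -(E12_sum dc) mulrDr h addr0.
by rewrite !mulrA qe.
Qed.

Lemma sink_rep : right_rep B (fun a => H1 * a).
Proof.
have [s [s1 s2 s3]] := cb_dual hB1; have [c1e c1eE] := c1_lfun.
have pE p a : (amull H1 \o (p \o c1e))%VF a = H1 * p (c1 a) :> A.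
  by rewrite comp_lfunE lfunE /= comp_lfunE c1eE.
have pB p a : p \in s -> H1 * p.2 (c1 a) \in B1.
  by move=> ps; apply: (cb_mul hB1) H1B _; apply: s1 => //; apply: (c1_corner V1).
exists [seq (H1 * p.1, (amull H1 \o (p.2 \o c1e))%VF) | p <- s]; split.
- by move=> _ /mapP [p ps ->] a; rewrite [X in X \in _](pE p.2 a); apply: B1sub; apply: pB.
- move=> _ /mapP [p ps ->] a b /(memB dc hB1 hB2) [b1 b2].
  rewrite [LHS](pE p.2 (a * b)) [X in _ = X * _](pE p.2 a) (c1_mul dc) s2 ?(c1_corner V1) // mulrA sink_mul ?pB //.
  by rewrite mulrA (H1H1 dc).
move=> a; rewrite H1a {1}(s3 _ (c1_corner V1 a)) mulr_sumr big_map.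
rewrite big_seq [RHS]big_seq; apply: eq_bigr => p ps; rewrite [X in _ = _ * X](pE p.2 a) /=.
have kB := s1 p ps _ (c1_corner V1 a).
have {1}-> : p.2 (c1 a) = H1 * p.2 (c1 a) + ev * p.2 (c1 a).
  by rewrite -mulrDl subrK (E1B1 hB1 kB).
rewrite mulrDr mulrDr !mulrA.
by rewrite -(mulrA H1 p.1 ev) so -scalerAr (H1v dc) scaler0 mul0r addr0.
Qed.

(** Inside the first corner, e_v B1 is a direct summand of the row at v, with the right B1-linear
    retraction [k0]. The complement uses coefficients in H1 B1, on which b and its corner act alike
    by [sink_mul]; so the summand is all that remains to be glued. *)
Lemma sink_retract : exists (k0 : 'End(A)) (t : seq (A * 'End(A))),
  [/\ forall a, c1 a = a -> [/\ k0 a \in B1, ev * k0 a = k0 a &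
        forall b, b \in B1 -> k0 (a * b) = k0 a * b],
      k0 ev = ev,
      forall p, p \in t -> forall z, c1 z = z -> [/\ p.2 z \in B1, H1 * p.2 z = p.2 z &
        forall b, b \in B1 -> p.2 (z * b) = p.2 z * b]
    & forall z, c1 z = z -> ev * z = z -> z = k0 z + \sum_(p <- t) p.1 * p.2 z].
Proof.
have [s [s1 s2 s3]] := cb_dual hB1.
pose k0 : 'End(A) := \sum_(p <- s) chv p.1 *: (amull ev \o p.2)%VF.
(* In the expansion of e_v a, only e_v p.1 e_v, that is chi_v(p.1) e_v, is kept of the first
   factor. *)
have k0E a : k0 a = \sum_(p <- s) chv p.1 *: (ev * p.2 a).
  rewrite /k0 sum_lfunE; apply: eq_bigr => p _.
  by rewrite scale_lfunE comp_lfunE lfunE.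
have C1 a : c1 a = a -> a \in cornerv e V1 by move=> h; apply/memv_corner.
have k0P a : c1 a = a -> [/\ k0 a \in B1, ev * k0 a = k0 a &
        forall b, b \in B1 -> k0 (a * b) = k0 a * b].
  move=> /C1 ha; split.
  - rewrite k0E big_seq; apply: rpred_sum => p ps; apply: rpredZ.
    by apply: (cb_mul hB1); [exact: (ev1 dc hB1)|exact: s1].
  - rewrite k0E mulr_sumr; apply: eq_bigr => p _.
    by rewrite -scalerAr mulrA (eii ef).
  - move=> b hb; rewrite !k0E mulr_suml big_seq [RHS]big_seq; apply: eq_bigr => p ps.
    by rewrite s2 // -scalerAl mulrA.
have cev : c1 ev = ev by rewrite (E1v dc) (vE1 dc).
have k0ev : k0 ev = ev.
  have e1 p : p \in s -> p.2 ev = chv (p.2 ev) *: ev.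
    by move=> ps; rewrite -so -s2 ?(eii ef) //; [exact: C1|exact: (ev1 dc hB1)].
  have e2 : \sum_(p <- s) chv p.1 * chv (p.2 ev) = 1.
    have := congr1 (fun x => chv x) (s3 _ (C1 _ cev)); rewrite (chi_e ef) linear_sum /= => ->.
    by apply: eq_bigr => p _; rewrite (chiM sb).
  rewrite k0E -[RHS]scale1r -e2 scaler_suml big_seq [RHS]big_seq.
  by apply: eq_bigr => p ps; rewrite {1}(e1 p ps) -scalerAr (eii ef) scalerA.
have zk z : c1 z = z -> c1 (z - k0 z) = z - k0 z.
  by move=> hz; have [kB _ _] := k0P z hz; rewrite mulrBr mulrBl hz (B1c1 hB1 kB).
have pE p z : (amull H1 \o (p \o (\1 - k0)))%VF z = H1 * p (z - k0 z) :> A.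
  by rewrite comp_lfunE lfunE /= comp_lfunE add_lfunE opp_lfunE id_lfunE.
exists k0, [seq (ev * p.1 * H1, (amull H1 \o (p.2 \o (\1 - k0)))%VF) | p <- s]; split=> //.
- move=> _ /mapP [p ps ->] z hz; cbn [fst snd]; rewrite pE.
  have kB := s1 p ps _ (C1 _ (zk z hz)); split.
  + exact: (cb_mul hB1) H1B kB.
  + by rewrite mulrA (H1H1 dc).
  move=> b hb; have [_ _ kb] := k0P z hz.
  by rewrite pE kb // -mulrBl s2 ?mulrA //; apply/C1/zk.
move=> z hz evz; rewrite big_map.
(* Subtracting this zero removes from every term of the expansion of z - k0 z the part of p.1 that
   starts at v, leaving e_v p.1 H1. *)
have k00 : k0 (z - k0 z) = 0.
  have [kB evk _] := k0P z hz; have [_ _ kb] := k0P ev cev.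
  have kk : k0 (k0 z) = k0 z by rewrite -{1}evk kb // k0ev evk.
  by apply: etrans (linearB k0 z (k0 z)) _; apply/eqP; rewrite subr_eq0; apply/eqP/esym/kk.
apply/eqP; rewrite addrC -subr_eq; apply/eqP.
have [kB evk _] := k0P z hz.
have -> : z - k0 z = ev * (z - k0 z) by rewrite mulrBr evz evk.
rewrite {1}(s3 _ (C1 _ (zk z hz))) mulr_sumr.
rewrite -[LHS]subr0 -[X in _ - X = _]k00 (k0E (z - k0 z)) -sumrB big_seq [RHS]big_seq.
apply: eq_bigr => p ps; cbn [fst snd]; rewrite pE.
have qB := s1 p ps _ (C1 _ (zk z hz)).
move: (p.2 _) qB => k qB /=.
have {1}-> : k = H1 * k + ev * k by rewrite -mulrDl subrK (E1B1 hB1 qB).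
rewrite (mulrDr p.1) (mulrDr ev).
have -> : ev * (p.1 * (ev * k)) = chv p.1 *: (ev * k).
  by rewrite !mulrA (dc_ev dc) -scalerAl.
by rewrite addrK !mulrA -[X in _ = X * _]mulrA (H1H1 dc).
Qed.

Lemma sink_tail : exists k0 : 'End(A),
  [/\ forall a, c1 a = a -> [/\ k0 a \in B1, ev * k0 a = k0 a &
        forall b, b \in B1 -> k0 (a * b) = k0 a * b],
      k0 ev = ev & right_rep B (fun a => c1 (ev * a) - k0 (c1 (ev * a)))].
Proof.
have [k0 [t [k1 k2 t1 t2]]] := sink_retract; exists k0; split=> //.
have [f fE] := c1_lfun.
have pE (p : 'End(A)) a : (p \o (f \o amull ev))%VF a = p (c1 (ev * a)) :> A.
  by rewrite comp_lfunE comp_lfunE lfunE /= fE.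
have cc a : c1 (c1 a) = c1 a by have /memv_corner := c1_corner V1 a.
exists [seq (p.1, (p.2 \o (f \o amull ev))%VF) | p <- t]; split.
- move=> _ /mapP [p pt ->] a; cbn [fst snd]; rewrite pE; apply: B1sub.
  by have [] := t1 p pt _ (cc (ev * a)).
- move=> _ /mapP [p pt ->] a b /(memB dc hB1 hB2) [b1 b2]; cbn [fst snd].
  rewrite !pE (mulrA ev a b) (c1_mul dc (ev * a)).
  have [h1 h2 h3] := t1 p pt _ (cc (ev * a)); rewrite h3 //; exact: sink_mul.
move=> a; have hev : ev * c1 (ev * a) = c1 (ev * a) by rewrite !mulrA (vE1 dc) (eii ef) (E1v dc).
rewrite {1}(t2 _ (cc (ev * a)) hev) addrAC subrr add0r big_map.
by apply: eq_bigr => p _; cbn [fst snd]; rewrite pE.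
Qed.
End Sink.
End Side5.

Section Side6.
Variables (V1 V2 : {set I}).
Hypothesis dc : deconcat V1 V2.
Let cd := deconcat_sym dc.
Notation E1 := (eset e V1).
Notation E2 := (eset e V2).
Notation H1 := (E1 - ev).
Notation H2 := (E2 - ev).
Notation c1 a := (E1 * a * E1).
Notation c2 a := (E2 * a * E2).
Variables (B1 B2 : {vspace A}).
Hypotheses (hB1 : cborel chi e ord V1 B1) (hB2 : cborel chi e ord V2 B2).
Notation B := (B1 + B2)%VS.
Notation N := (nradv chi B).
Notation N1 := (nradv chi B1).
Notation N2 := (nradv chi B2).
Notation AN := (({:A} * N)%VS).

Section Sink6.
Hypothesis so : forall a, a * ev = chv a *: ev.

(** The retractions onto e_v B1 and e_v B2 have the same component along K e_v, namely chi_v. Glued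
    there, they give a right B-linear retraction [K0] onto e_v B, and [sink_tail] represents what
    remains on each side. *)
Lemma sink_rep_v : right_rep B (fun a => ev * a).
Proof.
have [k1 [k1B k1v r1]] := sink_tail dc hB1 hB2 so.
have [k2 [k2B k2v r2]] := sink_tail cd hB2 hB1 so; rewrite addvC in r2.
have [f1 f1E] := c1_lfun V1; have [f2 f2E] := c1_lfun V2.
pose K0 : 'End(A) := ((k1 \o (f1 \o amull ev)) + (k2 \o (f2 \o amull ev)) - (amull ev \o amulr ev))%VF.
have K0E a : K0 a = k1 (c1 (ev * a)) + k2 (c2 (ev * a)) - chv a *: ev.
  rewrite add_lfunE opp_lfunE add_lfunE !comp_lfunE !lfunE /= f1E f2E.
  by rewrite (mulrA ev a ev) (dc_ev dc).
have cc1 a : c1 (c1 a) = c1 a by have /memv_corner := c1_corner V1 a.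
have cc2 a : c2 (c2 a) = c2 a by have /memv_corner := c1_corner V2 a.
have vB1 := ev1 dc hB1; have vB2 := ev1 cd hB2.
have r0 : right_rep B K0.
  exists [:: (ev, K0)]; split.
  - move=> p; rewrite inE => /eqP -> a; cbn [fst snd]; rewrite K0E.
    have [h1 _ _] := k1B _ (cc1 (ev * a)); have [h2 _ _] := k2B _ (cc2 (ev * a)).
    by rewrite -addrA memv_add // rpredB // rpredZ.
  - move=> p; rewrite inE => /eqP -> a b /(memB dc hB1 hB2) [b1 b2]; cbn [fst snd].
    rewrite !K0E (mulrA ev a b) (c1_mul dc (ev * a)) (c1_mul cd (ev * a)).
    have [h1 g1 l1] := k1B _ (cc1 (ev * a)); have [h2 g2 l2] := k2B _ (cc2 (ev * a)).
    rewrite l1 // l2 //.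
    have q1 : k1 (c1 (ev * a)) * ev = chv a *: ev.
      rewrite -l1 // so linearZ /= k1v (chv_c1 dc) (chiM sb) (chi_e ef) mul1r.
      by [].
    have q2 : k2 (c2 (ev * a)) * ev = chv a *: ev.
      rewrite -l2 // so linearZ /= k2v (chv_c1 cd) (chiM sb) (chi_e ef) mul1r.
      by [].
    (* On an element of B1, b acts through its first corner and, after e_v, through its second; the
       component along e_v is counted twice. *)
    have m1 (z : A) : z \in B1 -> z * ev = chv a *: ev ->
        z * b = z * c1 b + chv a *: (ev * c2 b) - (chv a * chv b) *: ev.
      move=> zB zv; have zE : z * E1 = z := B1E1 hB1 zB.
      rewrite -[LHS]mulr1 -(E12_sum dc) mulrDr.
      have -> : z * b * E1 = z * c1 b by rewrite !mulrA zE.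
      have -> : z * b * H2 = z * ev * (b * H2).
        by rewrite -{1}zE -(mulrA z E1 b) -(mulrA z) (E1aH2 dc) !mulrA.
      rewrite zv -scalerAl mulrBr mulrBr scalerBr (mulrA ev b ev) (dc_ev dc) scalerA addrA.
      by rewrite !mulrA (vE2 dc).
    have m2 (z : A) : z \in B2 -> z * ev = chv a *: ev ->
        z * b = z * c2 b + chv a *: (ev * c1 b) - (chv a * chv b) *: ev.
      move=> zB zv; have zE : z * E2 = z := B1E1 hB2 zB.
      rewrite -[LHS]mulr1 -(E12_sum cd) mulrDr.
      have -> : z * b * E2 = z * c2 b by rewrite !mulrA zE.
      have -> : z * b * H1 = z * ev * (b * H1).
        by rewrite -{1}zE -(mulrA z E2 b) -(mulrA z) (E1aH2 cd) !mulrA.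
      rewrite zv -scalerAl mulrBr mulrBr scalerBr (mulrA ev b ev) (dc_ev dc) scalerA addrA.
      by rewrite !mulrA (vE1 dc).
    rewrite mulrBl mulrDl (m1 _ h1 q1) (m2 _ h2 q2) -scalerAl (chiM sb).
    have evb : ev * b = ev * c1 b + ev * c2 b - chv b *: ev.
      by rewrite {1}(c_dec dc b) mulrBr mulrDr -scalerAr (eii ef).
    rewrite evb scalerBr scalerDr scalerA.
    apply/eqP; rewrite eq_sym subr_eq [X in X == _]addrACA [X in _ == X]addrACA.
    rewrite [X in X + _ == _]addrACA [X in _ + X + _ == _]addrC.
    by rewrite eqxx.
  move=> a; rewrite big_seq1; cbn [fst snd]; rewrite K0E mulrBr mulrDr -scalerAr (eii ef).
  by have [_ -> _] := k1B _ (cc1 (ev * a)); have [_ -> _] := k2B _ (cc2 (ev * a)).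
apply: (right_rep_ext _ (right_rep_add r0 (right_rep_add r1 r2))) => a.
rewrite K0E (addrACA (c1 (ev * a))) -opprD [LHS]addrC [LHS]addrA subrK.
rewrite [RHS](c_dec dc (ev * a)).
by rewrite (chiM sb) (chi_e ef) mul1r.
Qed.
End Sink6.

Lemma glue_dual : (forall a, a * ev = chv a *: ev) \/ (forall a, ev * a = chv a *: ev) ->
  right_rep B id.
Proof.
move=> so; have [r1 [r2 r3]] : right_rep B (fun a => H1 * a) /\
    right_rep (B2 + B1) (fun a => H2 * a) /\ right_rep B (fun a => ev * a).
  case: so => so.
    by split; [exact: (sink_rep dc hB1 hB2 so)|split; [exact: (sink_rep cd hB2 hB1 so)|exact: sink_rep_v]].
  split; [exact: (source_rep dc hB1 hB2 so)|split; [exact: (source_rep cd hB2 hB1 so)|]].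
  exact: (source_rep_v dc B2 hB1).
rewrite addvC in r2; apply: (right_rep_ext _ (right_rep_add r1 (right_rep_add r2 r3))) => a.
have h : E1 * a = H1 * a + ev * a by rewrite -mulrDl subrK.
by change (H1 * a + (H2 * a + ev * a) = a); rewrite (addrC (H2 * a)) [LHS]addrA -h -mulrDl (E12_sum dc) mul1r.
Qed.

(* For [i] on the side of [V2] and [j] on that of [V1], the only obstruction to
   [cb_baer] at a sink is a map [N_2 e_i -> e_v A e_j] factoring through the
   simple module at [v]. *)
Definition sink_condition (V1 V2 : {set I}) (B2 : {vspace A}) (W : {vspace A}) : Prop :=
  forall j, j \in V1 -> j != v ->
    (forall n, n \in nradv chi B2 -> ev * n = 0) \/ (forall a, ev * a * e j \in W).

Lemma glue_baer_sink i j (phi : 'End(A)) : (forall a, a * ev = chv a *: ev) ->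
  sink_condition V1 V2 B2 AN ->
  j \in V1 -> j != v ->
  (forall n, n \in N -> n * e i = n -> phi n * e j = phi n) ->
  (forall n b, n \in N -> n * e i = n -> b \in B ->
       exists c : K, phi (b * n) - b * phi n - c *: e j \in AN) ->
  exists x, [/\ x * e j = x & forall n, n \in N -> n * e i = n ->
       exists c : K, phi n - n * x - c *: e j \in AN].
Proof.
move=> so sc j1 jv phie phib.
have [iv|iv] := eqVneq i v.
  exists 0; split=> [|n hn]; first exact: mul0r.
  rewrite iv so ((NP B1 B2 n).1 hn).2 scale0r => <-.
  by exists 0; rewrite mul0r scale0r !subr0 linear0 mem0v.
have [i1|i1] := boolP (i \in V1).
  have [x [_ xe hx]] := glue_baer_same dc hB1 hB2 i1 j1 jv phie phib.
  exists x; split=> // n hn ne; apply: hx => //.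
  by rewrite -(col1 dc i1 iv ne); exact: (N_c1 dc hB1 hB2 hn).
have [i2 _] := dc_notin1 dc i1.
(* For i in V2, phi n agrees with e_v phi n up to e_j and A N. In the first alternative the latter
   agrees with phi (e_v n) = 0; in the second it lies in A N. *)
exists 0; split=> [|n hn ne]; first exact: mul0r.
rewrite mulr0 subr0.
have n2 : n \in N2 by rewrite -(col1 cd i2 iv ne); apply: (N_c1 cd hB2 hB1); rewrite (addvC B2).
have E2n : E2 * n = n by apply: (E1N1 hB2).
have E2B : E2 \in B by rewrite addvC; apply: B1sub; exact: (E1B hB2).
have evB : ev \in B by apply: B1sub; exact: (ev1 dc hB1).
have [c hc] := nother hn ne E2B E2n phib; have pe := phie n hn ne.
have E2p : E2 * phi n = ev * phi n.
  by rewrite -(col1 dc j1 jv pe) !mulrA (E2E1 dc) (vE1 dc).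
rewrite E2p in hc; have [ev0|evj] := sc j j1 jv.
  have [d hd] := phib n ev hn ne evB; exists (c - d); have := rpredB hc hd.
  rewrite (ev0 n n2) linear0 scalerBl sub0r !opprD !opprK !addrA.
  by rewrite [phi n - _ - _ + _]addrAC subrK.
by exists c; rewrite -(subrK (ev * phi n) (phi n)) addrAC rpredD // -pe mulrA.
Qed.

Lemma glue_baer_source i j (phi : 'End(A)) : (forall a, ev * a = chv a *: ev) ->
  i \in V1 -> j \in V1 ->
  (forall n, n \in N -> n * e i = n -> phi n * e j = phi n) ->
  (forall n b, n \in N -> n * e i = n -> b \in B ->
       exists c : K, phi (b * n) - b * phi n - c *: e j \in AN) ->
  exists x, [/\ c1 x = x, x * e j = x & forall n, n \in N1 -> n * e i = n ->
       exists c : K, phi n - n * x - c *: e j \in AN].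
Proof.
move=> so i1 j1; have [->|jv] := eqVneq j v.
  exact: (source_baer_v dc hB1 hB2 so i1).
exact: (glue_baer_same dc hB1 hB2 i1 j1 jv).
Qed.

(** At a source n = H1 n, so phi n may be replaced by H1 phi n, which is 0 because the column at j
    lies on the other side. *)
Lemma glue_baer_source0 i j (phi : 'End(A)) : (forall a, ev * a = chv a *: ev) ->
  j \notin V1 ->
  (forall n, n \in N -> n * e i = n -> phi n * e j = phi n) ->
  (forall n b, n \in N -> n * e i = n -> b \in B ->
       exists c : K, phi (b * n) - b * phi n - c *: e j \in AN) ->
  forall n, n \in N1 -> n * e i = n -> exists c : K, phi n - c *: e j \in AN.
Proof.
move=> so j1 phie phib n hn ne; have [j2 jv] := dc_notin1 dc j1.
have [c hc] := nother (N1N B2 hn) ne (B1sub B2 (H1B dc hB1)) (source_H1N hB1 so hn) phib.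
exists c; have h : H1 * phi n = 0; last by rewrite h subr0 in hc.
rewrite -(col1 cd j2 jv (phie n (N1N B2 hn) ne)) !mulrA.
by rewrite mulrBl (E1E2 dc) (vE2 dc) subrr !mul0r.
Qed.
End Side6.

Section Side7.
Variables (V1 V2 : {set I}).
Hypothesis dc : deconcat V1 V2.
Let cd := deconcat_sym dc.
Notation E1 := (eset e V1).
Notation E2 := (eset e V2).
Notation c1 a := (E1 * a * E1).
Notation c2 a := (E2 * a * E2).
Variables (B1 B2 : {vspace A}).
Hypotheses (hB1 : cborel chi e ord V1 B1) (hB2 : cborel chi e ord V2 B2).
Notation B := (B1 + B2)%VS.
Notation N := (nradv chi B).
Notation N1 := (nradv chi B1).
Notation N2 := (nradv chi B2).
Notation AN := (({:A} * N)%VS).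

Lemma in_sides i : [\/ i = v, i \in V1 /\ i != v | i \in V2 /\ i != v].
Proof.
have [->|iv] := eqVneq i v; first by constructor 1.
have [i1|/(dc_notin1 dc) [i2 _]] := boolP (i \in V1); first by constructor 2.
by constructor 3.
Qed.

Lemma glue_baer_source_all i j (phi : 'End(A)) : (forall a, ev * a = chv a *: ev) ->
  i \in V1 -> i != v ->
  (forall n, n \in N -> n * e i = n -> phi n * e j = phi n) ->
  (forall n b, n \in N -> n * e i = n -> b \in B ->
       exists c : K, phi (b * n) - b * phi n - c *: e j \in AN) ->
  exists x, [/\ x * e j = x & forall n, n \in N -> n * e i = n ->
       exists c : K, phi n - n * x - c *: e j \in AN].
Proof.
move=> so i1 iv phie phib; have nN n : n \in N -> n * e i = n -> n \in N1.
  by move=> hn ne; rewrite -(col1 dc i1 iv ne); exact: (N_c1 dc hB1 hB2 hn).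
have [j1|j1] := boolP (j \in V1).
  have [x [_ xe hx]] := glue_baer_source dc hB1 hB2 so i1 j1 phie phib.
  by exists x; split=> // n hn ne; apply: hx => //; apply: nN.
exists 0; split=> [|n hn ne]; first exact: mul0r.
have [c hc] := glue_baer_source0 dc hB1 so j1 phie phib (nN n hn ne) ne.
by exists c; rewrite mulr0 subr0.
Qed.

Lemma glue_baer_source_v j (phi : 'End(A)) : (forall a, ev * a = chv a *: ev) ->
  (forall n, n \in N -> n * ev = n -> phi n * e j = phi n) ->
  (forall n b, n \in N -> n * ev = n -> b \in B ->
       exists c : K, phi (b * n) - b * phi n - c *: e j \in AN) ->
  forall n, n \in N1 -> n * ev = n -> exists c : K, phi n - c *: e j \in AN.
Proof.
move=> so phie phib n hn ne; have [j1|j1] := boolP (j \in V1); last first.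
  exact: (glue_baer_source0 dc hB1 so j1 phie phib hn ne).
have [x [x1 xe hx]] := glue_baer_source dc hB1 hB2 so (dc_v1 dc) j1 phie phib.
have [c hc] := hx n hn ne; exists c.
rewrite -(subrK (n * x) (phi n)) addrAC rpredD // -ne -mulrA so -scalerAr rpredZ // ne.
exact: N_AN (N1N B2 hn).
Qed.
End Side7.

Section Final.
Variables (V1 V2 : {set I}).
Hypothesis dc : deconcat V1 V2.
Let cd := deconcat_sym dc.
Variables (B1 B2 : {vspace A}).
Hypotheses (hB1 : cborel chi e ord V1 B1) (hB2 : cborel chi e ord V2 B2).
Notation B := (B1 + B2)%VS.
Notation N := (nradv chi B).
Notation N1 := (nradv chi B1).
Notation N2 := (nradv chi B2).
Notation AN := (({:A} * N)%VS).

Hypothesis so :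
  [/\ forall a, a * ev = chv a *: ev, sink_condition V1 V2 B2 AN & sink_condition V2 V1 B1 AN]
  \/ (forall a, ev * a = chv a *: ev).

Let so' : (forall a, a * ev = chv a *: ev) \/ (forall a, ev * a = chv a *: ev).
Proof. by case: so => [[h _ _]|h]; [left|right]. Qed.

Lemma side_cases i k :
  [\/ i \in V1 /\ k \in V1, i \in V2 /\ k \in V2 | forall a, e k * a * e i = 0].
Proof.
case: (in_sides dc i) (in_sides dc k) => [->|[i1 iv]|[i2 iv]] [->|[k1 kv]|[k2 kv]];
  rewrite ?(dc_v1 dc) ?(dc_v1 cd); try by [constructor 1|constructor 2].
- by constructor 3 => a; have [] := dc_zero dc a i1 iv k2 kv.
- by constructor 3 => a; have [] := dc_zero dc a k1 kv i2 iv.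
Qed.

Lemma glue_triT n i k : n \in N -> e k * n * e i != 0 -> sord ord i k.
Proof.
move=> hn h; case: (side_cases i k) => [[i1 k1]|[i2 k2]|z].
- exact: (glue_tri dc hB1 hB2 hn i1 k1 h).
- by apply: (glue_tri cd hB2 hB1 (n := n) _ i2 k2 h); rewrite addvC.
- by rewrite z eqxx in h.
Qed.

Lemma glue_stdT i k a : ~~ ord k i -> e k * a * e i \in AN.
Proof.
move=> nki; case: (side_cases i k) => [[i1 k1]|[i2 k2]|z].
- exact: (glue_std B2 hB1 a i1 k1 nki).
- by rewrite addvC; apply: (glue_std B1 hB2 a i2 k2 nki).
- by rewrite z mem0v.
Qed.

Lemma glue_cborel : cborel chi e ord setT B.
Proof.
have socle2 := glue_socle cd hB2 hB1 so'.
have AT : cornerv e setT = {:A}%VS by apply: (cornerT ef).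
rewrite addvC in socle2.
split; rewrite /cradv ?AT.
- move=> i _; have [i1|i1] := boolP (i \in V1); first exact/B1sub/(cb_idem hB1).
  by have [i2 _] := dc_notin1 dc i1; rewrite addvC; apply/B1sub/(cb_idem hB2).
- by rewrite subvf.
- move=> x y; exact: (B_mul dc hB1 hB2).
- by move=> n i k hn _ _; apply: glue_triT.
- have [s [s1 s2 s3]] := glue_dual dc hB1 hB2 so'.
  by exists s; split=> [p ps a _|p ps a b _ hb|a _]; [exact: s1|exact: s2|exact: s3].
- by move=> i k a _ _ nki _; apply: glue_stdT.
- move=> j x _ _ xe hx n hn; case: (in_sides dc j) => [jv|[j1 jv]|[j2 jv]].
  (* At a sink the column at v is K e_v, killed by radical elements. At a source each side
     contributes its own part of n. *)
  + rewrite jv in xe hx; case: so => [[sk _ _]|sc].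
      by rewrite -xe sk -scalerAr sk ((NP B1 B2 n).1 hn).2 scale0r scaler0 mem0v.
    have h2 := source_socle cd hB2 hB1 sc (x := x); rewrite addvC in h2.
    rewrite (N_split dc hn) mulrDl rpredD //.
      exact: (source_socle dc hB1 hB2 sc xe hx (N_c1 dc hB1 hB2 hn)).
    apply: h2 => //; apply: (N_c1 cd hB2 hB1); rewrite (addvC B2); exact: hn.
  + exact: (glue_socle dc hB1 hB2 so' j1 jv xe hx hn).
  + exact: (socle2 j x j2 jv xe hx n hn).
move=> i j phi _ _ phie' phib.
have phie n : n \in N -> n * e i = n -> phi n * e j = phi n.
  by move=> hn ne; have [] := phie' n hn ne.
suff [x [xe hx]] : exists x, [/\ x * e j = x & forall n, n \in N -> n * e i = n ->
       exists c : K, phi n - n * x - c *: e j \in AN].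
  by exists x; split=> //; rewrite memvf.
move: phie phib {phie'} => phie phib.
case: so => [[sk s12 s21]|sc].
  have b2 := @glue_baer_sink _ _ cd _ _ hB2 hB1 i j phi sk.
  rewrite addvC in b2.
  case: (in_sides dc j) => [jv|[j1 jv]|[j2 jv]].
  - rewrite jv in phie phib *; exists 0; split=> [|n hn ne]; first exact: mul0r.
    by exists (chv (phi n)); rewrite mulr0 subr0 -{1}(phie n hn ne) sk subrr mem0v.
  - exact: (glue_baer_sink dc hB1 hB2 sk s12 j1 jv phie phib).
  - exact: (b2 s21 j2 jv phie phib).
have b2 := @glue_baer_source_all _ _ cd _ _ hB2 hB1 i j phi sc.
rewrite addvC in b2.
case: (in_sides dc i) => [iv|[i1 iv]|[i2 iv]].
(* An element n of N e_v may have parts on both sides; each requires a constant only, and the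
   constants add up. *)
- rewrite iv in phie phib *; exists 0; split=> [|n hn ne]; first exact: mul0r.
  have v2 := @glue_baer_source_v _ _ cd _ _ hB2 hB1 j phi sc.
  rewrite addvC in v2.
  have p1 (V1' V2' : {set I}) (dc' : deconcat V1' V2') : eset e V1' * n * eset e V1' * ev = eset e V1' * n * eset e V1'.
    by rewrite -mulrA (E1v dc') -ne -!mulrA (vE1 dc') (eii ef).
  have [c hc] := glue_baer_source_v dc hB1 hB2 sc phie phib (N_c1 dc hB1 hB2 hn) (p1 _ _ dc).
  have hn2 : n \in nradv chi (B2 + B1) by rewrite addvC.
  have [d hd] := v2 phie phib _ (N_c1 cd hB2 hB1 hn2) (p1 _ _ cd).
  exists (c + d); rewrite mulr0 subr0 {1}(N_split dc hn) linearD /= scalerDl opprD addrACA.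
  exact: rpredD.
- exact: (glue_baer_source_all dc hB1 hB2 sc i1 iv phie phib).
- exact: (b2 i2 iv phie phib).
Qed.
End Final.
End Glue.

(** * Lifting idempotents and comparing Borel subalgebras *)

Section LiftIdempotents.
Variable K : fieldType.

(* Iterating [y |-> 3 y^2 - 2 y^3] from [x] makes [y^2 - y] divisible by high
   powers of [x^2 - x]. *)
Lemma idem_iter (R : comNzRingType) (x : R) n : exists y q t s : R,
  [/\ y = x * q, y - x = (x ^+ 2 - x) * t & y ^+ 2 - y = (x ^+ 2 - x) ^+ n.+1 * s].
Proof.
elim: n => [|n [y [q [t [s [yq yt ys]]]]]].
  by exists x, 1, 0, 1; split; rewrite ?mulr1 // subrr mulr0.
set r := x ^+ 2 - x in yt ys *; exists (3 * y ^+ 2 - 2 * y ^+ 3).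
exists (3 * y * q - 2 * y ^+ 2 * q), (t + r ^+ n * s * (1 - 2 * y)).
exists (r ^+ n * s ^+ 2 * (4 * (y ^+ 2 - y) - 3)); split.
- have -> : x * (3 * y * q - 2 * y ^+ 2 * q) = 3 * y * (x * q) - 2 * y ^+ 2 * (x * q) by ring.
  by rewrite -yq; ring.
- have -> : 3 * y ^+ 2 - 2 * y ^+ 3 - x = (y - x) + (y ^+ 2 - y) * (1 - 2 * y) by ring.
  by rewrite yt ys exprS; ring.
- set z := 3 * y ^+ 2 - _.
  have -> : z ^+ 2 - z = (y ^+ 2 - y) * (y ^+ 2 - y) * (4 * (y ^+ 2 - y) - 3) by rewrite /z; ring.
  rewrite {1 2}ys !exprS -!exprS [r ^+ n.+2]exprS [r ^+ n.+1]exprS; ring.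
Qed.

Variables (A : falgType K) (I : finType).
Variable chi : I -> {linear A -> K^o}.
Hypothesis sb : split_basic chi.

(** The iteration takes place in K[X] and is evaluated at a. The factor q places f in both a A and A
    a, which carries orthogonality relations from a over to f. *)
Lemma lift_idem a : in_rad chi (a * a - a) -> exists f q : A,
  [/\ f = a * q, f = q * a, in_rad chi (f - a) & f * f = f].
Proof.
move=> ra; have [m hm] := rad_expr sb.
have [F [Q [T [S [FQ FT FS]]]]] := idem_iter ('X : {poly K}) m.
have [h hX] : exists h : {rmorphism {poly K} -> A}, h 'X = a.
  by exists (horner_alg a); apply: horner_algX.
exists (h F), (h Q); split.
- by rewrite FQ rmorphM hX.
- by rewrite FQ mulrC rmorphM hX.
- rewrite -hX -rmorphB /= FT rmorphM /= rmorphB rmorphXn /= hX.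
  by apply: (in_radMr sb); rewrite expr2.
- apply/eqP; rewrite -subr_eq0 -expr2 -rmorphXn -rmorphB /= FS rmorphM rmorphXn /=.
  by rewrite rmorphB rmorphXn /= hX expr2 exprS hm // mulr0 mul0r.
Qed.

Lemma rad_idem0 x : in_rad chi x -> x * x = x -> x = 0.
Proof.
have [m hm] := rad_expr sb; move=> rx xx.
have h n : x = x * x ^+ n.
  by elim: n => [|n IH]; rewrite ?expr0 ?mulr1 // exprS mulrA xx -IH.
by rewrite (h m) hm // mulr0.
Qed.

(** Separated characters give elements with prescribed values. The idempotents are lifted one at a
    time inside g A g, with g complementary to those already found; in the end 1 minus their sum is
    a radical idempotent, hence 0. *)
Lemma idem_family_exists :
  (forall i j, i != j -> exists a, chi i a <> chi j a) -> exists e, idem_family chi e.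
Proof.
move=> sep.
have sep1 i j : i != j -> exists a, chi i a = 1 :> K /\ chi j a = 0 :> K.
  move=> ij; have [a ha] := sep i j ij.
  have d0 : (chi i a : K) - chi j a != 0 by rewrite subr_eq0; apply/eqP.
  exists (((chi i a : K) - chi j a)^-1 *: (a - (chi j a : K)%:A)).
  by rewrite !(chiZ chi) !linearB /= !(chi_scalar sb) subrr mulr0 mulVf.
have point i : exists b, forall k, chi k b = (k == i)%:R :> K.
  have [b [b1 b2]] : exists b, chi i b = 1 :> K /\
      forall k, k \in enum I -> k != i -> chi k b = 0 :> K.
    elim: (enum I) => [|k s [b [b1 b2]]]; first by exists 1; split=> //; exact: (chi1 sb).
    have [->|ki] := eqVneq k i.
      by exists b; split=> // k'; rewrite inE => /orP [/eqP ->|]; [rewrite eqxx|exact: b2].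
    have [|c [c1 c2]] := sep1 i k; first by rewrite eq_sym.
    exists (c * b); rewrite (chiM sb) c1 b1 mul1r; split=> // k'.
    by rewrite inE (chiM sb) => /orP [/eqP ->|k's] k'i; rewrite ?c2 ?mul0r // b2 // mulr0.
  exists b => k; have [->|ki] := eqVneq k i; first exact: b1.
  by apply: b2; rewrite ?mem_enum.
have [e [e1 e2]] : exists e : I -> A,
    (forall i k, i \in enum I -> chi k (e i) = (k == i)%:R :> K) /\
    forall i j, i \in enum I -> j \in enum I -> e i * e j = if i == j then e i else 0.
  elim: (enum I) (enum_uniq I) => [_|i s IH /andP [is_ us]]; first by exists (fun => 0).
  have [e [e1 e2]] := IH us; pose g := 1 - \sum_(j <- s) e j.
  have ge j : j \in s -> g * e j = 0 /\ e j * g = 0.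
    move=> js; have d k : k \in s -> e k * e j = (if k == j then e j else 0) /\
        e j * e k = (if k == j then e j else 0).
      by move=> ks; rewrite !e2 // [j == k]eq_sym; case: eqP => [->|].
    have m : (\sum_(k <- s) if k == j then e j else 0) = e j.
      by rewrite -big_mkcond (big_rem j) //= eqxx big_seq_cond big1 ?addr0 // => k;
        rewrite mem_rem_uniq // inE => /andP [/andP [/negbTE ->]].
    rewrite mulrBl mulrBr mul1r mulr1 mulr_suml mulr_sumr.
    by split; rewrite -[X in X - _]m -sumrB big_seq big1 // => k /d [d1 d2]; rewrite (d1, d2) subrr.
  have [b hb] := point i.
  have chig k : chi k (g * b * g) = (k == i)%:R :> K.
    rewrite !(chiM sb) hb; have [->|ki] := eqVneq k i; last by rewrite mulr0 mul0r.
    rewrite linearB /= (chi1 sb) linear_sum /= big_seq big1 ?subr0 ?mulr1 // => j js.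
    by rewrite e1 //; case: eqP => // ij; rewrite ij js in is_.
  have [|f [q [f1 f2 f3 f4]]] := @lift_idem (g * b * g).
    by move=> k; rewrite linearB /= (chiM sb) chig; case: (k == i); rewrite ?mulr1 ?mulr0 subrr.
  have chif k : chi k f = (k == i)%:R :> K.
    by rewrite -chig; apply/eqP; rewrite -subr_eq0 -linearB; apply/eqP/f3.
  have fe j : j \in s -> f * e j = 0 /\ e j * f = 0.
    move=> js; have [h1 h2] := ge j js.
    by rewrite {1}f2 f1 -!mulrA h1 !mulr0 !mulrA h2 !mul0r.
  exists (fun j => if j == i then f else e j); split.
    move=> j k; rewrite inE; case: (eqVneq j i) => [->|ji] /=; first by rewrite chif.
    by move=> js; rewrite e1.
  move=> j k; rewrite !inE.
  case: (eqVneq j i) => [->|ji] /=; case: (eqVneq k i) => [->|ki] //=.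
  - by move=> _ ks; rewrite (fe k ks).1.
  - by move=> js _; rewrite (fe j js).2 (negbTE ji).
  - exact: e2.
exists e; split.
- by move=> i j; rewrite e1 ?mem_enum.
- by move=> i j; rewrite e2 ?mem_enum.
apply/eqP; rewrite eq_sym -subr_eq0; apply/eqP/rad_idem0 => [k|].
  rewrite linearB /= (chi1 sb) linear_sum /= (bigD1 k) //= e1 ?mem_enum // eqxx.
  rewrite big1 ?addr0 ?subrr // => i ik; by rewrite e1 ?mem_enum // eq_sym (negbTE ik).
have ss : (\sum_i e i) * (\sum_i e i) = \sum_i e i.
  rewrite mulr_suml; apply: eq_bigr => i _; rewrite mulr_sumr (bigD1 i) //= e2 ?mem_enum //.
  rewrite eqxx big1 ?addr0 // => j ji; by rewrite e2 ?mem_enum // eq_sym (negbTE ji).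
by rewrite mulrBl mul1r mulrBr mulr1 ss subrr subr0.
Qed.
End LiftIdempotents.

Section BorelIdempotents.
Variables (K : fieldType) (A : falgType K) (I : finType).
Variable chi : I -> {linear A -> K^o}.
Hypothesis sb : split_basic chi.
Variables (e : I -> A) (ef : idem_family chi e).
Variables (L : I -> lmodType A) (ord : rel I).
Hypothesis hL : forall i, exists u : L i, char_module (chi i) u.

(** The L_B(i) are pairwise non-isomorphic, so the characters stay distinct on the subalgebra and
    idempotents can be lifted inside it. *)
Lemma borel_idem (U : {vspace A}) : regular_exact_Borel L ord U ->
  exists2 f, idem_family chi f & forall i, f i \in U.
Proof.
case=> B <- [B1 [LB [[LBs LBi _] [_ LBst] _ LBstd _]]].
have LBc := borel_simple_char sb B1 hL ef LBs LBstd.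
have [i j ij|f hf] := idem_family_exists (split_basicB sb B1).
  apply: contrapT => no; move/eqP: ij; apply; apply: LBi.
  have [u hu] := LBc i; have [w hw] := LBc j.
  apply: (char_module_isom hu); apply: char_module_ext hw _ => a.
  by apply: contrapT => h; apply: no; exists a => /esym.
exists (fun i => vsval (f i)) => [|i]; last exact: subvsP.
split=> [i j|i j|]; first exact: (if_chi hf i j).
  by have /(congr1 val) /= := if_orth hf i j; rewrite (fun_if val).
by have /(congr1 val) := if_sum hf; rewrite linear_sum => /= ->; exact: vsval1.
Qed.
End BorelIdempotents.

Section Ideal.
Variables (K : fieldType) (A : falgType K) (I : finType).
Variable chi : I -> {linear A -> K^o}.
Hypothesis sb : split_basic chi.
Variable ord : rel I.
Hypothesis hord : partial_order ord.

(* the trace ideal of the projectives [A e_k], [k] not below [i] *)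
Definition upper_ideal (e : I -> A) i : {vspace A} :=
  (\sum_(k | ~~ ord k i) ({:A} * <[e k]> * {:A}))%VS.

Lemma upper_ideal_sandwich (e : I -> A) i k a b :
  ~~ ord k i -> a * e k * b \in upper_ideal e i.
Proof.
move=> nki; apply: subvP (sumv_sup k nki (subvv _)) _ _.
by rewrite !memv_mul ?memvf ?memv_line.
Qed.

Lemma upper_ideal_ind (e : I -> A) i (P : A -> Prop) :
  P 0 -> (forall x y, P x -> P y -> P (x + y)) -> (forall (c : K) x, P x -> P (c *: x)) ->
  (forall k a b, ~~ ord k i -> P (a * e k * b)) -> forall x, x \in upper_ideal e i -> P x.
Proof.
move=> P0 PD PZ Pk x /memv_sumP [y hy ->]; elim/big_ind: _ => // k nki.
move: (hy k nki); move: (y k); apply: prodv_ind => // u b hu _.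
move: u hu; apply: prodv_ind => [|u w hu hw|c u hu|a _ _ /vlineP [c ->]].
- by rewrite mul0r.
- by rewrite mulrDl; apply: PD.
- by rewrite -scalerAl; apply: PZ.
- by rewrite -scalerAr -scalerAl; apply/PZ/Pk.
Qed.

Lemma upper_idealM (e : I -> A) i a x b : x \in upper_ideal e i -> a * x * b \in upper_ideal e i.
Proof.
move: x; apply: upper_ideal_ind => [|x y hx hy|c x hx|k a' b' nki].
- by rewrite mulr0 mul0r mem0v.
- by rewrite mulrDr mulrDl rpredD.
- by rewrite -scalerAr -scalerAl rpredZ.
- by rewrite !mulrA -[_ * b' * b]mulrA; apply: upper_ideal_sandwich.
Qed.

Section Families.
Variables (e f : I -> A) (ef : idem_family chi e) (ff : idem_family chi f).

Lemma idem_rad i : in_rad chi (e i - e i * f i * e i).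
Proof.
move=> k; rewrite linearB /= !(chiM sb) !(if_chi ef) (if_chi ff).
by case: (k == i); rewrite ?mulr1 ?mulr0 subrr.
Qed.

(** The families have the same characters, so e_i f_i e_i is a unit of e_i A e_i. Hence e_i lies in
    the ideal generated by f_i. *)
Lemma idem_sandwich i : exists u w, e i = u * e i * f i * e i /\ e i = e i * f i * e i * w.
Proof.
have [u [u1 u2]] := unit_1Brad sb (idem_rad i).
have eq1 : (1 - (e i - e i * f i * e i)) * e i = e i * f i * e i.
  by rewrite mulrBl mul1r mulrBl -!mulrA (eii ef) !mulrA subKr.
have eq2 : e i * (1 - (e i - e i * f i * e i)) = e i * f i * e i.
  by rewrite mulrBr mulr1 mulrBr !mulrA (eii ef) subKr.
exists u, u; split.
  by rewrite -2!mulrA (mulrA (e i)) -eq1 mulrA u1 mul1r.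
by rewrite -eq2 -mulrA u2 mulr1.
Qed.

Lemma upper_ideal_sub i x : x \in upper_ideal e i -> x \in upper_ideal f i.
Proof.
move: x; apply: upper_ideal_ind => [|x y|c x|k a b nki]; first exact: mem0v.
- exact: rpredD.
- exact: rpredZ.
have [u [_ [-> _]]] := idem_sandwich k.
have -> : a * (u * e k * f k * e k) * b = a * u * e k * f k * (e k * b) by rewrite !mulrA.
exact: upper_ideal_sandwich.
Qed.
End Families.

(* Since [upper_ideal] does not depend on the family of idempotents, this allows
   comparing [A B_rad] for two Borel subalgebras [B]. *)
Lemma upper_ideal_rad (e : I -> A) (ef : idem_family chi e) (N : {vspace A}) :
  (forall n i k, n \in N -> e k * n * e i != 0 -> sord ord i k) ->
  (forall i k a, ~~ ord k i -> e k * a * e i \in ({:A} * N)%VS) ->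
  forall i x, x * e i = x -> (x \in upper_ideal e i <-> x \in ({:A} * N)%VS).
Proof.
move=> tri std i x xe; split=> hx; rewrite -xe.
  move: x hx {xe}; apply: upper_ideal_ind => [|x y hx hy|c x hx|k a b nki].
  - by rewrite mul0r mem0v.
  - by rewrite mulrDl rpredD.
  - by rewrite -scalerAl rpredZ.
  - have := std i k b nki; rewrite -!mulrA; move: (e k * _) => z.
    by move=> hz; have := memv_mul (memvf a) hz; rewrite prodvA; apply: subvP; apply: prodvSl; apply: subvf.
move: x hx {xe}; apply: prodv_ind => [|x y hx hy|c x hx|a n _ hn].
- by rewrite mul0r mem0v.
- by rewrite mulrDl rpredD.
- by rewrite -scalerAl rpredZ.
rewrite -mulrA {1}(sum_el ef (n * e i)) mulr_sumr; apply: rpred_sum => k _.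
have [z|nz] := eqVneq (e k * n * e i) 0.
  by rewrite [e k * _]mulrA z mulr0 mem0v.
have /andP [ik oik] := tri n i k hn nz; rewrite mulrA; apply: upper_ideal_sandwich.
by apply: contra ik => oki; case: hord => _ anti _; apply/eqP/anti; rewrite oik.
Qed.
End Ideal.

(** * Exclusion of the obstruction at a sink *)

Section SinkCondition.
Variables (K : fieldType) (A : falgType K) (I : finType).
Variable chi : I -> {linear A -> K^o}.
Hypothesis sb : split_basic chi.
Variables (e : I -> A) (ef : idem_family chi e).
Variable (ord : rel I).
Hypothesis hord : partial_order ord.
Variable v : I.
Notation ev := (e v).
Notation chv a := (chi v a : K).

Lemma nilp_right (N U : {vspace A}) : (N <= radv chi)%VS -> (U <= U * N)%VS -> U = 0%VS.
Proof.
move=> hN h; have [m hm] := rad_expv sb hN; apply/eqP; rewrite -subv0.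
have H k : (U <= U * N ^+ k)%VS.
  elim: k => [|k IH]; first by rewrite expv0 prodv1.
  by rewrite expvSl prodvA; apply: subv_trans IH _; apply: prodvSl.
by have := H m; rewrite hm prodv0.
Qed.

Lemma lfun_intro (g : A -> A) : linear g -> exists phi : 'End(A), forall x, phi x = g x.
Proof.
move=> gl; pose h : {linear A -> A} := HB.pack g (GRing.isLinear.Build _ _ _ _ g gl).
by exists (linfun h) => x; rewrite lfunE.
Qed.

Section Functional.
Variables (V1 V2 : {set I}).
Hypothesis dc : deconcat chi e v V1 V2.
Let cd := deconcat_sym dc.
Variables (B1 B2 : {vspace A}).
Hypotheses (hB1 : cborel chi e ord V1 B1) (hB2 : cborel chi e ord V2 B2).
Notation B := (B1 + B2)%VS.
Notation N := (nradv chi B).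
Notation N1 := (nradv chi B1).
Notation AN := (({:A} * N)%VS).
Notation E1 := (eset e V1).
Hypothesis so : forall a, a * ev = chv a *: ev.

Lemma top_functional : (exists2 n, n \in N1 & ev * n != 0) ->
  exists i n (xi : {linear A -> K^o}), [/\ i \in V1, i != v, n \in N1, n * e i = n
    & xi n != 0 /\ forall b m, b \in B1 -> m \in N1 -> xi (b * m) = (chv b) * xi m :> K].
Proof.
move=> [n hn evn]; have vB : ev \in B1 := ev1 dc hB1.
have [i [m [hm hmi]]] : exists i m, m \in N1 /\ ev * m * e i \notin (N1 * N1)%VS.
  apply: contrapT => no; have NN m : m \in N1 -> ev * m \in (N1 * N1)%VS.
    move=> hm; rewrite (sum_er ef (ev * m)); apply: rpred_sum => i _.
    by apply/negPn/negP => h; apply: no; exists i, m.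
  suff z : (<[ev]> * N1)%VS = 0%VS.
    by move/eqP: evn; apply; apply/eqP; rewrite -memv0 -z memv_mul ?memv_line.
  apply: (@nilp_right N1); first exact: capvSr.
  apply/prodvP => _ m /vlineP [c ->] hm; rewrite -scalerAl rpredZ // -prodvA.
  have -> : ev * m = ev * (ev * m) by rewrite mulrA (eii ef).
  by rewrite memv_mul ?memv_line ?NN.
have BM x y : x \in B1 -> y \in B1 -> x * y \in B1 by exact: (cb_mul hB1).
have NMl x y : x \in B1 -> y \in N1 -> x * y \in N1.
  move=> hx /N1P [yB ry]; apply/N1P; split; [exact: BM|exact: (in_radMl sb)].
have NMr x y : x \in N1 -> y \in B1 -> x * y \in N1.
  move=> /N1P [xB rx] hy; apply/N1P; split; [exact: BM|exact: (in_radMr sb)].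
have i1 : i \in V1.
  apply: contraNT hmi => i1; rewrite -mulrA -(N1E1 ef hB1 hm) -(mulrA m) (eset_el ef).
  by rewrite (negbTE i1) !mulr0 mem0v.
have iv : i != v.
  apply: contraNneq hmi => ->; rewrite -mulrA so ((N1P chi B1 m).1 hm).2 scale0r mulr0.
  exact: mem0v.
set n0 := ev * m * e i in hmi.
have n0N : n0 \in N1 by apply: NMr (cb_idem hB1 i1); apply: NMl.
have evn0 : ev * n0 = n0 by rewrite /n0 !mulrA (eii ef).
have [xi xin0 xiW] : exists2 xi : {linear A -> K^o}, xi n0 != 0
    & forall y, y \in (N1 * N1 + <[1 - ev]> * N1)%VS -> xi y = 0.
  apply: exists_functional; apply: contraNN hmi => /memv_addP [w hw [z hz nE]].
  have -> : n0 = ev * w.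
    have evz : ev * z = 0.
      move: z hz {nE}; apply: prodv_ind => [|x y hx hy|c x hx|_ y /vlineP [c ->] _].
      - exact: mulr0.
      - by rewrite mulrDr hx hy addr0.
      - by rewrite -scalerAr hx scaler0.
      - by rewrite mulrA -scalerAr mulrBr mulr1 (eii ef) subrr scaler0 mul0r.
    by rewrite -evn0 nE mulrDr evz addr0.
  move: w hw {nE}; apply: prodv_ind => [|x y hx hy|c x hx|x y hx hy].
  - by rewrite mulr0 mem0v.
  - by rewrite mulrDr rpredD.
  - by rewrite -scalerAr rpredZ.
  - by rewrite mulrA memv_mul ?NMl.
exists i, n0, xi; split=> //; first by rewrite /n0 -!mulrA (eii ef).
split=> // b p hb hp.
have xie q : q \in N1 -> xi q = xi (ev * q) :> K.
  move=> hq; apply/eqP; rewrite -subr_eq0 -linearB; apply/eqP/xiW.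
  rewrite -[X in X - _]mul1r -mulrBl; apply: subvP (addvSr _ _) _ _.
  by rewrite memv_mul ?memv_line.
have hev : ev * b = (chv b) *: ev + (ev * b - (chv b) *: ev) by rewrite addrC subrK.
rewrite xie ?NMl // mulrA hev mulrDl linearD /= [X in _ + X]xiW ?addr0; last first.
  apply: subvP (addvSl _ _) _ _; apply: memv_mul => //; apply/N1P; split.
    by rewrite rpredB ?rpredZ ?BM.
  exact: (rad_partl sb ef).
by rewrite -scalerAl linearZ /= -xie.
Qed.

(** This induces the map of [top_functional] to an A-map from A N e_i to the simple A-module at v.
    The dual basis writes w as the sum of the p.1 p.2(w), which dictates the formula for [th]. *)
Lemma sink_functional : (exists2 n, n \in N1 & ev * n != 0) ->
  exists i (th : {linear A -> K^o}), [/\ i \in V1, i != v,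
    exists n, [/\ n \in AN, n * e i = n & th n != 0]
    & forall a w, w \in AN -> w * e i = w -> th (a * w) = chv a * th w :> K].
Proof.
move=> h; have [i [n [xi [i1 iv hn ne [xin xiM]]]]] := top_functional h.
have [s [s1 s2 s3]] := cb_dual hB1.
pose th (w : A) : K := \sum_(p <- s) chv p.1 * xi (p.2 w).
have thl : linear (th : A -> K^o).
  move=> c x y; rewrite /th scaler_sumr -big_split; apply: eq_bigr => p _ /=.
  by rewrite !linearP mulrDr mulrCA.
pose TH : {linear A -> K^o} := HB.pack (th : A -> K^o) (GRing.isLinear.Build _ _ _ _ _ thl).
have thN a m : E1 * a * E1 = a -> m \in N1 -> th (a * m) = chv a * xi m.
  move=> ha hm; have ca := (memv_corner ef V1 a).2 ha; have [mB _] := (N1P chi B1 m).1 hm.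
  have -> : th (a * m) = \sum_(p <- s) chv p.1 * chv (p.2 a) * xi m.
    rewrite /th big_seq [RHS]big_seq; apply: eq_bigr => p ps.
    rewrite s2 //.
    have hx := xiM (p.2 a) m (s1 p ps a ca) hm.
    by apply: etrans (congr1 (fun z => chv p.1 * z) hx) _; rewrite mulrA.
  rewrite -mulr_suml; congr (_ * _); rewrite [in RHS](s3 a ca) linear_sum.
  by apply: eq_bigr => p _; rewrite (chiM sb).
have thC a w : E1 * a * E1 = a -> w \in cradv chi e V1 B1 -> th (a * w) = chv a * th w.
  move=> ha; move: w; apply: prodv_ind => [|x y hx hy|c x hx|u w /(memv_corner ef) hu hw].
  - by rewrite mulr0 -[th 0]/(TH 0) linear0 mulr0.
  - by rewrite mulrDr -![th (_ + _)]/(TH (_ + _)) !linearD /= hx hy mulrDr.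
  - rewrite -scalerAr -![th (_ *: _)]/(TH (_ *: _)) !linearZ /= hx; exact: mulrCA.
  - have hau : E1 * (a * u) * E1 = a * u by rewrite (c1_mul sb ef dc) ha hu.
    by rewrite mulrA !thN // (chiM sb) mulrA.
have E1E : E1 * E1 * E1 = E1 by rewrite !(eset_id ef).
exists i, TH; split=> //.
  exists n; split=> //; first exact/N_AN/(N1N B2).
  rewrite -(E1N1 ef hB1 hn) [TH _]thN // (chi_eset ef) (dc_v1 dc) mul1r.
  exact: xin.
move=> a w hw we.
have cw : E1 * w * E1 = w := col1 ef dc i1 iv we.
have cc : E1 * (E1 * a * E1) * E1 = E1 * a * E1.
  by rewrite !mulrA (eset_id ef) -mulrA (eset_id ef).
have -> : a * w = (E1 * a * E1) * w.
  have aw : a * w * e i = a * w by rewrite -mulrA we.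
  by rewrite -{1}(col1 ef dc i1 iv aw) (c1_mul sb ef dc) cw.
rewrite [TH _]thC //; first by rewrite (chv_c1 sb ef dc).
by rewrite -cw; apply: (AN_c1 sb ef dc hB1 hB2).
Qed.
End Functional.

Section Condition.
Variables (V1 V2 : {set I}).
Hypothesis dc : deconcat chi e v V1 V2.
Let cd := deconcat_sym dc.
Variables (B1 B2 : {vspace A}).
Hypotheses (hB1 : cborel chi e ord V1 B1) (hB2 : cborel chi e ord V2 B2).
Notation B := (B1 + B2)%VS.
Notation N := (nradv chi B).
Notation AN := (({:A} * N)%VS).
Hypothesis so : forall a, a * ev = chv a *: ev.
Variables (f : I -> A) (ff : idem_family chi f).
Variable B' : {vspace A}.
Hypothesis hB' : cborel chi f ord setT B'.
Notation N' := (nradv chi B').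
Notation AN' := (({:A} * N')%VS).

Lemma upper_AN i x : x * e i = x -> (x \in upper_ideal ord e i <-> x \in AN).
Proof.
apply: (upper_ideal_rad hord ef) => [n i' k|i' k a].
  exact: (glue_triT sb ef dc hB1 hB2).
exact: (glue_stdT ef dc hB1 hB2).
Qed.

Lemma upper_AN' i x : x * f i = x -> (x \in upper_ideal ord f i <-> x \in AN').
Proof.
apply: (upper_ideal_rad hord ff) => [n i' k hn|i' k a nki].
  by apply: (cb_tri hB' hn); rewrite inE.
have := cb_std hB' (in_setT i') (in_setT k) nki; rewrite /cradv (cornerT ff); apply.
exact: memvf.
Qed.

Lemma upper_ef i x : x \in upper_ideal ord e i <-> x \in upper_ideal ord f i.
Proof. by split; apply: (upper_ideal_sub sb). Qed.

(** If e_v N2 is nonzero and y in e_v A e_j lies outside A N, then m |-> th(m e_i) y f_j is a B'-map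
    through the simple module at v. By Baer's criterion for B' it is m |-> m x up to f_j and A N',
    but f_i A f_j = 0; so [th] vanishes on all of A N e_i, a contradiction. *)
Lemma sink_conditionP : sink_condition chi e v V1 V2 B2 AN.
Proof.
move=> j j1 jv.
have [h|no] := pselect (exists2 n, n \in nradv chi B2 & ev * n != 0); last first.
  by left=> n hn; apply/eqP/negPn/negP => h; apply: no; exists n.
right=> a; apply/negPn/negP => hy; set y := ev * a * e j in hy.
have [i [th [i2 iv [n0 [hn0 n0e thn0]] thM]]] := sink_functional cd hB2 hB1 so h.
rewrite addvC in hn0 thM.
have ye : y * e j = y by rewrite /y -mulrA (eii ef).
have evy : ev * y = y by rewrite /y !mulrA (eii ef).
clearbody y.
have yf : y * f j \notin AN'.
  apply: contra hy => hyf; apply/(upper_AN ye)/upper_ef.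
  have : y * f j \in upper_ideal ord f j.
    by apply/upper_AN'; rewrite // -mulrA (eii ff).
  have [_ [w [_ ew]]] := idem_sandwich sb ef ff j.
  move=> /(upper_idealM 1 (e j * w)); rewrite mul1r.
  suff -> : y * f j * (e j * w) = y by [].
  by rewrite -[RHS]ye {2}ew !mulrA ye.
have AN_col m : m \in AN' -> m * f i = m -> m * e i \in AN /\ m * e i * e i = m * e i.
  move=> hm me; have h2 : m * e i * e i = m * e i by rewrite -mulrA (eii ef).
  split=> //; apply/(upper_AN h2)/upper_ef; rewrite -[m]mul1r; apply: upper_idealM.
  exact/upper_AN'.
have [phi phiE] : exists phi : 'End(A), forall m, phi m = (th (m * e i) : K) *: (y * f j).
  apply: lfun_intro => c x z.
  by rewrite mulrDl -scalerAl linearP scalerDl scalerA.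
have N'AN m : m \in N' -> m \in AN' by move=> hm; rewrite -[m]mul1r memv_mul ?memvf.
have by_ b : b * (y * f j) = chv b *: (y * f j).
  by rewrite -{1}evy !mulrA so -!scalerAl evy.
have fAf x : f i * x * f j = 0.
  have [_ [w [_ fi]]] := idem_sandwich sb ff ef i.
  have [u [_ [fj _]]] := idem_sandwich sb ff ef j.
  have z := (dc_zero dc (f i * w * x * u * f j) j1 jv i2 iv).1.
  have -> : f i * x * f j = f i * (e i * (f i * w * x * u * f j) * e j) * f j.
    by rewrite {1}fi {1}fj !mulrA.
  by rewrite z mulr0 mul0r.
have [|m b hm me hb|x [_ xe hx]] := cb_baer hB' (in_setT i) (in_setT j) (phi := phi).
- move=> m hm me; rewrite (cornerT ff) memvf; split=> //.
  by rewrite phiE -scalerAl -mulrA (eii ff).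
- have [h1 h2] := AN_col m (N'AN m hm) me.
  exists 0; rewrite scale0r subr0 !phiE -mulrA thM // -scalerAr by_ scalerA.
  by rewrite mulrC subrr mem0v.
have th0 m : m \in N' -> m * f i = m -> th (m * e i) = 0.
  move=> hm me; have [c] := hx m hm me.
  have -> : m * x = 0 by rewrite -{1}me -{1}xe -!mulrA (mulrA _ x) fAf mulr0.
  rewrite subr0 /cradv (cornerT ff) => hc.
  (* The character at j detects c: it vanishes on A N' and on y = e_v y, since j is not v. *)
  have c0 : c = 0.
    have : chi j (phi m - c *: f j) = 0.
      move: (phi m - c *: f j) hc; apply: prodv_ind => [|u w hu hw|d u hu|u w _].
      - exact: linear0.
      - by rewrite linearD /= hu hw addr0.
      - by rewrite linearZ /= hu; exact: mulr0.
      - by move=> /(N1P chi B') [_ /(in_radMl sb u)].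
    rewrite linearB /= phiE !(chiZ chi) !(chiM sb) -{1}evy (chiM sb) (chi_en ef jv).
    by rewrite !mul0r mulr0 sub0r (chi_e ff) mulr1 => /eqP; rewrite oppr_eq0 => /eqP.
  move: hc; rewrite c0 scale0r subr0 phiE => hc; apply/eqP/negPn/negP => t0.
  move/negP: yf; apply; rewrite -[y * f j]scale1r -(mulVf t0) -scalerA.
  exact: rpredZ.
move/eqP: thn0; apply.
(* Writing n0 = z e_i with z in A N' f_i lets the vanishing on N' f_i extend to n0, as [th] is
   A-linear up to chi_v. *)
have [u [_ [ei _]]] := idem_sandwich sb ef ff i.
pose z := n0 * u * e i * f i.
have n0E : n0 = z * e i by rewrite -{1}n0e {1}ei /z !mulrA.
have zf : z * f i = z by rewrite /z -mulrA (eii ff).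
have zAN : z \in AN'.
  apply/(upper_AN' zf)/upper_ef.
  have : n0 \in upper_ideal ord e i by apply/upper_AN.
  by move=> /(upper_idealM 1 (u * e i * f i)); rewrite mul1r !mulrA.
rewrite n0E -zf; move: z zAN {zf n0E}; apply: prodv_ind => [|x1 x2 h1 h2|c x1 h1|a1 m _ hm].
- by rewrite !mul0r linear0.
- by rewrite !mulrDl linearD /= h1 h2 addr0.
- by rewrite -!scalerAl linearZ /= h1; exact: mulr0.
have mf : m * f i \in N'.
  have [mB rm] := (N1P chi B' m).1 hm; apply/N1P; split; last exact: (in_radMr sb).
  by apply: (cb_mul hB') => //; apply: (cb_idem hB'); rewrite inE.
have mff : m * f i * f i = m * f i by rewrite -mulrA (eii ff).
have [g1 g2] := AN_col _ (N'AN _ mf) mff.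
by rewrite -2!mulrA (mulrA m) thM // th0 // mulr0.
Qed.
End Condition.
End SinkCondition.

(** * Corners as vertex quotients *)

Section VertexCorner.
Variables (K : fieldType) (A : falgType K) (I : finType).
Variable chi : I -> {linear A -> K^o}.
Hypothesis sb : split_basic chi.
Variables (e : I -> A) (ef : idem_family chi e).
Variables (L : I -> lmodType A).

Lemma vertex_simple_char : vertex_simples e L -> forall i, exists u : L i, char_module (chi i) u.
Proof.
move=> hL i; have [sL [x ex]] := hL i; have [k [u hu]] := simple_char sb sL.
suff ki : i = k by exists u; move: hu; rewrite -ki.
by apply/eqP; apply: contraNT ex => ik; rewrite (char_e ef hu) (negbTE ik).
Qed.

Variable V : {set I}.
Notation E := (eset e V).
Notation c a := (E * a * E).
Hypothesis cM : forall a b, c (a * b) = c a * c b.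
Variables (A1 : falgType K) (pi : {lrmorphism A -> A1}).
Hypothesis pi_surj : forall y, exists x, pi x = y.
Hypothesis pi_ker : forall x, pi x = 0 <->
  x \in ({:A} * <<[seq e u | u in ~: V]>> * {:A})%VS.
Notation J := {i : I | i \in V}.

Lemma pi_ker_ind (P : A -> Prop) : P 0 -> (forall x y, P x -> P y -> P (x + y)) ->
  (forall (d : K) x, P x -> P (d *: x)) ->
  (forall a u b, u \notin V -> P (a * e u * b)) -> forall x, pi x = 0 -> P x.
Proof.
move=> P0 PD PZ Pu x /pi_ker; move: x; apply: prodv_ind => // z b hz _.
move: z hz; apply: prodv_ind => [|y z hy hz|d y hy|a w _ hw].
- by rewrite mul0r.
- by rewrite mulrDl; apply: PD.
- by rewrite -scalerAl; apply: PZ.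
rewrite (coord_span hw) mulr_sumr mulr_suml; elim/big_ind: _ => // k _.
rewrite -scalerAr -scalerAl; apply: PZ.
have /imageP [u uV ->] : (image e (~: V))`_k \in image e (~: V).
  by apply: mem_nth; have := ltn_ord k; rewrite ?size_tuple.
by apply: Pu; move: uV; rewrite inE.
Qed.

Lemma pi_e0 u : u \notin V -> pi (e u) = 0.
Proof.
move=> uV; apply/pi_ker; rewrite -[e u]mulr1 -[e u]mul1r.
apply: memv_mul (memvf _); apply: memv_mul (memvf _) _; apply: memv_span.
by apply: image_f; rewrite inE.
Qed.

Lemma pi_E : pi E = 1.
Proof.
have <- : pi 1 = 1 by rewrite rmorph1.
apply/eqP; rewrite eq_sym -subr_eq0 -raddfB -(if_sum ef) (bigID (mem V)) /= /eset addrAC subrr add0r.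
by rewrite raddf_sum big1 // => i /pi_e0.
Qed.

Lemma pi_M x y : pi (x * y) = pi x * pi y. Proof. exact: rmorphM. Qed.

Lemma pi_c a : pi (c a) = pi a.
Proof. by rewrite !pi_M pi_E mul1r mulr1. Qed.

(** The map a |-> E a E is multiplicative and kills e_u for u outside V, hence the ideal that
    defines [A1]. The section so obtained realises [A1] as the corner. *)
Lemma corner_section : exists s : {linear A1 -> A}, forall a, s (pi a) = c a.
Proof.
have cl : linear (fun a => c a) by move=> d x y; rewrite mulrDr mulrDl -scalerAr -scalerAl.
pose g : {linear A -> A} := HB.pack (fun a => c a) (GRing.isLinear.Build _ _ _ _ _ cl).
apply: (linear_factor (g := g) pi_surj); apply: pi_ker_ind => [|x y hx hy|d x hx|a u b uV].
- exact: linear0.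
- by rewrite linearD hx hy addr0.
- by rewrite linearZ hx; exact: scaler0.
rewrite -[LHS]/(c (a * e u * b)) !cM.
by rewrite -[X in _ * X * _]mulrA (eset_er ef) (negbTE uV) !mulr0 !mul0r.
Qed.

Lemma corner_char (j : J) : exists ch : {linear A1 -> K^o}, forall a, ch (pi a) = chi (val j) a.
Proof.
apply: (linear_factor (g := chi (val j)) pi_surj).
apply: pi_ker_ind => [|x y hx hy|d x hx|a u b uV].
- exact: linear0.
- by rewrite linearD hx hy; exact: addr0.
- by rewrite linearZ hx; exact: mulr0.
rewrite !(chiM sb) (chi_en ef) ?mulr0 ?mul0r //.
by apply: contraNneq uV => <-; exact: valP.
Qed.

Section Transfer.
Variables (s : {linear A1 -> A}) (sE : forall a, s (pi a) = c a).
Variable chi1 : J -> {linear A1 -> K^o}.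
Hypothesis chi1E : forall j a, chi1 j (pi a) = chi (val j) a.
Notation e1 := (fun j : J => pi (e (val j))).

Lemma pi_s x : pi (s x) = x.
Proof. by have [a <-] := pi_surj x; rewrite sE pi_c. Qed.

Lemma c_id a : c (c a) = c a.
Proof. by rewrite !mulrA (eset_id ef) -mulrA (eset_id ef). Qed.

Lemma c_s x : c (s x) = s x.
Proof. by have [a <-] := pi_surj x; rewrite sE c_id. Qed.

Lemma s_pi a : c a = a -> s (pi a) = a.
Proof. by rewrite sE. Qed.

Lemma sM x y : s (x * y) = s x * s y.
Proof.
have [a <-] := pi_surj x; have [b <-] := pi_surj y.
by rewrite -pi_M !sE cM.
Qed.

Lemma s_inj : injective s. Proof. exact: can_inj pi_s. Qed.

Lemma s_e (j : J) : s (pi (e (val j))) = e (val j).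
Proof.
by rewrite sE (eset_el ef) (valP j) (eset_er ef) (valP j).
Qed.

Lemma chi_s (j : J) x : chi (val j) (s x) = chi1 j x.
Proof. by rewrite -[in RHS](pi_s x) chi1E. Qed.

Lemma rad_s x : in_rad chi1 x <-> in_rad chi (s x).
Proof.
split=> h i; last by rewrite -chi_s.
have [iV|iV] := boolP (i \in V); first by rewrite -(h (Sub i iV)) -chi_s.
by rewrite -c_s !(chiM sb) (chi_eset ef) (negbTE iV) mulr0.
Qed.

Lemma corner_basic : split_basic chi1.
Proof.
split=> [j|].
  have c1 : chi1 j 1 = 1 by rewrite -pi_E chi1E (chi_eset ef) (valP j).
  split=> // x y; have [a <-] := pi_surj x; have [b <-] := pi_surj y.
  by rewrite -pi_M !chi1E; exact: (chiM sb).
have [m hm] := sb_nil sb; exists m => l hl rl.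
have -> : \prod_(x <- l) x = pi (\prod_(x <- map s l) x).
  by rewrite rmorph_prod big_map; apply: eq_bigr => x _; rewrite /= pi_s.
rewrite hm ?size_map // ?raddf0 // => _ /mapP [x hx ->]; exact/rad_s/rl.
Qed.

Lemma corner_idem : idem_family chi1 e1.
Proof.
split=> [i j|i j|].
- by rewrite chi1E (if_chi ef).
- by rewrite -pi_M (if_orth ef) -val_eqE; case: ifP => // _; rewrite raddf0.
- apply: etrans pi_E; rewrite /eset raddf_sum (big_sub V). exact: erefl.
Qed.

Variables (ord : rel I) (B1 : {vspace A1}).
Hypothesis hB1 : cborel chi1 e1 (sub_rel V ord) setT B1.
Notation sB := (linfun s @: B1)%VS.
Notation N1 := (nradv chi1 B1).
Notation AN1 := ({:A1} * N1)%VS.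

Lemma mem_sB x : x \in sB <-> c x = x /\ pi x \in B1.
Proof.
split=> [/memv_imgP [b hb ->]|[cx hx]].
  by rewrite lfunE c_s pi_s.
by apply/memv_imgP; exists (pi x); rewrite ?lfunE //= s_pi.
Qed.

Lemma s_sB b : b \in B1 -> s b \in sB.
Proof. by move=> hb; apply/mem_sB; rewrite c_s pi_s. Qed.

Lemma mem_sN n : n \in nradv chi sB <-> exists2 m, m \in N1 & n = s m.
Proof.
split=> [/N1P [/mem_sB [cn nB] rn]|[m /N1P [mB rm] ->]].
  by exists (pi n); rewrite ?s_pi //; apply/N1P; split=> //; apply/rad_s; rewrite s_pi.
by apply/N1P; split; [exact: s_sB|exact/rad_s].
Qed.

Lemma s_corner x : s x \in cornerv e V.
Proof. by apply/(memv_corner ef); exact: c_s. Qed.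

Lemma mem_sCN x : s x \in cradv chi e V sB <-> x \in AN1.
Proof.
split=> [h|].
  suff [y hy /s_inj ->] : exists2 y, y \in AN1 & s x = s y by [].
  move: (s x) h; apply: prodv_ind => [|y z [y' hy ->] [z' hz ->]|d y [y' hy ->]|u w hu hw].
  - by exists 0; rewrite ?mem0v ?linear0.
  - by exists (y' + z'); rewrite ?linearD ?rpredD.
  - by exists (d *: y'); rewrite ?linearZ ?rpredZ.
  have [m hm ->] := (mem_sN w).1 hw; exists (pi u * m); first by rewrite memv_mul ?memvf.
  by rewrite sM s_pi //; exact/(memv_corner ef).
move: x; apply: prodv_ind => [|x y hx hy|d x hx|u w _ hw].
- by rewrite linear0 mem0v.
- by rewrite linearD rpredD.
- by rewrite linearZ rpredZ.
- by rewrite sM; apply: memv_mul (s_corner u) _; apply/mem_sN; exists w.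
Qed.

(** Each condition concerns elements of the corner, which [s] and [pi] exchange with elements of
    [A1]; endomorphisms are transported by composing with [s] and [pi]. *)
Lemma corner_cborel : cborel chi e ord V sB.
Proof.
have T j : j \in [set: J] by rewrite inE.
have C1 x : x \in cornerv e V -> s (pi x) = x by move=> /(memv_corner ef); exact: s_pi.
have CT : cradv chi1 e1 setT B1 = AN1 by rewrite /cradv (cornerT corner_idem).
have CA x : x \in cornerv e1 setT by rewrite (cornerT corner_idem) memvf.
split.
- move=> i iV; rewrite -(s_e (Sub i iV)); exact/s_sB/(cb_idem hB1).
- by apply/subvP => x /mem_sB [cx _]; apply/(memv_corner ef).
- move=> x y /mem_sB [cx hx] /mem_sB [cy hy]; apply/mem_sB; rewrite cM cx cy pi_M.
  by split=> //; apply: (cb_mul hB1).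
- move=> n i k /mem_sN [m hm ->] iV kV nz.
  have := cb_tri hB1 hm (T (Sub i iV)) (T (Sub k kV)).
  rewrite /sord -val_eqE /sub_rel /= => -> //; apply: contraNneq nz => z.
  by rewrite -(s_e (Sub i iV)) -(s_e (Sub k kV)) -!sM /= z linear0.
- have [t [t1 t2 t3]] := cb_dual hB1.
  have fE (k : 'End(A1)) : exists f : 'End(A), forall a, f a = s (k (pi a)).
    by apply: lfun_intro => d x y; rewrite !linearP.
  have [F FE] := choice fE; exists [seq (s p.1, F p.2) | p <- t]; split.
  + move=> _ /mapP [p pt ->] a ha; cbn [fst snd]; rewrite FE; exact/s_sB/t1.
  + move=> _ /mapP [p pt ->] a b ha /mem_sB [cb hb]; cbn [fst snd].
    by rewrite !FE pi_M t2 // sM s_pi.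
  + move=> a ha; rewrite -{1}(C1 a ha) {1}(t3 (pi a) (CA _)) linear_sum big_map.
    by apply: eq_bigr => p _; cbn [fst snd]; rewrite FE sM.
- move=> i k a iV kV nki ha.
  have := cb_std hB1 (T (Sub i iV)) (T (Sub k kV)) nki (CA (pi a)).
  by rewrite CT => /mem_sCN; rewrite !sM !s_e C1.
- move=> j x jV hx xe hs n /mem_sN [m hm ->].
  rewrite -(C1 x hx) -sM; apply/mem_sCN; rewrite -CT.
  apply: (cb_socle hB1 (T (Sub j jV)) (CA _)) => //; first by rewrite -pi_M /= xe.
  move=> q hq; have [|d] := hs (s q); first by apply/mem_sN; exists q.
  rewrite -{1}(C1 x hx) -(s_e (Sub j jV)) -sM -linearZ -linearB => /mem_sCN hd.
  by exists d; rewrite CT pi_s; exact: hd.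
move=> i j phi iV jV phiC phib.
have [psi psiE] : exists psi : 'End(A1), forall x, psi x = pi (phi (s x)).
  by apply: lfun_intro => d x y; rewrite !linearP.
have seE m : m * e1 (Sub i iV) = m -> s m * e i = s m.
  by move=> {2}<-; rewrite sM (s_e (Sub i iV)).
have sN m : m \in N1 -> s m \in nradv chi sB by move=> hm; apply/mem_sN; exists m.
have [m hm me|m b hm me hb|x [_ xe hx]] :=
    cb_baer hB1 (T (Sub i iV)) (T (Sub j jV)) (phi := psi).
- have [h1 h2] := phiC _ (sN m hm) (seE m me); split=> //.
  by rewrite psiE -pi_M h2.
- have [h1 h2] := phiC _ (sN m hm) (seE m me).
  have bm : b * m \in N1.
    have /N1P [mB rm] := hm; apply/N1P; split; first exact: (cb_mul hB1).
    exact: (in_radMl corner_basic).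
  have bme : b * m * e1 (Sub i iV) = b * m by rewrite -mulrA me.
  have [h3 h4] := phiC _ (sN _ bm) (seE _ bme).
  have [d] := phib _ _ (sN m hm) (seE m me) (s_sB hb); rewrite -sM => hd.
  exists d; rewrite CT; apply/mem_sCN; rewrite !linearB linearZ sM !psiE (s_e (Sub j jV)) !C1 //.
exists (s x); split; first exact: s_corner.
  by rewrite -(s_e (Sub j jV)) -sM /= xe.
move=> n /mem_sN [m hm ->] ne; have me : m * e1 (Sub i iV) = m.
  by apply: s_inj; rewrite sM s_e.
have [d] := hx m hm me; rewrite CT => /mem_sCN hd; exists d; move: hd.
rewrite !linearB linearZ sM psiE (s_e (Sub j jV)) C1 //.
by have [] := phiC _ (sN m hm) (seE m me).
Qed.
End Transfer.
End VertexCorner.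

(** * Bound quiver algebras *)

Section BoundQuiverBasic.
Variables (K : fieldType) (Q : quiver).
Notation KQ := (pathalg K Q).
Implicit Types (x y z : KQ) (p q r : qpath Q) (i j : vertex Q).

Lemma supp_ind (P : KQ -> Prop) x : P 0 -> (forall y z, P y -> P z -> P (y + z)) ->
  (forall (c : K) y, P y -> P (c *: y)) ->
  (forall p, coeff p x != 0 -> P (pathof K p)) -> P x.
Proof.
move=> P0 PD PZ Pp; rewrite -[x]freeg_sumE big_seq; elim/big_ind: _ => // p px.
have -> : << coeff p x *g p >> = coeff p x *: pathof K p :> KQ.
  by apply/eqP/freeg_eqP => u; rewrite coeffZ !coeffU mul1r.
by apply/PZ/Pp; rewrite -mem_dom.
Qed.

Lemma coeff_path p q : coeff p (pathof K q) = (q == p)%:R :> K.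
Proof. by rewrite /pathof coeffU mul1r. Qed.

Lemma coeff_pathN p q : coeff p (pathof K q) != 0 -> p = q.
Proof. by rewrite coeff_path; case: (q =P p) => [-> //|_]; rewrite eqxx. Qed.

Lemma arrow_ideal0 m : arrow_ideal m (0 : KQ).
Proof. by move=> p; rewrite coeff0 eqxx. Qed.

Lemma arrow_idealD m x y : arrow_ideal m x -> arrow_ideal m y -> arrow_ideal m (x + y).
Proof.
move=> hx hy p; rewrite coeffD => h; have [px|px] := eqVneq (coeff p x) 0.
  by apply: hy; move: h; rewrite px add0r.
exact: hx.
Qed.

Lemma arrow_idealZ m (c : K) x : arrow_ideal m x -> arrow_ideal m (c *: x).
Proof.
by move=> hx p; rewrite coeffZ mulf_eq0 negb_or => /andP [_]; apply: hx.
Qed.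

Lemma path_mul p q : pathof K p * pathof K q = pathof_opt K (pcomp p q).
Proof. exact: kqmul_path. Qed.

Lemma arrow_idealM m n x y : arrow_ideal m x -> arrow_ideal n y -> arrow_ideal (m + n) (x * y).
Proof.
move=> hx hy; apply: (supp_ind (P := fun x => arrow_ideal (m + n) (x * y))) => [|u w hu hw|c u hu|p px].
- by rewrite mul0r; apply: arrow_ideal0.
- by rewrite mulrDl; apply: arrow_idealD.
- by rewrite -kqscaleAl; apply: arrow_idealZ.
apply: (supp_ind (P := fun y => arrow_ideal (m + n) (pathof K p * y))) => [|u w hu hw|c u hu|q qy].
- by rewrite mulr0; apply: arrow_ideal0.
- by rewrite mulrDr; apply: arrow_idealD.
- by rewrite -kqscaleAr; apply: arrow_idealZ.
rewrite path_mul; case E: (pcomp p q) => [r|] /=; last exact: arrow_ideal0.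
have [_ _ rE] := (pcompP p q r).1 E => t /coeff_pathN ->.
by rewrite /plen rE size_cat addnC leq_add ?hx ?hy.
Qed.

(** On KQ this is the character of the simple module at i; as a lift from the paths it inherits
    linearity. *)
Definition path_char i : KQ -> K^o := fglift (fun p => (p == triv i)%:R : K^o).

HB.instance Definition _ i := GRing.Linear.on (path_char i).

Lemma path_charE i p : path_char i (pathof K p) = (p == triv i)%:R.
Proof. by rewrite /path_char liftU scale1r. Qed.

Lemma path_charM i x y : path_char i (x * y) = (path_char i x : K) * path_char i y.
Proof.
apply: (supp_ind (P := fun x => path_char i (x * y) = (path_char i x : K) * path_char i y)).
- by rewrite mul0r linear0 mul0r.
- by move=> u w hu hw; rewrite mulrDl !linearD /= hu hw mulrDl.
- by move=> c u hu; rewrite -kqscaleAl !linearZ /= hu; exact: mulrA.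
move=> p _; apply: (supp_ind (P := fun y => path_char i (pathof K p * y) =
   (path_char i (pathof K p) : K) * path_char i y)).
- by rewrite mulr0 linear0 mulr0.
- by move=> u w hu hw; rewrite mulrDr !linearD /= hu hw mulrDr.
- by move=> c u hu; rewrite -kqscaleAr !linearZ /= hu; exact: mulrCA.
move=> q _; rewrite path_mul !path_charE -natrM mulnb.
case E: (pcomp p q) => [r|] /=.
  have [e1 e2 e3] := (pcompP p q r).1 E; rewrite path_charE; congr (_%:R); congr nat_of_bool.
  apply/eqP/andP => [re|[/eqP pE /eqP qE]].
    have a : parr q ++ parr p = [::] by rewrite -e3 re.
    have [q0 p0] : parr q = [::] /\ parr p = [::] by case: (parr q) a => //= ->.
    have qi : psrc q = i by rewrite -e2 re.
    have pi : psrc p = i by rewrite -e1 /ptgt q0 qi.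
    by split; apply/eqP/val_inj; rewrite [val _]surjective_pairing -/(psrc _) -/(parr _) ?pi ?p0 ?qi ?q0.
  apply: val_inj; rewrite [val _]surjective_pairing -/(psrc _) -/(parr _) e2 e3 pE qE.
  by [].
rewrite linear0; case: andP => // -[/eqP pE /eqP qE].
by move: E; rewrite pE qE pcomp_trivl eqxx.
Qed.

Lemma path_char1 i : path_char i 1 = 1.
Proof.
rewrite -[1 : KQ]/(kq1 K Q) /kq1 linear_sum (bigD1 i) //= path_charE eqxx big1 ?addr0 // => j ji.
rewrite path_charE; case: eqP => // /(congr1 (@psrc Q)) h.
by move: ji; rewrite -[j]/(psrc (triv j)) h eqxx.
Qed.

Lemma path_char_coeff i x : path_char i x = coeff (triv i) x.
Proof.
apply: (supp_ind (P := fun x => path_char i x = coeff (triv i) x)) => [|y z hy hz|c y hy|p _].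
- by rewrite linear0 coeff0.
- by rewrite linearD /= hy hz coeffD.
- by rewrite linearZ /= hy coeffZ.
- by rewrite path_charE coeff_path.
Qed.

Lemma triv_eta p : parr p = [::] -> p = triv (psrc p).
Proof. by move=> p0; apply: val_inj; rewrite [LHS]surjective_pairing -/(psrc _) -/(parr _) p0. Qed.

Variables (I : KQ -> Prop) (hI : admissible I) (A : falgType K) (phi : {linear KQ -> A}).
Hypothesis hA : bound_quiver_algebra I phi.

Lemma phiM x y : phi (x * y) = phi x * phi y.
Proof. by case: hA => -[_ h] _ _; exact: h. Qed.
Lemma phi1 : phi 1 = 1. Proof. by case: hA => -[h _] _ _. Qed.

(** An admissible ideal contains no element with a trivial path in its support, so the characters
    vanish on it and descend to A. *)
Lemma bound_quiver_chars : exists chi : vertex Q -> {linear A -> K^o},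
  forall i x, chi i (phi x) = path_char i x.
Proof.
have [_ ps pI] := hA.
suff h i : exists ch : {linear A -> K^o}, forall x, ch (phi x) = path_char i x.
  by have [chi chiE] := choice h; exists chi.
apply: (linear_factor (g := path_char i) ps) => x /pI Ix.
have [_ [m _ [_ I2]]] := hI; rewrite [LHS] path_char_coeff; apply/eqP/negPn/negP => /(I2 x Ix).
by [].
Qed.

Variable chi : vertex Q -> {linear A -> K^o}.
Hypothesis chiE : forall i x, chi i (phi x) = path_char i x.
Notation e := (videm phi).

(** A radical element lifts to a combination of nontrivial paths, so a product of m of them lifts to
    the m-th power of the arrow ideal, which is contained in I. *)
Lemma bound_quiver_basic : split_basic chi.
Proof.
have [_ ps pI] := hA; have [_ [m _ [mI _]]] := hI.
split=> [i|].
  split=> [|a b]; first by rewrite -phi1 chiE path_char1.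
  have [x <-] := ps a; have [y <-] := ps b; by rewrite -phiM !chiE path_charM.
exists m => s sm rs.
have [x xE ax] : exists2 x, phi x = \prod_(a <- s) a & arrow_ideal (size s) x.
  elim: s rs {sm} => [|a s IH] rs.
    by exists 1; rewrite ?big_nil ?phi1.
  have [|x xE ax] := IH; first by move=> b hb; apply: rs; rewrite inE hb orbT.
  have [y yE] := ps a; exists (y * x); first by rewrite phiM big_cons xE yE.
  rewrite -[size _]/(1 + size s)%N; apply: arrow_idealM ax => p py.
  rewrite lt0n; apply: contra py => /eqP /size0nil /triv_eta ->.
  by rewrite -path_char_coeff -chiE yE rs // mem_head.
by rewrite -xE; apply/pI/mI; rewrite -sm.
Qed.

Lemma bound_quiver_idem : idem_family chi e.
Proof.
split=> [i j|i j|].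
- rewrite chiE path_charE; congr (_%:R); congr nat_of_bool; apply/eqP/eqP => [h|-> //].
  by rewrite -[i]/(psrc (triv i)) -h.
- rewrite /videm -phiM path_mul pcomp_trivl /ptgt /= [j == i]eq_sym.
  by case: eqP => [->|_] //=; rewrite linear0.
- by rewrite -linear_sum -[X in phi X]/(1 : KQ) phi1.
Qed.
End BoundQuiverBasic.

(** * Deconcatenations in terms of idempotents *)

Section Deconcatenation.
Variables (K : fieldType) (Q : quiver).
Notation KQ := (pathalg K Q).
Implicit Types (p q r : qpath Q) (i j : vertex Q).
Variables (V1 V2 : {set vertex Q}) (v : vertex Q).

Lemma deconcatenation_sym : deconcatenation V1 V2 v -> deconcatenation V2 V1 v.
Proof.
by case=> h1 [h2 h3] h4 h5 h6; split; rewrite 1?setUC 1?setIC // => a; have [] := h6 a.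
Qed.

Hypothesis hdec : deconcatenation V1 V2 v.

Lemma sink_path p : sink v -> psrc p = v -> p = triv v.
Proof.
move=> sv pv; rewrite -pv; apply: triv_eta; have := valP p; rewrite /parr.
by case: (val p).2 => [//|a s] /= /andP [/eqP h _]; move: (sv a); rewrite h -/(psrc p) pv eqxx.
Qed.

Lemma source_path p : source v -> ptgt p = v -> p = triv v.
Proof.
move=> sv pv; have p0 : parr p = [::].
  move: pv; rewrite /ptgt /pend; case/lastP: (parr p) => [//|s a].
  by rewrite map_rcons last_rcons => h; move: (sv a); rewrite h eqxx.
by rewrite (triv_eta p0); congr triv; rewrite -pv /ptgt p0.
Qed.

(** A walk could change sides only at v, but it stops at a sink and cannot enter a source. *)
Lemma walk_side i (s : seq (arrow Q)) : walk i s -> let inV V := (i \in V) && all (fun a => (src a \in V) && (tgt a \in V)) s in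
  inV V1 || inV V2.
Proof.
have [hv _ hU hM hz] := hdec.
have cover j : (j \in V1) || (j \in V2) by rewrite -in_setU hU inE.
have vV : (v \in V1) && (v \in V2) by rewrite -in_setI hM inE.
elim: s i => [i _|a s IH i] /=; first by rewrite !andbT.
case/andP => /eqP <- ws; have h := IH _ ws.
have [z1 z2] := hz a; move: z1 z2; rewrite !inE.
have [sv|sv] := eqVneq (src a) v.
  by rewrite sv; case/andP: vV => -> -> /= _ _; case/orP: h => /andP [-> ->]; rewrite ?orbT.
have [tv|tv] := eqVneq (tgt a) v.
  have s0 : s = [::].
    case: s ws {IH h} => [//|b s] /= /andP [/eqP sb _]; case: hv => [sk|sc].
      by have := sk b; rewrite sb tv eqxx.
    by have := sc a; rewrite tv eqxx.
  rewrite s0 tv; case/andP: vV => -> -> _ _ /=; rewrite !andbT !andbb.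
  exact: cover.
rewrite /= => z1 z2; case/orP: h => /andP [t l]; rewrite t l ?andbT.
  by case/orP: (cover (src a)) => sa; move: z2; rewrite ?sa ?t //= => _; rewrite ?orbT.
by case/orP: (cover (src a)) => sa; move: z1; rewrite ?sa ?t //= ?andbT ?orbT.
Qed.

Lemma path_side p : path_in V1 p || path_in V2 p.
Proof. exact: walk_side (valP p). Qed.

Lemma path_in_tgt V p : path_in V p -> (psrc p \in V) /\ (ptgt p \in V).
Proof.
case/andP => h1 h2; split=> //; rewrite /ptgt /pend.
case/lastP: (parr p) h2 => [//|s a]; rewrite all_rcons => /andP [/andP [_ h] _].
by rewrite map_rcons last_rcons.
Qed.

Variables (I : KQ -> Prop) (A : falgType K) (phi : {linear KQ -> A}).
Hypothesis hA : bound_quiver_algebra I phi.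
Variable chi : vertex Q -> {linear A -> K^o}.
Hypothesis chiE : forall i x, chi i (phi x) = path_char i x.
Notation e := (videm phi).
Notation ph p := (phi (pathof K p)).

Lemma bound_quiver_ind (P : A -> Prop) : P 0 -> (forall a b, P a -> P b -> P (a + b)) ->
  (forall (c : K) a, P a -> P (c *: a)) -> (forall p, P (ph p)) -> forall a, P a.
Proof.
move=> P0 PD PZ Pp a; have [_ ps _] := hA; have [x <-] := ps a.
apply: (supp_ind (P := fun x => P (phi x))) => [|y z hy hz|c y hy|p _].
- by rewrite linear0.
- by rewrite linearD; apply: PD.
- by rewrite linearZ; apply: PZ.
- exact: Pp.
Qed.

Lemma idem_path i p : e i * ph p = if ptgt p == i then ph p else 0.
Proof.
by rewrite /videm -(phiM hA) path_mul pcomp_trivl; case: ifP => _ //=; rewrite linear0.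
Qed.

Lemma path_idem p i : ph p * e i = if psrc p == i then ph p else 0.
Proof.
by rewrite /videm -(phiM hA) path_mul pcomp_trivr; case: ifP => _ //=; rewrite linear0.
Qed.

Lemma eset_path V p : eset e V * ph p = if ptgt p \in V then ph p else 0.
Proof.
rewrite /eset mulr_suml; case: ifP => pV.
  rewrite (bigD1 (ptgt p)) //= idem_path eqxx big1 ?addr0 // => i /andP [_ ip].
  by rewrite idem_path eq_sym (negbTE ip).
by rewrite big1 // => i iV; rewrite idem_path; case: eqP => // pi; rewrite pi iV in pV.
Qed.

Lemma path_eset V p : ph p * eset e V = if psrc p \in V then ph p else 0.
Proof.
rewrite /eset mulr_sumr; case: ifP => pV.
  rewrite (bigD1 (psrc p)) //= path_idem eqxx big1 ?addr0 // => i /andP [_ ip].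
  by rewrite path_idem eq_sym (negbTE ip).
by rewrite big1 // => i iV; rewrite path_idem; case: eqP => // pi; rewrite pi iV in pV.
Qed.

Lemma sink_idem : sink v -> forall a, a * e v = (chi v a : K) *: e v.
Proof.
move=> sv; apply: bound_quiver_ind => [|a b ha hb|c a ha|p].
- by rewrite mul0r linear0 scale0r.
- by rewrite mulrDl ha hb -scalerDl linearD.
- by rewrite -scalerAl ha scalerA linearZ.
rewrite path_idem chiE path_charE; case: (psrc p =P v) => [pv|pv].
  by rewrite (sink_path sv pv) eqxx scale1r.
by case: eqP => [pE|_]; [case: pv; rewrite pE|rewrite scale0r].
Qed.

Lemma source_idem : source v -> forall a, e v * a = (chi v a : K) *: e v.
Proof.
move=> sv; apply: bound_quiver_ind => [|a b ha hb|c a ha|p].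
- by rewrite mulr0 linear0 scale0r.
- by rewrite mulrDr ha hb -scalerDl linearD.
- by rewrite -scalerAr ha scalerA linearZ.
rewrite idem_path chiE path_charE; case: (ptgt p =P v) => [pv|pv].
  by rewrite (source_path sv pv) eqxx scale1r.
by case: eqP => [pE|_]; [case: pv; rewrite pE|rewrite scale0r].
Qed.

Lemma deconcatenation_zero a i k : i \in V1 -> i != v -> k \in V2 -> k != v ->
  e k * a * e i = 0 /\ e i * a * e k = 0.
Proof.
move=> i1 iv k2 kv; have [_ _ _ hM _] := hdec.
have i2 : i \notin V2.
  by apply: contra iv => i2; rewrite -in_set1 -hM inE i1.
have k1 : k \notin V1.
  by apply: contra kv => k1; rewrite -in_set1 -hM inE k1.
move: a; apply: bound_quiver_ind => [|a b [h1 h2] [h3 h4]|c a [h1 h2]|p].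
- by rewrite !mulr0 !mul0r.
- by rewrite !mulrDr !mulrDl h1 h2 h3 h4 addr0.
- by rewrite -!scalerAr -!scalerAl h1 h2 scaler0.
rewrite !idem_path; case/orP: (path_side p) => /path_in_tgt [h1 h2]; split.
- by case: eqP => [pk|_]; rewrite ?mul0r //; rewrite -pk h2 in k1.
- case: eqP => [pi|_]; rewrite ?mul0r // path_idem; case: eqP => // pk.
  by rewrite -pk h1 in k1.
- case: eqP => [pk|_]; rewrite ?mul0r // path_idem; case: eqP => // pi.
  by rewrite -pi h1 in i2.
- by case: eqP => [pi|_]; rewrite ?mul0r //; rewrite -pi h2 in i2.
Qed.

Hypothesis hI : admissible I.

Lemma deconcatenation_deconcat : deconcat chi e v V1 V2.
Proof.
have [hv _ hU hM _] := hdec; split=> // [a i k|a]; first exact: deconcatenation_zero.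
have ef := bound_quiver_idem hA chiE.
case: hv => [/sink_idem sk|/source_idem sc]; first by rewrite -mulrA sk -scalerAr (eii ef).
by rewrite sc -scalerAl (eii ef).
Qed.

(** A path with both ends in V1 that is not inside V1 would lie in V2 and have both ends at v, hence
    be trivial; so the corner contains nothing beyond the paths inside V1. *)
Lemma path_spanP x : path_span phi V1 x <-> eset e V1 * x * eset e V1 = x.
Proof.
have [hv _ hU hM _] := hdec.
split=> [[f hf <-]|<-].
  apply: (supp_ind (P := fun f => eset e V1 * phi f * eset e V1 = phi f)) => [|y z hy hz|c y hy|p /hf].
  - by rewrite linear0 mulr0 mul0r.
  - by rewrite linearD mulrDr mulrDl hy hz.
  - by rewrite linearZ -scalerAr -scalerAl hy.
  - by move=> /path_in_tgt [h1 h2]; rewrite eset_path h2 path_eset h1.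
move: x; apply: bound_quiver_ind => [|a b [f1 s1 h1] [f2 s2 h2]|c a [f1 s1 h1]|p].
- by exists 0 => [p|]; rewrite ?coeff0 ?eqxx // linear0 mulr0 mul0r.
- exists (f1 + f2) => [p|]; last by rewrite linearD mulrDr mulrDl h1 h2.
  rewrite coeffD => h; have [z|z] := eqVneq (coeff p f1) 0; last exact: s1.
  by apply: s2; rewrite z add0r in h.
- exists (c *: f1) => [p|]; last by rewrite linearZ -scalerAr -scalerAl h1.
  by rewrite coeffZ mulf_eq0 negb_or => /andP [_]; apply: s1.
have [pV|pV] := boolP (path_in V1 p).
  exists (pathof K p) => [q /coeff_pathN -> //|].
  by have [h1 h2] := path_in_tgt pV; rewrite eset_path h2 path_eset h1.
exists 0 => [q|]; first by rewrite coeff0 eqxx.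
rewrite linear0 eset_path; case: ifP => t1; rewrite ?mul0r // path_eset; case: ifP => // s1.
have := path_side p; rewrite (negbTE pV) /= => /path_in_tgt [s2 t2].
have pv : psrc p = v by apply/eqP; rewrite -in_set1 -hM inE s1.
have tv : ptgt p = v by apply/eqP; rewrite -in_set1 -hM inE t1.
have pE : p = triv v by case: hv => [/sink_path|/source_path]; apply.
by move: pV; rewrite pE /path_in /= -pv s1.
Qed.
End Deconcatenation.

(** This moves the hypotheses on a vertex quotient into A: the subspace obtained is the copy of [B1]
    that enters [glue]. *)
Lemma borel_corner (K : fieldType) (Q : quiver) (I : pathalg K Q -> Prop) (A : falgType K)
    (phi : {linear pathalg K Q -> A}) (chi : vertex Q -> {linear A -> K^o})
    (ord : rel (vertex Q)) (V1 V2 : {set vertex Q}) (v : vertex Q)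
    (A1 : falgType K) (pi1 : {lrmorphism A -> A1})
    (L1 : {i : vertex Q | i \in V1} -> lmodType A1) (B1 : {vspace A1}) :
  admissible I -> bound_quiver_algebra I phi ->
  (forall i x, chi i (phi x) = path_char i x) -> deconcatenation V1 V2 v ->
  vertex_quotient phi V1 pi1 -> vertex_simples (fun i => pi1 (videm phi (val i))) L1 ->
  regular_exact_Borel L1 (sub_rel V1 ord) B1 ->
  (forall i, i \in V1 -> pi1 (videm phi i) \in B1) ->
  exists2 B : {vspace A}, cborel chi (videm phi) ord V1 B
    & forall x, x \in B <-> in_path_span phi V1 pi1 B1 x.
Proof.
move=> hI hA chiE hdec [pis pik] hL1 hB1 eB1.
have sb := bound_quiver_basic hI hA chiE; have ef := bound_quiver_idem hA chiE.
have dc := deconcatenation_deconcat hdec hA chiE.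
have cM := c1_mul sb ef dc.
have [s sE] := corner_section ef cM pis pik.
have [chi1 chi1E] := choice (corner_char sb ef pis pik).
have sb1 := corner_basic sb ef pis pik sE chi1E.
have ef1 := corner_idem ef pik chi1E.
have hL := vertex_simple_char sb1 ef1 hL1.
have hc := borel_cborel sb1 ef1 hL hB1 (fun j => eB1 _ (valP j)).
exists (linfun s @: B1)%VS; first exact: (corner_cborel sb ef cM pis pik sE chi1E hc).
move=> x; rewrite /in_path_span; split=> [/(mem_sB ef pis pik sE) [cx hx]|[/(path_spanP hdec hA) cx hx]].
  by split=> //; apply/(path_spanP hdec hA).
by apply/(mem_sB ef pis pik sE).
Qed.

Theorem proposition58
  (K : closedFieldType) (Q : quiver)
  (hQ : connected_on [set: vertex Q])
  (I : pathalg K Q -> Prop) (hI : admissible I)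
  (A : falgType K) (phi : {linear pathalg K Q -> A})
  (hA : bound_quiver_algebra I phi)
  (L : vertex Q -> lmodType A) (hL : vertex_simples (videm phi) L)
  (ord : rel (vertex Q)) (hord : partial_order ord)
  (hqh : quasi_hereditary L ord)
  (V1 V2 : {set vertex Q}) (v : vertex Q)
  (hdec : deconcatenation V1 V2 v)
  (A1 : falgType K) (pi1 : {lrmorphism A -> A1})
  (hA1 : vertex_quotient phi V1 pi1)
  (L1 : {i : vertex Q | i \in V1} -> lmodType A1)
  (hL1 : vertex_simples (fun i => pi1 (videm phi (val i))) L1)
  (hqh1 : quasi_hereditary L1 (sub_rel V1 ord))
  (A2 : falgType K) (pi2 : {lrmorphism A -> A2})
  (hA2 : vertex_quotient phi V2 pi2)
  (L2 : {i : vertex Q | i \in V2} -> lmodType A2)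
  (hL2 : vertex_simples (fun i => pi2 (videm phi (val i))) L2)
  (hqh2 : quasi_hereditary L2 (sub_rel V2 ord))
  (B1 : {vspace A1}) (hB1 : regular_exact_Borel L1 (sub_rel V1 ord) B1)
  (heB1 : forall i, i \in V1 -> pi1 (videm phi i) \in B1)
  (B2 : {vspace A2}) (hB2 : regular_exact_Borel L2 (sub_rel V2 ord) B2)
  (heB2 : forall i, i \in V2 -> pi2 (videm phi i) \in B2)
  (hB : exists B : {vspace A}, regular_exact_Borel L ord B) :
  exists2 B : {vspace A},
    (forall x, x \in B <-> glue phi V1 V2 pi1 pi2 B1 B2 x) &
    regular_exact_Borel L ord B.
Proof.
have [chi chiE] := bound_quiver_chars hI hA.
have sb := bound_quiver_basic hI hA chiE; have ef := bound_quiver_idem hA chiE.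
have dc := deconcatenation_deconcat hdec hA chiE.
have hced := deconcatenation_sym hdec.
have [C1 c1 m1] := borel_corner hI hA chiE hdec hA1 hL1 hB1 heB1.
have [C2 c2 m2] := borel_corner hI hA chiE hced hA2 hL2 hB2 heB2.
have hLc := vertex_simple_char sb ef hL.
exists (C1 + C2)%VS => [x|].
  split=> [/memv_addP [x1 /m1 h1 [x2 /m2 h2 ->]]|[x1 [x2 [/m1 h1 /m2 h2 ->]]]].
    by exists x1, x2.
  exact: memv_add.
apply: (cborel_borel sb ef hLc hord); apply: (glue_cborel sb ef dc c1 c2).
have [hv _ _ _ _] := hdec; case: hv => [sv|sv]; [left|right]; last exact: (source_idem hA chiE sv).
have sk := sink_idem hA chiE sv; split=> //.
  have [B' hB'] := hB; have [f ff fB] := borel_idem sb ef hLc hB'.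
  exact: (sink_conditionP sb ef hord dc c1 c2 sk ff (borel_cborel sb ff hLc hB' fB)).
have [B' hB'] := hB; have [f ff fB] := borel_idem sb ef hLc hB'.
rewrite addvC.
exact: (sink_conditionP sb ef hord (deconcat_sym dc) c2 c1 sk ff (borel_cborel sb ff hLc hB' fB)).
Qed.
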